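(* Let $(R,\mathfrak{m})$ be a commutative Noetherian local ring, $\mathcal{S}$ a Serre class of $R$-modules, and $M$ a finitely generated $R$-module. Then the following are equivalent: (i) $M$ is an $\mathcal{S}$-Cohen-Macaulay $R$-module. (ii) For any $\mathfrak{p}\in\mathcal{S}\text{-}\mathrm{Supp}_R(M)$, $M_{\mathfrak{p}}$ is Cohen-Macaulay and $\mathrm{ht}_M(\mathfrak{p})+\dim(R/\mathfrak{p})=\dim M$. (iii) For any $\mathfrak{p}\in\mathcal{S}\text{-}\mathrm{Supp}_R(M)$, $\mathcal{S}\text{-}E.\mathrm{grade}_R(\mathfrak{p},M)=\mathcal{S}\text{-}\mathrm{ht}_M(\mathfrak{p})=\mathrm{ht}_M(\mathfrak{p})$ and $\mathrm{ht}_M(\mathfrak{p})+\dim(R/\mathfrak{p})=\dim M$. (iv) $\mathrm{depth}_{R_{\mathfrak{p}}}(M_{\mathfrak{p}})=\dim M-\dim(R/\mathfrak{p})$ for any $\mathfrak{p}\in\mathcal{S}\text{-}\mathrm{Supp}_R(M)$. (v) If $x_1,\dots,x_d$ is a system of parameters for $M$ (where $d=\dim M$), then $\dim(R/\mathfrak{p})=\dim M-i$ for all $0\le i\le d$ and all $\mathfrak{p}\in\mathcal{S}\text{-}\mathrm{Ass}_R(M/(x_1,\dots,x_i)M)$. (vi) $\mathrm{ht}(\mathfrak{p}/\mathfrak{q})+\mathrm{ht}_M(\mathfrak{q})=\mathrm{ht}_M(\mathfrak{p})$ for all $\mathfrak{q}\subseteq\mathfrak{p}$ in $\mathcal{S}\text{-}\mathrm{Supp}_R(M)\cup\{\mathfrak{m}\}$;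 $M_{\mathfrak{p}}$ is Cohen-Macaulay for all $\mathfrak{p}\in\mathcal{S}\text{-}\mathrm{Supp}_R(M)$; and $\dim(R/\mathfrak{p})=\dim M$ for all $\mathfrak{p}\in\min(\mathcal{S}\text{-}\mathrm{Supp}_R(M))$.
   Context: A Serre class $\mathcal{S}$ of $R$-modules is a (nonempty) class of $R$-modules such that for every exact sequence $0\to L\to M\to N\to 0$ of $R$-modules, $M\in\mathcal{S}$ if and only if $L\in\mathcal{S}$ and $N\in\mathcal{S}$. A sequence $x_1,\dots,x_r$ in $R$ is a weak $M$-sequence with respect to $\mathcal{S}$ if for each $i=1,\dots,r$ the module $((x_1,\dots,x_{i-1})M:_M x_i)/(x_1,\dots,x_{i-1})M$ belongs to $\mathcal{S}$, where $(N:_M x)=\{m\in M: xm\in N\}$. A finitely generated module $M$ over a local ring is $\mathcal{S}$-Cohen-Macaulay if every system of parameters of $M$ is a weak $M$-sequence with respect to $\mathcal{S}$. For an $R$-module $L$: $\mathcal{S}\text{-}\mathrm{Supp}_R(L)=\{\mathfrak{p}\in\mathrm{Supp}_R L: R/\mathfrak{p}\notin\mathcal{S}\}$ and $\mathcal{S}\text{-}\mathrm{Ass}_R(L)=\{\mathfrak{p}\in\mathrm{Ass}_R L: R/\mathfrak{p}\notin\mathcal{S}\}$. For a set $X$ of primes, $\min(X)$ is the set of members of $X$ minimal under inclusion. For $\mathfrak{p}\in\mathrm{Supp}_R M$, $\mathrm{ht}_M(\mathfrak{p})=\dim M_{\mathfrak{p}}$; $\mathrm{ht}(\mathfrak{p}/\mathfrak{q})$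 is the height of $\mathfrak{p}/\mathfrak{q}$ in $R/\mathfrak{q}$. For an ideal $\mathfrak{a}$, $\mathcal{S}\text{-}\mathrm{ht}_M(\mathfrak{a})=\inf\{\mathrm{ht}_M(\mathfrak{q}):\mathfrak{q}\in\mathcal{S}\text{-}\mathrm{Supp}_R(M),\ \mathfrak{a}\subseteq\mathfrak{q}\}$ and $\mathcal{S}\text{-}E.\mathrm{grade}_R(\mathfrak{a},M)=\inf\{i\ge0:\mathrm{Ext}^i_R(R/\mathfrak{a},M)\notin\mathcal{S}\}$, with $\inf\emptyset=+\infty$. *)

(* Defs.v *)
From HB Require Import structures.
From mathcomp Require Import all_boot all_order all_algebra.
From mathcomp Require Import generic_quotient ring_quotient.
From mathcomp Require Import finmap.
From mathcomp Require Import boolp classical_sets functions cardinality fsbigop.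
From mathcomp Require Import constructive_ereal.
From mathcomp Require Import ring.

Set Implicit Arguments.
Unset Strict Implicit.
Unset Printing Implicit Defensive.

Import GRing.Theory.
Local Open Scope classical_set_scope.
Local Open Scope ring_scope.
Local Open Scope quotient_scope.

(* Conventions: the bundled library predicates are used for submodules        *)
(* (submodClosed V), arbitrary ideals (submodClosed R^o), proper ideals       *)
(* (idealr R) and prime ideals (prime_idealr R). Collections of primes are    *)
(* Prop-valued predicates, since prime_idealr R is too large for [set _].     *)

Section Submodule.
Variables (R : comNzRingType) (V : lmodType R) (N : submodClosed V).

Record submod := Submod { submod_val : V; _ : submod_val \in N }.

HB.instance Definition _ := [isSub for submod_val].
HB.instance Definition _ := [Choice of submod by <:].
HB.instance Definition _ := [SubChoice_isSubLmodule of submod by <:].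

Fact submod_val_linear : linear submod_val.
Proof. by []. Qed.

HB.instance Definition _ :=
  GRing.isLinear.Build R submod V _ submod_val submod_val_linear.

End Submodule.

Section QuotientModule.
Variables (R : comNzRingType) (V : lmodType R) (N : submodClosed V).

Definition zmodClosed_of_submod : zmodClosed V :=
  HB.pack (N : {pred V})
    (GRing.isZmodClosed.Build V (N : {pred V})
      (GRing.submod_closedB (submodClosedP N))).

Definition quotmod := {ideal_quot zmodClosed_of_submod}.

HB.instance Definition _ := GRing.Zmodule.on quotmod.
HB.instance Definition _ := EqQuotient.on quotmod.

Lemma quotmod_eqP (x y : V) :
  reflect (\pi_quotmod x = \pi_quotmod y) (x - y \in N).
Proof.
by rewrite [_ \in N](Quotient.idealrBE zmodClosed_of_submod); apply: eqP.
Qed.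

Definition quotmod_scale (a : R) := lift_op1 quotmod ( *:%R a).

Lemma pi_quotmod_scale a x :
  quotmod_scale a (\pi_quotmod x) = \pi_quotmod (a *: x).
Proof.
unlock quotmod_scale; apply/quotmod_eqP; rewrite -scalerBr rpredZ //.
by apply/quotmod_eqP; rewrite reprK.
Qed.

Lemma pi_quotmodD : {morph \pi_quotmod : x y / x + y}.
Proof. exact: raddfD. Qed.

Fact quotmod_scalerA a b z :
  quotmod_scale a (quotmod_scale b z) = quotmod_scale (a * b) z.
Proof. by rewrite -[z]reprK !pi_quotmod_scale scalerA. Qed.

Fact quotmod_scale1r : left_id 1 quotmod_scale.
Proof. by move=> z; rewrite -[z]reprK pi_quotmod_scale scale1r. Qed.

Fact quotmod_scalerDr : right_distributive quotmod_scale +%R.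
Proof.
move=> a y z; rewrite -[y]reprK -[z]reprK -pi_quotmodD !pi_quotmod_scale.
by rewrite scalerDr pi_quotmodD.
Qed.

Fact quotmod_scalerDl z : {morph quotmod_scale^~ z : a b / a + b}.
Proof.
by move=> a b; rewrite -[z]reprK !pi_quotmod_scale scalerDl pi_quotmodD.
Qed.

HB.instance Definition _ := GRing.Zmodule_isLmodule.Build R quotmod
  quotmod_scalerA quotmod_scale1r quotmod_scalerDr quotmod_scalerDl.

End QuotientModule.

Section Localization.
Variables (R : comNzRingType) (p : prime_idealr R).

Fact regular_scaleE (a b : R) : a *: (b : R^o) = a * b :> R.
Proof. by []. Qed.

(* M_p is (M * (R \ p)) modulo (m, s) ~ (n, t) iff u (t m) = u (s n) for some *)
(* u outside p; the ring R_p is obtained from the regular module R^o.         *)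
Definition denom := {s : R | s \notin p}.

Definition denom1 : denom :=
  exist (fun s => is_true (s \notin p)) 1 (negbT (idealr1 p)).

Fact denomM_subproof (s t : denom) : sval s * sval t \notin p.
Proof. by rewrite prime_idealrM negb_or (valP s) (valP t). Qed.

Definition denomM (s t : denom) : denom :=
  exist (fun s => is_true (s \notin p)) _ (denomM_subproof s t).

Section Module.
Variable M : lmodType R.
Implicit Types x y z : M * denom.

Definition loc_equiv x y : bool :=
  `[< exists u : denom,
      sval u *: (sval y.2 *: x.1) = sval u *: (sval x.2 *: y.1) >].

Fact loc_equiv_is_equiv : equiv_class_of loc_equiv.
Proof.
split.
- by move=> x; apply/asboolP; exists denom1.
- by move=> x y; apply: asbool_equiv_eq; split=> -[u e]; exists u.
- move=> y x z /asboolP[u e] /asboolP[v f]; apply/asboolP.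
  exists (denomM (denomM u v) y.2); rewrite /= !scalerA.
  transitivity ((sval v * sval z.2) *: (sval u *: (sval y.2 *: x.1))).
    by rewrite !scalerA; congr (_ *: _); ring.
  rewrite e.
  transitivity ((sval u * sval x.2) *: (sval v *: (sval z.2 *: y.1))).
    by rewrite !scalerA; congr (_ *: _); ring.
  by rewrite f !scalerA; congr (_ *: _); ring.
Qed.

Canonical loc_equivRel := EquivRelPack loc_equiv_is_equiv.
Canonical loc_encModRel := defaultEncModRel loc_equiv.

Definition locmod := {eq_quot loc_equiv}.

HB.instance Definition _ := EqQuotient.on locmod.
HB.instance Definition _ := Choice.on locmod.

Definition locfrac (m : M) (s : denom) : locmod := \pi_locmod (m, s).

Lemma locfracP m s n t :
  locfrac m s = locfrac n t <->
  exists u : denom, sval u *: (sval t *: m) = sval u *: (sval s *: n).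
Proof.
split=> [/eqP|e]; first by rewrite piE => /asboolP.
by apply/eqP; rewrite piE; apply/asboolP.
Qed.

Lemma locfracE (z : locmod) : z = locfrac (repr z).1 (repr z).2.
Proof. by rewrite /locfrac -surjective_pairing reprK. Qed.

Lemma locfrac_eq m s n t :
  sval t *: m = sval s *: n -> locfrac m s = locfrac n t.
Proof. by move=> e; apply/locfracP; exists denom1; rewrite e. Qed.

Lemma repr_locfrac m s : exists u : denom,
  sval u *: (sval (repr (locfrac m s)).2 *: m)
  = sval u *: (sval s *: (repr (locfrac m s)).1).
Proof. by apply/locfracP; rewrite -locfracE. Qed.

Definition loc_zero : locmod := locfrac 0 denom1.
Definition loc_opp (z : locmod) : locmod :=
  locked (locfrac (- (repr z).1) (repr z).2).
Definition loc_add (y z : locmod) : locmod :=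
  locked (locfrac (sval (repr z).2 *: (repr y).1 + sval (repr y).2 *: (repr z).1)
            (denomM (repr y).2 (repr z).2)).

Lemma loc_oppE m s : loc_opp (locfrac m s) = locfrac (- m) s.
Proof.
rewrite /loc_opp -lock; apply/locfracP.
have [u e] := repr_locfrac m s.
by exists u; rewrite !scalerN e.
Qed.

Lemma loc_addE m s n t :
  loc_add (locfrac m s) (locfrac n t)
  = locfrac (sval t *: m + sval s *: n) (denomM s t).
Proof.
rewrite /loc_add -lock; apply/locfracP.
have [u] := repr_locfrac m s; have [v] := repr_locfrac n t.
move: (repr (locfrac m s)) (repr (locfrac n t)) => [m' s'] [n' t'] /= f e.
exists (denomM u v); rewrite /= !scalerDr !scalerA; congr (_ + _).
  transitivity ((sval v * sval t * sval t') *: (sval u *: (sval s *: m'))).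
    by rewrite !scalerA; congr (_ *: _); ring.
  by rewrite -e !scalerA; congr (_ *: _); ring.
transitivity ((sval u * sval s * sval s') *: (sval v *: (sval t *: n'))).
  by rewrite !scalerA; congr (_ *: _); ring.
by rewrite -f !scalerA; congr (_ *: _); ring.
Qed.

Fact loc_addA : associative loc_add.
Proof.
move=> x y z; rewrite [x]locfracE [y]locfracE [z]locfracE !loc_addE.
apply: locfrac_eq; rewrite /= !scalerDr !scalerA -addrA.
by congr (_ *: _ + (_ *: _ + _ *: _)); ring.
Qed.

Fact loc_addC : commutative loc_add.
Proof.
move=> x y; rewrite [x]locfracE [y]locfracE !loc_addE.
apply: locfrac_eq; rewrite /= !scalerDr !scalerA addrC.
by congr (_ *: _ + _ *: _); ring.
Qed.

Fact loc_add0 : left_id loc_zero loc_add.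
Proof.
move=> x; rewrite [x]locfracE /loc_zero loc_addE.
by apply: locfrac_eq; rewrite /= scaler0 add0r scale1r mul1r.
Qed.

Fact loc_addN : left_inverse loc_zero loc_opp loc_add.
Proof.
move=> x; rewrite [x]locfracE loc_oppE loc_addE /loc_zero.
by apply: locfrac_eq; rewrite /= scalerN addNr !scaler0.
Qed.

HB.instance Definition _ :=
  GRing.isZmodule.Build locmod loc_addA loc_addC loc_add0 loc_addN.

Lemma locfracD m s n t :
  locfrac m s + locfrac n t = locfrac (sval t *: m + sval s *: n) (denomM s t).
Proof. exact: loc_addE. Qed.

Lemma locfrac0 : 0 = locfrac 0 denom1.
Proof. by []. Qed.

End Module.

Definition locring := locmod R^o.

HB.instance Definition _ := GRing.Zmodule.on locring.

Definition loc_act (M : lmodType R) (c : locring) (z : locmod M) : locmod M :=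
  locked (locfrac ((repr c).1 *: (repr z).1) (denomM (repr c).2 (repr z).2)).

Lemma loc_actE (M : lmodType R) (a : R) s (m : M) t :
  loc_act (@locfrac R^o a s) (locfrac m t) = locfrac (a *: m) (denomM s t).
Proof.
rewrite /loc_act -lock; apply/locfracP.
have [u] := @repr_locfrac R^o a s; have [v] := repr_locfrac m t.
move: (repr (@locfrac R^o a s)) (repr (locfrac m t)) => [a' s'] [n' t'] /= f e.
exists (denomM u v); rewrite /= !scalerA.
rewrite !regular_scaleE in e.
transitivity ((sval u * (sval s * a')) *: (sval v *: (sval t *: n'))).
  by rewrite !scalerA; congr (_ *: _); ring.
by rewrite -e -f !scalerA; congr (_ *: _); ring.
Qed.

Section ModuleAxioms.
Variable M : lmodType R.

Fact loc_actA (b c : locring) (z : locmod M) :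
  loc_act b (loc_act c z) = loc_act (loc_act b c : locring) z.
Proof.
rewrite [b]locfracE [c]locfracE [z]locfracE !loc_actE.
apply: locfrac_eq; rewrite /= regular_scaleE !scalerA.
by congr (_ *: _); ring.
Qed.

Fact loc_act1 : left_id (@locfrac R^o 1 denom1 : locring) (@loc_act M).
Proof.
move=> z; rewrite [z]locfracE loc_actE.
by apply: locfrac_eq; rewrite /= scale1r mul1r.
Qed.

Fact loc_actDr : right_distributive (@loc_act M) +%R.
Proof.
move=> c y z; rewrite [c]locfracE [y]locfracE [z]locfracE !(locfracD, loc_actE).
apply: locfrac_eq; rewrite /= !scalerDr !scalerA.
by congr (_ *: _ + _ *: _); ring.
Qed.

Fact loc_actDl (z : locmod M) : {morph (@loc_act M)^~ z : b c / b + c}.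
Proof.
move=> b c; rewrite [b]locfracE [c]locfracE [z]locfracE !(locfracD, loc_actE).
apply: locfrac_eq; rewrite /= !regular_scaleE !(scalerDl, scalerDr) !scalerA.
by congr (_ *: _ + _ *: _); ring.
Qed.

End ModuleAxioms.

Definition loc_mul : locring -> locring -> locring := @loc_act R^o.

Fact loc_mulC : commutative loc_mul.
Proof.
move=> b c; rewrite [b]locfracE [c]locfracE /loc_mul !loc_actE.
by apply: locfrac_eq; rewrite /= !regular_scaleE; ring.
Qed.

Fact loc_mulA : associative loc_mul.
Proof. by move=> a b c; exact: loc_actA. Qed.

Fact loc_mulDl : left_distributive loc_mul +%R.
Proof. by move=> a b c; exact: loc_actDl. Qed.

Fact loc_1neq0 : (@locfrac R^o 1 denom1 : locring) != 0.
Proof.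
apply/eqP=> /locfracP[u]; rewrite !regular_scaleE !mulr1 !mulr0 => u0.
by have /negP[] := valP u; rewrite [X in X \in _]u0; exact: idealr0.
Qed.

HB.instance Definition _ := GRing.Zmodule_isComNzRing.Build locring
  loc_mulA loc_mulC (@loc_act1 R^o) loc_mulDl loc_1neq0.

HB.instance Definition _ (M : lmodType R) :=
  GRing.Zmodule_isLmodule.Build locring (locmod M)
    (@loc_actA M) (@loc_act1 M) (@loc_actDr M) (@loc_actDl M).

End Localization.

Section SubmoduleOfSet.
Variables (R : comNzRingType) (V : lmodType R).

Definition submod_set (A : set V) : Prop :=
  A 0 /\ forall (a : R) u v, A u -> A v -> A (a *: u + v).

Variables (A : set V) (HA : submod_set A).

Fact submod_set_closed : submod_closed (fun x => `[< A x >] : bool).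
Proof.
case: HA => A0 AD; split=> [|a u v]; first exact/asboolP.
by move=> /asboolP Au /asboolP Av; apply/asboolP/AD.
Qed.

Definition mk_submod : submodClosed V :=
  HB.pack (fun x => `[< A x >])
    (GRing.isSubmodClosed.Build R V (fun x => `[< A x >])
      (GRing.submod_closed_semi submod_set_closed)).

Lemma mem_mk_submod x : x \in mk_submod <-> A x.
Proof. by split=> /asboolP. Qed.

End SubmoduleOfSet.

Section SubmoduleConstructions.
Variables (R : comNzRingType) (V : lmodType R).

(* (x_1, ..., x_r) V; only the values of f below size x matter. *)
Fact seq_submod_subproof (x : seq R) :
  submod_set [set m : V | exists f : nat -> V,
                m = \sum_(j < size x) x`_j *: f j].
Proof.
split=> [|a u v [f ->] [g ->]].
  by exists (fun=> 0); rewrite big1 // => i _; rewrite scaler0.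
exists (fun j => a *: f j + g j); rewrite scaler_sumr -big_split /=.
by apply: eq_bigr => i _; rewrite scalerDr !scalerA mulrC.
Qed.

Definition seq_submod (x : seq R) : submodClosed V :=
  mk_submod (seq_submod_subproof x).

Fact colon_subproof (N : submodClosed V) (x : R) :
  submod_set [set m : V | x *: m \in N].
Proof.
split=> [|a u v /= Nu Nv]; first by rewrite /= scaler0 rpred0.
by rewrite scalerDr scalerA mulrC -scalerA rpredD // rpredZ.
Qed.

Definition colon (N : submodClosed V) (x : R) : submodClosed V :=
  mk_submod (colon_subproof N x).

Fact restrict_subproof (Z B : submodClosed V) :
  submod_set [set z : submod Z | submod_val z \in B].
Proof.
split=> [|a u v Bu Bv]; first by rewrite /mkset linear0 rpred0.
by rewrite /mkset linearP rpredD // rpredZ.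
Qed.

(* Z / B, where B is included in Z in all uses. *)
Definition subquot (Z B : submodClosed V) : lmodType R :=
  quotmod (mk_submod (restrict_subproof Z B)).

End SubmoduleConstructions.

Section Ideals.
Variable R : comNzRingType.

Fact ideal_of_subproof (p : prime_idealr R) :
  submod_set [set a : R^o | (a : R) \in p].
Proof.
split=> [|a u v pu pv] /=; first exact: rpred0.
by apply: rpredD => //; apply: idealMr.
Qed.

Definition ideal_of (p : prime_idealr R) : submodClosed R^o :=
  mk_submod (ideal_of_subproof p).

(* idealr only has proper ideals. *)
Definition maximal_ideal (m : idealr R) : Prop :=
  forall I : idealr R, {subset m <= I} -> {subset I <= m}.

Definition local_ring (m : prime_idealr R) : Prop :=
  maximal_ideal m /\ forall n : idealr R, maximal_ideal n -> n =i m.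

Definition fin_gen (M : lmodType R) : Prop :=
  exists x : seq M, forall m : M, exists a : nat -> R,
    m = \sum_(j < size x) a j *: x`_j.

Definition noetherian : Prop :=
  forall I : submodClosed R^o, fin_gen (submod I).

End Ideals.

Section Dimension.
Variable A : comNzRingType.

(* Strict chains q 0 < ... < q n, of length n, of primes satisfying X. *)
Definition prime_chain (X : prime_idealr A -> Prop)
    (n : nat) (q : nat -> prime_idealr A) : Prop :=
  (forall i, (i <= n)%N -> X (q i)) /\
  (forall i, (i < n)%N ->
     {subset q i <= q i.+1} /\ ~ {subset q i.+1 <= q i}).

(* Equal to -oo on the empty set, so that the zero module has dimension -oo. *)
Definition nat_sup (X : set nat) : \bar int :=
  supremum -oo%E [set n%:Z%:E%E | n in X].

Definition krull_dim : \bar int :=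
  nat_sup [set n | exists q, prime_chain (fun=> True) n q].

(* P is a predicate so that it can be the image of a prime in a quotient ring *)
Definition height (P : {pred A}) : \bar int :=
  nat_sup [set n | exists q, prime_chain (fun=> True) n q /\ q n =i P].

Definition supp (M : lmodType A) (p : prime_idealr A) : Prop :=
  exists z : locmod p M, z != 0.

(* p is the annihilator of some element of M. *)
Definition ass (M : lmodType A) (p : prime_idealr A) : Prop :=
  exists m : M, forall a : A, (a \in p) = (a *: m == 0).

Definition mod_dim (M : lmodType A) : \bar int :=
  nat_sup [set n | exists q, prime_chain (supp M) n q].

Definition finite_length (M : lmodType A) : Prop :=
  exists b : nat, forall (k : nat) (N : nat -> submodClosed M),
    (forall i, (i < k)%N ->
       {subset N i <= N i.+1} /\ ~ {subset N i.+1 <= N i}) -> (k <= b)%N.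

Definition regular_seq (M : lmodType A) (x : seq A) : Prop :=
  (forall i, (i < size x)%N ->
     forall z : quotmod (seq_submod M (take i x)), x`_i *: z = 0 -> z = 0) /\
  exists z : quotmod (seq_submod M x), z != 0.

(* In depth, cohen_macaulay and sop, m stands for the maximal ideal of A. *)
Definition depth (m : {pred A}) (M : lmodType A) : \bar int :=
  nat_sup [set n | exists x : seq A,
    [/\ size x = n, {subset x <= m} & regular_seq M x]].

Definition cohen_macaulay (m : {pred A}) (M : lmodType A) : Prop :=
  (forall z : M, z = 0) \/ depth m M = mod_dim M.

Definition sop (m : {pred A}) (M : lmodType A) (x : seq A) : Prop :=
  [/\ {subset x <= m}, (size x)%:Z%:E%E = mod_dim M
    & finite_length (quotmod (seq_submod M x))].

End Dimension.

(* The maximal ideal p R_p of R_p. *)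
Definition loc_max (R : comNzRingType) (p : prime_idealr R) :
    {pred locring p} :=
  fun z => `[< exists a s, a \in p /\ z = @locfrac R p R^o a s >].

Arguments loc_max {R} p.

(* The ideal p / q of R / q, for q included in p. *)
Definition quot_image (R : comNzRingType) (q p : prime_idealr R) :
    {pred {ideal_quot q}} :=
  fun z => `[< exists2 a, a \in p & z = \pi_{ideal_quot q} a >].

Arguments quot_image {R} q p.

Definition ht (R : comNzRingType) (M : lmodType R) (p : prime_idealr R) :
    \bar int :=
  @mod_dim (locring p) (locmod p M).

Definition min_primes (R : comNzRingType) (X : prime_idealr R -> Prop)
    (p : prime_idealr R) : Prop :=
  X p /\ forall q, X q -> {subset q <= p} -> {subset p <= q}.

Section Ext.
Variable R : comNzRingType.

(* Ext is computed on the canonical free resolution of N: each term is the    *)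
(* free module on the underlying set of the previous syzygy, realised as its  *)
(* finitely supported R-valued functions, and the next syzygy is the kernel   *)
(* of the evaluation map.                                                   *)
Section FreeModule.
Variable N : lmodType R.

Fact fin_supp_subproof :
  submod_set [set f : N -> R^o | finite_set [set y | f y != 0]].
Proof.
split=> [|a f g ff gf] /=.
  rewrite [X in finite_set X](_ : _ = set0) //.
  by apply/seteqP; split=> y //=; rewrite eqxx.
apply: (@sub_finite_set _ _ ([set y | f y != 0] `|` [set y | g y != 0])).
  move=> y /= h; apply: contrapT => /not_orP[] /negP.
  rewrite negbK => /eqP f0 /negP; rewrite negbK => /eqP g0.
  by move: h; rewrite -[_ y]/(a *: f y + g y) f0 g0 scaler0 addr0 eqxx.
by rewrite finite_setU.
Qed.

Definition free_mod := submod (mk_submod fin_supp_subproof).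

HB.instance Definition _ := GRing.Lmodule.on free_mod.

Lemma free_mod_fin_supp (f : free_mod) :
  finite_set [set y | submod_val f y != 0].
Proof. by case: f => f hf; exact: (proj1 (mem_mk_submod _ f) hf). Qed.

Definition free_eval (f : free_mod) : N :=
  \sum_(y \in [set: N]) (submod_val f y : R) *: y.

Fact free_eval_linear : linear free_eval.
Proof.
move=> a f g; rewrite /free_eval.
pose A := [set y | submod_val f y != 0] `|` [set y | submod_val g y != 0].
have finA : finite_set A.
  by rewrite finite_setU; split; exact: free_mod_fin_supp.
have widen (h : free_mod) : (forall y, ~ A y -> submod_val h y = 0) ->
    \sum_(y \in [set: N]) (submod_val h y : R) *: y
    = \sum_(y <- fset_set A) (submod_val h y : R) *: y.
  move=> h0; rewrite -fsbig_finite //; apply/esym/fsbig_widen => // y [_ Ay] /=.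
  by rewrite h0 // scale0r.
have Af y : ~ A y -> submod_val f y = 0.
  by move=> /not_orP[/negP]; rewrite negbK => /eqP.
have Ag y : ~ A y -> submod_val g y = 0.
  by move=> /not_orP[_ /negP]; rewrite negbK => /eqP.
rewrite !widen //; last first.
  move=> y Ay; rewrite linearP -[_ y]/(a *: submod_val f y + submod_val g y).
  by rewrite Af // Ag // scaler0 addr0.
rewrite scaler_sumr -big_split; apply: eq_bigr => y _.
rewrite linearP -[(_ + _) y]/(a *: submod_val f y + submod_val g y).
by rewrite scalerDl -scalerA.
Qed.

HB.instance Definition _ :=
  GRing.isLinear.Build R free_mod N _ free_eval free_eval_linear.

Fact relations_subproof : submod_set [set f : free_mod | free_eval f = 0].
Proof.
split=> [|a f g f0 g0]; first by rewrite /mkset linear0.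
by rewrite /mkset free_eval_linear [X in a *: X]f0 [X in _ + X]g0 scaler0 addr0.
Qed.

Definition relations := submod (mk_submod relations_subproof).

HB.instance Definition _ := GRing.Lmodule.on relations.

Lemma free_eval_surj (y : N) : exists f, free_eval f = y.
Proof.
pose d (z : N) : R^o := (z == y)%:R.
have dP : d \in mk_submod fin_supp_subproof.
  apply/mem_mk_submod; apply: (@sub_finite_set _ _ [set y]) => // z /=.
  by rewrite /d; case: (z =P y) => // _ /eqP[].
exists (Submod dP); rewrite /free_eval.
rewrite -(@fsbig_widen _ _ _ _ [set y]) //.
  by rewrite fsbig_set1 /= /d eqxx scale1r.
by move=> z [_ /= /eqP]; rewrite /d => /negbTE ->; rewrite scale0r.
Qed.

End FreeModule.

Section Resolution.
Variable N : lmodType R.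

Fixpoint syzygy (n : nat) : lmodType R :=
  if n is k.+1 then relations (syzygy k) else N.

Definition resol (n : nat) : lmodType R := free_mod (syzygy n).

Definition resol_diff (n : nat) (z : resol n.+1) : resol n :=
  submod_val (free_eval z : relations (syzygy n)).

Fact resol_diff_linear n : linear (@resol_diff n).
Proof. by move=> a y z; rewrite /resol_diff !linearP. Qed.

HB.instance Definition _ n :=
  GRing.isLinear.Build R _ _ _ (@resol_diff n) (@resol_diff_linear n).

Lemma resol_exact0 (y : resol 0) :
  free_eval y = 0 <-> exists z, y = resol_diff z.
Proof.
split=> [y0|[z ->]].
  have [z e] := free_eval_surj (
    Submod (proj2 (mem_mk_submod (@relations_subproof N) y) y0) : syzygy 1).
  by exists z; rewrite /resol_diff e.
rewrite /resol_diff; case: (free_eval z) => w hw.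
exact: (proj1 (mem_mk_submod _ w) hw).
Qed.

Lemma resol_exactS n (y : resol n.+1) :
  resol_diff y = 0 <-> exists z, y = resol_diff z.
Proof.
split=> [y0|[z ->]].
  have ey0 : free_eval y = 0 by apply: val_inj.
  have [z e] := free_eval_surj (
    Submod (proj2 (mem_mk_submod (@relations_subproof (syzygy n.+1)) y) ey0)
      : syzygy n.+2).
  by exists z; rewrite /resol_diff e.
rewrite {2}/resol_diff; case: (free_eval z) => w hw.
by rewrite /resol_diff /= (proj1 (mem_mk_submod _ w) hw).
Qed.

Variable M : lmodType R.

Fact cocycles_subproof n :
  submod_set [set f : resol n -> M |
    linear f /\ forall z, f (resol_diff z) = 0].
Proof.
split=> [|a f g [fL f0] [gL g0]].
  by split=> // b y z; rewrite -[LHS]/0 -[RHS]/(b *: 0 + 0) scaler0 addr0.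
have E y : (a *: f + g) y = a *: f y + g y by [].
split=> [b y z|z]; last by rewrite E f0 g0 scaler0 addr0.
rewrite !E fL gL !scalerDr !scalerA addrACA; congr (_ *: _ + _ + _).
  by rewrite mulrC.
Qed.

Definition cocycles n : submodClosed (resol n -> M) :=
  mk_submod (cocycles_subproof n).

Fact zero_subproof n : submod_set [set f : resol n -> M | f = 0].
Proof. by split=> // a f g /= -> ->; rewrite scaler0 addr0. Qed.

Fact coboundaries_subproof n :
  submod_set [set f : resol n.+1 -> M |
    exists2 g : resol n -> M, linear g & f = g \o @resol_diff n].
Proof.
split=> [|a _ _ [f fL ->] [g gL ->]].
  by exists 0 => // b y z; rewrite -[LHS]/0 -[RHS]/(b *: 0 + 0) scaler0 addr0.
exists (a *: f + g) => // b y z.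
have E t : (a *: f + g) t = a *: f t + g t by [].
rewrite !E fL gL !scalerDr !scalerA addrACA; congr (_ *: _ + _ + _).
  by rewrite mulrC.
Qed.

Definition coboundaries n : submodClosed (resol n -> M) :=
  match n with
  | 0 => mk_submod (zero_subproof 0)
  | k.+1 => mk_submod (coboundaries_subproof k)
  end.

Definition Ext n : lmodType R := subquot (cocycles n) (coboundaries n).

End Resolution.

End Ext.

Section SerreClass.
Variable R : comNzRingType.

Definition serre_class (S : lmodType R -> Prop) : Prop :=
  (exists M, S M) /\
  forall (L M N : lmodType R) (f : {linear L -> M}) (g : {linear M -> N}),
    injective f -> (forall y, g y = 0 <-> exists x, y = f x) ->
    (forall z, exists y, g y = z) ->
    S M <-> S L /\ S N.

Variable S : lmodType R -> Prop.

Definition weak_seq (M : lmodType R) (x : seq R) : Prop :=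
  forall i, (i < size x)%N ->
    S (subquot (colon (seq_submod M (take i x)) x`_i)
               (seq_submod M (take i x))).

Definition S_cohen_macaulay (m : {pred R}) (M : lmodType R) : Prop :=
  forall x, sop m M x -> weak_seq M x.

Definition S_supp (M : lmodType R) (p : prime_idealr R) : Prop :=
  supp M p /\ ~ S (quotmod (ideal_of p)).

Definition S_ass (M : lmodType R) (p : prime_idealr R) : Prop :=
  ass M p /\ ~ S (quotmod (ideal_of p)).

Definition S_ht (M : lmodType R) (a : submodClosed R^o) : \bar int :=
  infimum +oo%E
    [set h | exists q, [/\ S_supp M q, {subset a <= q} & h = ht M q]].

Definition S_Egrade (a : submodClosed R^o) (M : lmodType R) : \bar int :=
  infimum +oo%E [set i%:Z%:E%E | i in [set i | ~ S (Ext (quotmod a) M i)]].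

End SerreClass.

(* Main.v *)
(* Put d = dim M, and call M unmixed when dim R/p = d - i for every prime p    *)
(* with R/p not in S that is associated to M/(x_1, ..., x_i)M, where the x_j  *)
(* are part of a system of parameters; this is (v). Prime avoidance shows     *)
(* that (i) is equivalent to it.                                              *)
(*   If Ext^j(R/p, M)_p = 0 for all p in S-Supp M and j < d - dim R/p, then M *)
(* is unmixed, by induction on i: since the quotients by fewer parameters are *)
(* unmixed, x_1, ..., x_i is M_p-regular, so Ext^i(R/p, M)_p <> 0 when p is   *)
(* associated to M/(x_1, ..., x_i)M, and then i >= d - dim R/p. Each of (ii), *)
(* (iii) and (iv) gives this vanishing.                                       *)
(*   Conversely, if M is unmixed and p is in S-Supp M, a part of a system of  *)
(* parameters of length d - dim R/p chosen inside p is M_p-regular, and p is  *)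
(* associated to the quotient of M by it; it therefore computes the depth and *)
(* the height of M_p and the S-grade of p. Lifting associated primes along    *)
(* such a sequence produces saturated chains, whence (vi).                    *)

Require Import Defs.
From HB Require Import structures.
From mathcomp Require Import all_boot all_order all_algebra.
From mathcomp Require Import generic_quotient ring_quotient.
From mathcomp Require Import finmap.
From mathcomp Require Import boolp classical_sets functions cardinality fsbigop.
From mathcomp Require Import constructive_ereal.
From mathcomp Require Import ring zify.

Set Implicit Arguments.
Unset Strict Implicit.
Unset Printing Implicit Defensive.

Import GRing.Theory.
Local Open Scope classical_set_scope.
Local Open Scope ring_scope.
Local Open Scope quotient_scope.

(** * Noetherian modules and localisation at a prime *)

(** All conditions are compared with [unmixed]: for every part x of a system of parameters, each p
    in S-Ass(M/xM) has dim R/p = d - |x|. Two facts translate S into localisation. A member of S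
    vanishes at every q with R/q outside S, since an element surviving at q would make R/q a
    subquotient of it ([serre_torsion]); and a Noetherian module vanishing at all such q belongs to
    S ([serre_criterion]). So (i) says that systems of parameters are regular on M_q for these q.

    If M is unmixed and x_(i+1) is a zero divisor on (M/(x_1,...,x_i)M)_q, it lies in an associated
    prime of coheight d - i, too large for the support of the next quotient; hence
    [unmixed_regular]. Conversely, if some associated prime has too small a coheight, the next
    parameter can be chosen inside it, against (i) ([cohen_macaulay_unmixed]).

    For p in Supp M with dim R/p = t, [part_sop_in] finds d - t parameters z inside p such that p is
    associated to M/zM. If M is unmixed and R/p is outside S, z is M_p-regular. Then Ext^j(R/p, M)
    is in S for j < d - t and not for j = d - t ([ass_ext_nonzero]), while lifting associated primes
    along z ([ass_chain]) gives chains of primes below p of length d - t. As height plus coheight is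
    at most d ([dim_below_le]), the depth and height of M_p and the S-grade and S-height of p all
    equal d - t; the same chains, started at a smaller prime q, compute ht(p/q).

    In the other direction, each of (ii), (iii), (iv) forces Ext^j(R/p, M)_p = 0 for j < d - dim
    R/p, and [ext_zero_unmixed] deduces unmixedness by induction on the number of parameters.
    Condition (vi) gives (ii) on comparing p with m. The background is the principal ideal theorem,
    for dimensions, and [noeth_ext], which lets the Serre criterion be applied to Ext. *)

Section Submodules.
Variables (R : comNzRingType) (V : lmodType R).
Implicit Types (A B N : set V) (s : seq V) (p q : prime_idealr R).

Lemma submod_set0 A : submod_set A -> A 0.
Proof. by case. Qed.

Lemma submod_setD A u v : submod_set A -> A u -> A v -> A (u + v).
Proof. by move=> [_ h] Au Av; rewrite -[u]scale1r; apply: h. Qed.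

Lemma submod_setZ A a u : submod_set A -> A u -> A (a *: u).
Proof. by move=> [A0 h] Au; rewrite -[_ *: _]addr0; apply: h. Qed.

Lemma submod_setN A u : submod_set A -> A u -> A (- u).
Proof. by move=> hA Au; rewrite -scaleN1r; apply: submod_setZ. Qed.

Lemma submod_setB A u v : submod_set A -> A u -> A v -> A (u - v).
Proof. by move=> hA Au Av; apply: submod_setD => //; apply: submod_setN. Qed.

Lemma submod_setDr A u v : submod_set A -> A u -> A (u + v) -> A v.
Proof. by move=> hA Au Auv; rewrite -[v](addKr u); apply: submod_setD => //;
  exact: submod_setN. Qed.

Lemma submod_set_closed_mem (N : submodClosed V) : submod_set [set u | u \in N].
Proof. by split=> [|a u v]; [exact: rpred0|move=> /= *; rewrite rpredD ?rpredZ]. Qed.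

Lemma submod_set_zero : submod_set [set 0 : V].
Proof. by split=> // a u v -> ->; rewrite scaler0 addr0. Qed.

Lemma submod_setT : submod_set [set: V].
Proof. by split=> *; exact: I. Qed.

Definition sum_set A B : set V := [set u | exists2 a, A a & exists2 b, B b & u = a + b].

Lemma submod_sum A B : submod_set A -> submod_set B -> submod_set (sum_set A B).
Proof.
move=> hA hB; split=> [|c _ _ [a Aa [b Bb ->]] [a' Aa' [b' Bb' ->]]].
  by exists 0; [exact: submod_set0|exists 0; [exact: submod_set0|rewrite addr0]].
exists (c *: a + a'); first by apply: submod_setD => //; apply: submod_setZ.
exists (c *: b + b'); first by apply: submod_setD => //; apply: submod_setZ.
by rewrite scalerDr addrACA.
Qed.

Lemma sum_setl A B : submod_set B -> A `<=` sum_set A B.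
Proof. by move=> hB u Au; exists u => //; exists 0; [exact: submod_set0|rewrite addr0]. Qed.

Lemma sum_setr A B : submod_set A -> B `<=` sum_set A B.
Proof. by move=> hA u Bu; exists 0; [exact: submod_set0|exists u; rewrite ?add0r]. Qed.

Definition cyc (u : V) : set V := [set v | exists a : R, v = a *: u].

Lemma submod_cyc u : submod_set (cyc u).
Proof.
split=> [|c _ _ [a ->] [b ->]]; first by exists 0; rewrite scale0r.
by exists (c * a + b); rewrite scalerDl scalerA.
Qed.

Lemma cyc_id u : cyc u u.
Proof. by exists 1; rewrite scale1r. Qed.

Definition mul_set (x : R) : set V := [set v | exists w, v = x *: w].

Lemma submod_mul x : submod_set (mul_set x).
Proof.
split=> [|c _ _ [a ->] [b ->]]; first by exists 0; rewrite scaler0.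
by exists (c *: a + b); rewrite scalerDr !scalerA mulrC.
Qed.

Lemma submod_setI A B : submod_set A -> submod_set B -> submod_set (A `&` B).
Proof.
move=> hA hB; split=> [|c a b [? ?] [? ?]]; first by split; exact: submod_set0.
by split; apply: submod_setD => //; apply: submod_setZ.
Qed.

(** Recursive, so that generating lists can be treated by induction; [lspanP] gives the indexed sums
    of [fin_gen]. *)
Fixpoint lspan s : set V :=
  if s is x :: s' then [set u | exists a : R, exists2 v, lspan s' v & u = a *: x + v]
  else [set 0].

Lemma submod_lspan s : submod_set (lspan s).
Proof.
elim: s => [|x s IH] /=; first exact: submod_set_zero.
split=> [|c _ _ [a [v sv ->]] [b [w sw ->]]].
  by exists 0, 0; rewrite ?scale0r ?addr0 //; exact: submod_set0.
exists (c * a + b), (c *: v + w); last by rewrite scalerDr !scalerDl !scalerA addrACA.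
by apply: submod_setD => //; apply: submod_setZ.
Qed.

Lemma lspanP s u : lspan s u <-> exists a : nat -> R, u = \sum_(j < size s) a j *: s`_j.
Proof.
elim: s u => [|x s IH] u /=.
  by split=> [->|[a]]; [exists (fun=> 0)|]; rewrite big_ord0.
split=> [[a [v /IH[b ->] ->]]|[a ->]].
  by exists (fun j => if j is k.+1 then b k else a); rewrite big_ord_recl.
rewrite big_ord_recl; exists (a 0%N), (\sum_(j < size s) a j.+1 *: s`_j) => //.
by apply/IH; exists (fun j => a j.+1).
Qed.

Lemma lspan_mem s x : x \in s -> lspan s x.
Proof.
elim: s => //= y s IH; rewrite inE => /predU1P[<-|/IH h].
  by exists 1, 0; rewrite ?scale1r ?addr0 //; exact: (submod_set0 (submod_lspan _)).
by exists 0, x; rewrite ?scale0r ?add0r.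
Qed.

Lemma lspan_min s A : submod_set A -> (forall x, x \in s -> A x) -> lspan s `<=` A.
Proof.
move=> hA; elim: s => [|x s IH] hs u /=; first by move=> ->; exact: submod_set0.
move=> [a [v sv ->]]; apply: submod_setD => //.
  by apply: submod_setZ => //; exact/hs/mem_head.
by apply: IH sv => y ys; apply: hs; rewrite inE ys orbT.
Qed.

Definition noeth : Prop := forall A, submod_set A -> exists s, forall u, A u <-> lspan s u.

(** Otherwise choice yields a strictly ascending sequence of submodules satisfying [P]; its union is
    finitely generated, so one term already contains it. *)
Lemma noeth_max (P : set V -> Prop) : noeth ->
  (exists2 A, submod_set A & P A) ->
  exists A, [/\ submod_set A, P A & forall B, submod_set B -> P B -> A `<=` B -> B `<=` A].
Proof.
move=> nV [A0 hA0 PA0]; apply: contrapT => nomax.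
pose T := {A : set V | submod_set A /\ P A}.
have step (A : T) : exists B : T, sval A `<=` sval B /\ ~ sval B `<=` sval A.
  case: A => A [hA PA] /=; apply: contrapT => noB; apply: nomax.
  exists A; split=> // B hB PB AB; apply: contrapT => nBA; apply: noB.
  by exists (exist (fun A => submod_set A /\ P A) B (conj hB PB)).
have [f fP] := choice step.
pose F n := iter n f (exist (fun A => submod_set A /\ P A) A0 (conj hA0 PA0)).
have Fle m n : (m <= n)%N -> sval (F m) `<=` sval (F n).
  move=> /subnK <-; elim: (n - m)%N => [|k IH] //.
  by apply: (subset_trans IH); rewrite addSn; exact: (fP _).1.
have hU : submod_set [set u | exists n, sval (F n) u].
  split=> [|c u v [m Fu] [n Fv]]; first by exists 0%N; exact: submod_set0.
  exists (maxn m n); have [h _] := svalP (F (maxn m n)).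
  by apply: h.2; [apply: Fle Fu; exact: leq_maxl|apply: Fle Fv; exact: leq_maxr].
have [s sP] := nV _ hU.
have [n nP] : exists n, forall x, x \in s -> sval (F n) x.
  have : forall x, x \in s -> exists n, sval (F n) x by move=> x /lspan_mem /sP.
  elim: (s) => [|x s' IH] h; first by exists 0%N.
  have [n1 h1] := h x (mem_head _ _).
  have [y ys|n2 h2] := IH; first by apply: h; rewrite inE ys orbT.
  exists (maxn n1 n2) => y; rewrite inE => /predU1P[->|ys].
    by apply: Fle h1; exact: leq_maxl.
  by apply: Fle (h2 y ys); exact: leq_maxr.
apply: (fP (F n)).2 => u Fu.
apply: (lspan_min (svalP (F n)).1 nP); apply/sP.
by exists n.+1.
Qed.

(* [sat p N] is the preimage of N_p in V, and replaces localisation throughout. *)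
Definition sat p N : set V := [set u | exists2 c, c \notin p & N (c *: u)].

Lemma notin1 p : 1 \notin p.
Proof. by rewrite idealr1. Qed.

Lemma notinM p a b : a \notin p -> b \notin p -> a * b \notin p.
Proof. by move=> ha hb; rewrite prime_idealrM negb_or ha hb. Qed.

Lemma inMl p a b : a \in p -> b * a \in p.
Proof. exact: idealMr. Qed.

Lemma inMr p a b : a \in p -> a * b \in p.
Proof. by rewrite mulrC; exact: idealMr. Qed.

Lemma sub_sat p N : N `<=` sat p N.
Proof. by move=> u Nu; exists 1; rewrite ?notin1 ?scale1r. Qed.

Lemma submod_sat p N : submod_set N -> submod_set (sat p N).
Proof.
move=> hN; split=> [|a u v [c pc Nc] [d pd Nd]].
  by apply: sub_sat; exact: submod_set0.
exists (c * d); first exact: notinM.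
rewrite scalerDr; apply: submod_setD => //.
  have -> : (c * d) *: (a *: u) = (d * a) *: (c *: u) by rewrite !scalerA; congr (_ *: _); ring.
  exact: submod_setZ.
by rewrite -scalerA; exact: submod_setZ.
Qed.

Lemma sat_sat p N u : sat p (sat p N) u -> sat p N u.
Proof.
move=> [c pc [d pd]]; rewrite scalerA => h.
by exists (d * c) => //; exact: notinM.
Qed.

Lemma sat_mono p N N' : N `<=` N' -> sat p N `<=` sat p N'.
Proof. by move=> NN' u [c pc Nc]; exists c => //; exact: NN'. Qed.

Lemma sat_anti p q N : {subset p <= q} -> sat q N `<=` sat p N.
Proof. by move=> pq u [c qc Nc]; exists c => //; apply: contra qc; exact: pq. Qed.

Lemma sat_scale p N c u : c \notin p -> sat p N (c *: u) -> sat p N u.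
Proof. by move=> pc h; apply: sat_sat; exists c. Qed.

(** The denominators of finitely many generators multiply to a common one. *)
Lemma sat_common p N A : noeth -> submod_set N -> submod_set A -> A `<=` sat p N ->
  exists2 c, c \notin p & forall u, A u -> N (c *: u).
Proof.
move=> nV hN hA AN; have [s sP] := nV _ hA.
have {AN} : forall x, x \in s -> sat p N x by move=> x /lspan_mem /sP /AN.
move=> hs; have [c pc h] : exists2 c, c \notin p & forall x, x \in s -> N (c *: x).
  elim: s hs {sP} => [|x s IH] hs; first by exists 1; rewrite ?notin1.
  have [c pc Nc] := hs x (mem_head _ _).
  have [|d pd h] := IH; first by move=> y ys; apply: hs; rewrite inE ys orbT.
  exists (c * d) => [|y]; first exact: notinM.
  rewrite inE => /predU1P[->|ys].
    by rewrite mulrC -scalerA; exact: submod_setZ.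
  by rewrite -scalerA; apply: submod_setZ => //; exact: h.
exists c => // u /sP; apply: (lspan_min (A := [set u | N (c *: u)])) => //.
split=> [|a v w /= hv hw]; first by rewrite /= scaler0; exact: submod_set0.
rewrite scalerDr scalerA mulrC -scalerA.
by apply: submod_setD => //; exact: submod_setZ.
Qed.

End Submodules.

Arguments submod_mul {R V} x.

(** * Finitely generated modules over a Noetherian ring *)

Section NoetherianModules.
Variable R : comNzRingType.

Lemma noeth_surj (V W : lmodType R) (f : {linear V -> W}) :
  (forall w, exists v, f v = w) -> noeth V -> noeth W.
Proof.
move=> fs nV A hA.
have hB : submod_set [set v | A (f v)].
  split=> [|a u v /= hu hv]; first by rewrite /= linear0; exact: submod_set0.
  by rewrite linearP; apply: hA.2.
have [s sP] := nV _ hB; exists (map f s) => w; split=> [Aw|].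
  have [v vw] := fs w; have /sP : A (f v) by rewrite vw.
  rewrite -vw; apply: (lspan_min (A := [set v | lspan (map f s) (f v)])).
    split=> [|a u u' /= hu hu']; first by rewrite /= linear0; exact: (submod_set0 (submod_lspan _)).
    by rewrite linearP; apply: (submod_lspan _).2.
  by move=> x xs /=; apply: lspan_mem; exact: map_f.
by apply: lspan_min => // _ /mapP[x xs ->]; apply/(sP x)/lspan_mem.
Qed.

Lemma noeth_inj (V W : lmodType R) (f : {linear V -> W}) :
  injective f -> noeth W -> noeth V.
Proof.
move=> fi nW A hA.
have hB : submod_set [set w | exists2 v, A v & w = f v].
  split=> [|a _ _ [u Au ->] [v Av ->]].
    by exists 0; [exact: submod_set0|rewrite linear0].
  by exists (a *: u + v); [apply: hA.2|rewrite linearP].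
have [s sP] := nW _ hB.
have : forall w, w \in s -> exists2 v, A v & w = f v by move=> w /lspan_mem /sP.
move=> hs; have [t tA tE] : exists2 t, (forall v, v \in t -> A v) & s = map f t.
  elim: s hs {sP} => [|w s IH] hs; first by exists [::].
  have [v Av ->] := hs w (mem_head _ _).
  have [|t tA ->] := IH; first by move=> y ys; apply: hs; rewrite inE ys orbT.
  by exists (v :: t) => // u; rewrite inE => /predU1P[->|/tA].
exists t => u; split=> [Au|]; last by apply: lspan_min.
have /sP : exists2 v, A v & f u = f v by exists u.
rewrite tE => {}hs.
have : exists2 v, lspan t v & f u = f v.
  apply: (lspan_min (A := [set w | exists2 v, lspan t v & w = f v])) hs.
    split=> [|a _ _ [u1 Au1 ->] [v Av ->]].
      by exists 0; [exact: (submod_set0 (submod_lspan _))|rewrite linear0].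
    by exists (a *: u1 + v); [apply: (submod_lspan t).2|rewrite linearP].
  by move=> _ /mapP[v vt ->]; exists v => //; exact: lspan_mem.
by move=> [v tv /fi ->].
Qed.

Hypothesis hR : noetherian R.

Lemma noeth_regular : noeth R^o.
Proof.
move=> A hA; have [s sP] := hR (mk_submod hA).
exists (map (fun z : submod (mk_submod hA) => submod_val z) s) => u.
split=> [Au|]; last first.
  apply: lspan_min => // _ /mapP[[v hv] _ ->] /=.
  exact/(mem_mk_submod hA).
have [a] := sP (Submod (proj2 (mem_mk_submod hA u) Au)).
move=> /(congr1 (fun z => submod_val z)) /= ->.
apply/lspanP; exists a; rewrite size_map (linear_sum (@submod_val _ _ _)); apply: eq_bigr => j _.
by rewrite (nth_map 0) // linearZ.
Qed.

(** Induction on the generators: the coefficients of [x] in elements of [A] form an ideal, and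
    subtracting lifts of its generators leaves a remainder in the span of the other generators. *)
Lemma noeth_lspan (V : lmodType R) (s : seq V) (A : set V) :
  submod_set A -> A `<=` lspan s -> exists t, forall u, A u <-> lspan t u.
Proof.
elim: s A => [|x s IH] A hA As.
  exists [::] => u; split=> [/As //|->]; exact: submod_set0.
pose I : set R^o := [set a | exists2 v, lspan s v & A (a *: x + v)].
have hI : submod_set I.
  split=> [|c a b [v sv Av] [w sw Aw]].
    by exists 0; rewrite ?scale0r ?addr0;
      [exact: (submod_set0 (submod_lspan _))|exact: submod_set0].
  exists (c *: v + w); first by apply: (submod_lspan s).2.
  have -> : (c *: a + b : R^o) *: x + (c *: v + w) = c *: (a *: x + v) + (b *: x + w).
    by rewrite scalerDl scalerDr addrACA regular_scaleE scalerA.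
  by apply: hA.2.
have [r rP] := noeth_regular hI.
have [t' t'P] : exists t : seq V, (forall v, v \in t -> A v) /\
    forall a : R^o, lspan r a -> exists v, lspan t v /\ exists2 w, lspan s w & v = a *: x + w.
  have : forall a, a \in r -> I a by move=> a /lspan_mem /rP.
  elim: (r) => [|a r' IHr] hr.
    exists [::]; split=> // a ->; exists 0; split=> //; exists 0.
      by exact: (submod_set0 (submod_lspan _)).
    by rewrite scale0r addr0.
  have [v sv Av] := hr a (mem_head _ _).
  have [|t [tA tP]] := IHr; first by move=> y ys; apply: hr; rewrite inE ys orbT.
  exists ((a *: x + v) :: t); split=> [y|]; first by rewrite inE => /predU1P[->|/tA].
  move=> _ [c [b /tP[w [tw [w' sw' wE]]] ->]] /=; rewrite wE in tw.
  exists (c *: (a *: x + v) + (b *: x + w')); split; last first.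
    exists (c *: v + w'); first by apply: (submod_lspan s).2.
    by rewrite scalerDl scalerDr addrACA regular_scaleE scalerA.
  by exists c, (b *: x + w') => //; exact: tw.
have [tA tI] := t'P.
have [t2 t2P] : exists t2, forall u, (A `&` lspan s) u <-> lspan t2 u.
  by apply: IH => [|u []] //; apply: submod_setI => //; exact: submod_lspan.
exists (t' ++ t2) => u.
have sub1 : lspan t' `<=` lspan (t' ++ t2).
  apply: lspan_min; first exact: submod_lspan.
  by move=> y yt; apply: lspan_mem; rewrite mem_cat yt.
have sub2 : lspan t2 `<=` lspan (t' ++ t2).
  apply: lspan_min; first exact: submod_lspan.
  by move=> y yt; apply: lspan_mem; rewrite mem_cat yt orbT.
split=> [Au|]; last first.
  apply: lspan_min => // y; rewrite mem_cat => /orP[/tA //|/lspan_mem /t2P[] //].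
have [a [v sv uE]] := As _ Au.
have [|v' [tv' [w sw v'E]]] := tI a; first by apply/rP; exists v => //; rewrite -uE.
rewrite -[u](subrK v'); apply: submod_setD; [exact: submod_lspan| |exact: sub1].
apply/sub2/t2P; split; last first.
  rewrite uE v'E opprD addrACA subrr add0r.
  by apply: submod_setB => //; exact: submod_lspan.
by apply: submod_setB => //; apply: (lspan_min (s := t')).
Qed.

Lemma noeth_fin_gen (V : lmodType R) : fin_gen V -> noeth V.
Proof.
move=> [s sP] A hA; apply: (noeth_lspan (s := s)) => // u _.
exact/lspanP/sP.
Qed.

End NoetherianModules.

(** * Linear maps out of quotients *)

Section Quotients.
Variables (R : comNzRingType) (V : lmodType R) (N : submodClosed V).

Definition qpi (v : V) : quotmod N := \pi_(quotmod N) v.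

Fact qpi_linear : linear qpi.
Proof. by move=> a u v; rewrite /qpi pi_quotmodD -pi_quotmod_scale. Qed.

HB.instance Definition _ := GRing.isLinear.Build R V (quotmod N) _ qpi qpi_linear.

Lemma qpi_surj z : exists v, qpi v = z.
Proof. by exists (repr z); rewrite /qpi reprK. Qed.

Lemma qpi_eq0 v : qpi v = 0 <-> v \in N.
Proof.
rewrite -(linear0 qpi); split=> [/quotmod_eqP|Nv]; first by rewrite subr0.
by apply/quotmod_eqP; rewrite subr0.
Qed.

End Quotients.
Arguments qpi {R V} N v.

Section MkLinear.
Variables (R : comNzRingType) (V W : lmodType R) (f : V -> W) (fL : linear f).

(** The linearity proof is an argument so that the bundled structure can be attached to any function
    shown to be linear. *)
Definition mk_linear of linear f : V -> W := f.

HB.instance Definition _ := GRing.isLinear.Build R V W _ (mk_linear fL) fL.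

End MkLinear.

Section Factor.
Variables (R : comNzRingType) (V L W : lmodType R) (e : {linear V -> L}) (g : {linear V -> W}).
Hypothesis es : forall z, exists v, e v = z.
Hypothesis ge : forall v, e v = 0 -> g v = 0.

Lemma factor_linear : exists k : {linear L -> W}, forall v, k (e v) = g v.
Proof.
have [k0 k0P] := choice es.
have kE v : g (k0 (e v)) = g v.
  by apply/eqP; rewrite -subr_eq0 -linearB; apply/eqP/ge; rewrite linearB k0P subrr.
have kL : linear (fun z => g (k0 z)).
  move=> a y z; rewrite -linearP -[in LHS](k0P y) -[in LHS](k0P z) -linearP.
  exact: kE.
by exists (mk_linear kL : {linear L -> W}).
Qed.

End Factor.

(** * Associated primes, prime avoidance and Nakayama's lemma *)

Section Primes.
Variable R : comNzRingType.
Implicit Types (p q : prime_idealr R).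

Section MkPrime.
Variable A : set R^o.
Hypotheses (hA : submod_set A) (A1 : ~ A 1).
Hypothesis Aprime : forall a b : R, A (a * b) -> A a \/ A b.

Fact mk_prime_ideal_closed : idealr_closed (fun x : R => `[< A x >]).
Proof.
split; first by apply/asboolP; exact: (submod_set0 hA).
  exact/asboolP.
move=> a u v /asboolP Au /asboolP Av; apply/asboolP.
exact: (hA.2 a u v).
Qed.

Fact mk_prime_prime_closed : prime_idealr_closed (fun x : R => `[< A x >]).
Proof. by move=> u v /asboolP/Aprime[] h; apply/orP; [left|right]; apply/asboolP. Qed.

Definition mk_prime : prime_idealr R :=
  HB.pack (fun x : R => `[< A x >])
    (isIdealr.Build R (fun x => `[< A x >]) mk_prime_ideal_closed)
    (isPrimeIdealrClosed.Build R (fun x => `[< A x >]) mk_prime_prime_closed).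

Lemma mem_mk_prime x : x \in mk_prime <-> A x.
Proof. by split=> /asboolP. Qed.

End MkPrime.

(** Associated primes of V/N, without forming the quotient. *)
Definition is_ass (V : lmodType R) (N : set V) p : Prop :=
  exists u, forall a, a \in p <-> N (a *: u).

Lemma submod_prime p : submod_set [set a : R^o | (a : R) \in p].
Proof. exact: ideal_of_subproof. Qed.

Lemma submod_ann (V : lmodType R) (N : set V) u :
  submod_set N -> submod_set [set a : R^o | N ((a : R) *: u)].
Proof.
move=> hN; split=> [|c a b /= Na Nb]; first by rewrite /= scale0r; exact: submod_set0.
rewrite scalerDl regular_scaleE -scalerA.
by apply: submod_setD => //; exact: submod_setZ.
Qed.

Hypothesis hR : noetherian R.

(* A maximal annihilator among the multiples of u that survive in (V/N)_q. *)
Lemma exists_ass (V : lmodType R) (N : set V) q u : submod_set N -> ~ sat q N u ->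
  exists p c, {subset p <= q} /\ forall a, a \in p <-> N (a *: (c *: u)).
Proof.
move=> hN Nu.
pose P (A : set R^o) := exists2 c : R, ~ sat q N (c *: u) & A = [set a : R^o | N ((a : R) *: (c *: u))].
have [|A [hA [c Nc AE] Amax]] := @noeth_max _ _ P (noeth_regular hR).
  by exists [set a : R^o | N ((a : R) *: (1 *: u))]; [exact: submod_ann|exists 1; rewrite ?scale1r].
have grow b : ~ sat q N (b *: (c *: u)) -> forall a, N (a *: (b *: (c *: u))) -> A a.
  move=> Nb; apply: (Amax [set a : R^o | N ((a : R) *: (b *: (c *: u)))]).
  - exact: submod_ann.
  - by exists (b * c); rewrite -scalerA.
  - move=> a; rewrite AE /= => Na; rewrite scalerA mulrC -scalerA; exact: submod_setZ.
have A1 : ~ A 1 by rewrite AE /= scale1r => /(sub_sat q).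
(* If b c u dies at q through some s outside q, then s c u survives and is killed by b; otherwise b
   c u survives and is killed by a. Maximality puts the killer in [A]. *)
have Ap a b : A (a * b) -> A a \/ A b.
  move=> Aab; have [[s qs Ns]|Nb] := pselect (sat q N (b *: (c *: u))).
    right; apply: (grow s) => [/(sat_scale qs)/Nc //|].
    by rewrite scalerA mulrC -scalerA.
  by left; apply: (grow b) => //; move: Aab; rewrite AE /= -scalerA.
exists (mk_prime hA A1 Ap), c; split=> [a /mem_mk_prime|a].
  by rewrite AE /= => Na; apply: contrapT => /negP qa; apply: Nc; exists a.
by split=> [/mem_mk_prime|h]; [|apply/mem_mk_prime]; rewrite AE.
Qed.

Lemma exists_filter (T : Type) (l : list T) (Q : T -> Prop) :
  exists l', forall x, List.In x l' <-> List.In x l /\ Q x.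
Proof.
elim: l => [|y l [l' IH]] /=; first by exists nil => x; split=> [[]|[[]]].
have [Qy|nQy] := pselect (Q y).
  exists (y :: l')%list => x /=; rewrite IH; split=> [[<-|[? ?]]|[[<-|?] ?]]; by [split;
    [left|]|split; [right|]|left|right].
by exists l' => x; rewrite IH; split=> [[? ?]|[[<-|?] ?]] //; split=> //; right.
Qed.

(** A prime contained in the head of the list may be dropped. Otherwise, when an element avoiding
    the tail lies in the head q, add to it an element of [I] outside q that lies in all the primes
    of the tail. *)
Lemma prime_avoidance (l : list (prime_idealr R)) (I : set R^o) : submod_set I ->
  (forall q, List.In q l -> exists2 a : R, I a & a \notin q) ->
  exists2 a : R, I a & forall q, List.In q l -> a \notin q.
Proof.
move=> hI; move: {2}(List.length l) (leqnn (List.length l)) => n.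
elim: n l => [|n IH] [|q l] ln hl; try by [].
- by exists 0; [exact: (submod_set0 hI)|move=> ? []].
- by exists 0; [exact: (submod_set0 hI)|move=> ? []].
have [[r [lr rq]]|nr] := pselect (exists r, List.In r l /\ {subset r <= q}).
  have [l1 [l2 lE]] := List.in_split _ _ lr.
  have [||a Ia ha] := IH (q :: (l1 ++ l2))%list.
  - by move: ln; rewrite lE /= !List.length_app /= !plusE addnS.
  - move=> t [<-|/List.in_app_iff tl]; first by apply: hl; left.
    by apply: hl; right; rewrite lE; apply/List.in_app_iff; case: tl => ?; [left|right; right].
  exists a => // t [<-|]; first by apply: ha; left.
  rewrite lE => /List.in_app_iff[tl|[<-|tl]]; try by apply: ha; right; apply/List.in_app_iff; tauto.
  by apply/negP => /rq; apply/negP/ha; left.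
have [//|t lt|a Ia ha] := IH l; first by apply: hl; right.
have [qa|qa] := boolP (a \in q); last by exists a => // t [<-|/ha].
have [b [bI bq bl]] : exists b : R, [/\ I b, b \notin q & forall r, List.In r l -> b \in r].
  have [b Ib bq] := hl q (or_introl erefl).
  have {}nr r : List.In r l -> ~ {subset r <= q} by move=> lr rq; apply: nr; exists r.
  elim: (l) nr => [|r l' IHl] nr; first by exists b.
  have [|c [Ic qc cl]] := IHl; first by move=> t lt; apply: nr; right.
  have [d rd qd] : exists2 d, d \in r & d \notin q.
    apply: contrapT => h; apply: (nr r); first by left.
    by move=> d rd; apply: contrapT => /negP qd; apply: h; exists d.
  exists (d * c); split; first exact: (submod_setZ (A := I)).
    exact: notinM.
  by move=> t [<-|/cl ct]; [exact: inMr|exact: inMl].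
exists (a + b); first exact: (submod_setD (A := I)).
move=> t [<-|lt]; apply/negP => h.
  by case/negP: bq; rewrite -[b](addKr a) rpredD // rpredN.
by case/negP: (ha _ lt); rewrite -[a](addrK b) rpredB //; exact: bl.
Qed.

(** * Nakayama's lemma, localised at a prime *)

Section Nakayama.
Variable V : lmodType R.

Fixpoint pspan p (s : seq V) : set V :=
  if s is x :: s' then
    [set u | exists2 a : R, a \in p & exists2 v, pspan p s' v & u = a *: x + v]
  else [set 0].

Lemma submod_pspan p s : submod_set (pspan p s).
Proof.
elim: s => [|x s IH] /=; first exact: submod_set_zero.
split=> [|c _ _ [a pa [v sv ->]] [b pb [w sw ->]]].
  by exists 0; [exact: rpred0|exists 0; rewrite ?scale0r ?addr0 //; exact: submod_set0].
exists (c * a + b); first by apply: rpredD => //; exact: inMl.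
by exists (c *: v + w); [exact: IH.2|rewrite scalerDr !scalerDl !scalerA addrACA].
Qed.

Lemma lspan_pspan p s a u : a \in p -> lspan s u -> pspan p s (a *: u).
Proof.
move=> pa; elim: s u => [|x s IH] u /=; first by move=> ->; rewrite scaler0.
move=> [b [v /IH sv ->]]; exists (a * b); first exact: inMr.
by exists (a *: v) => //; rewrite scalerDr scalerA.
Qed.

(** Elimination of generators instead of a determinant: the coefficient [t - a] of the first
    generator is a unit at [p], so this generator is expressed by the others and substituted into
    their relations. *)
Lemma nakayama_span p (B : set V) (s : seq V) : submod_set B ->
  (forall x, x \in s -> sat p (sum_set B (pspan p s)) x) -> forall x, x \in s -> sat p B x.
Proof.
move=> hB; elim: s => // x s IH hs.
have hBp := submod_sum hB (submod_pspan p s).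
have [t pt [b Bb [v [a pa [w sw vE]] xE]]] := hs x (mem_head _ _).
have pta : t - a \notin p by apply: contra pt => h; rewrite -[t](subrK a) rpredD.
have xE' : (t - a) *: x = b + w.
  by rewrite scalerBl xE vE addrCA [X in X - _]addrC addrK.
have {}IH : forall y, y \in s -> sat p B y.
  apply: IH => y ys.
  have [|t' pt' [b' Bb' [v' [a' pa' [w' sw' v'E]] yE]]] := hs y; first by rewrite inE ys orbT.
  exists ((t - a) * t'); first exact: notinM.
  have -> : ((t - a) * t') *: y = (t - a) *: b' + (a' *: (b + w) + (t - a) *: w').
    by rewrite -scalerA yE v'E -xE' !scalerDr !scalerA [a' * _]mulrC.
  apply: submod_setD => //; first by apply: sum_setl; [exact: submod_pspan|exact: submod_setZ].
  apply: submod_setD => //; last by apply: sum_setr => //; apply: submod_setZ => //;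
    exact: submod_pspan.
  by apply: submod_setZ => //; exists b => //; exists w.
move=> y; rewrite inE => /predU1P[->|/IH //].
apply: (sat_scale pta); rewrite xE'; apply: submod_setD; first exact: submod_sat.
  exact: sub_sat.
have sub : pspan p s `<=` lspan s.
  elim: (s) => [|z s' IHs] u //= [c _ [z' /IHs h ->]]; by exists c, z'.
apply: (@lspan_min _ _ s); [exact: submod_sat|exact: IH|exact: sub].
Qed.

(** The hypothesis says that A_p lies in B_p + p A_p, with the denominator and the terms made
    explicit. *)
Lemma nakayama p (A B : set V) : noeth V -> submod_set A -> submod_set B ->
  (forall u, A u -> exists c b (d : seq (R * V)), [/\ c \notin p, B b,
     forall z, z \in d -> z.1 \in p /\ A z.2 & c *: u = b + \sum_(z <- d) z.1 *: z.2]) ->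
  A `<=` sat p B.
Proof.
move=> nV hA hB h; have [s sP] := nV _ hA.
move=> u /sP; apply: lspan_min; first exact: submod_sat.
apply: nakayama_span => // x /lspan_mem /sP /h [c [b [d [pc Bb dP xE]]]].
exists c => //; exists b => //; exists (\sum_(z <- d) z.1 *: z.2) => //.
elim: d dP {xE} => [|z d IH] dP.
  by rewrite big_nil; exact: (submod_set0 (submod_pspan p s)).
rewrite big_cons; apply: submod_setD; first exact: submod_pspan.
  by have [pz /sP Az] := dP z (mem_head _ _); exact: lspan_pspan.
by apply: IH => y yd; apply: dP; rewrite inE yd orbT.
Qed.

Lemma nakayama1 p x (A B : set V) : noeth V -> submod_set A -> submod_set B -> x \in p ->
  (forall u, A u -> sat p (sum_set B [set v | exists2 w, A w & v = x *: w]) u) ->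
  A `<=` sat p B.
Proof.
move=> nV hA hB px h; apply: nakayama => // u /h[c pc [b Bb [_ [w Aw ->] uE]]].
exists c, b, [:: (x, w)]; split=> //; last by rewrite big_seq1.
by move=> z; rewrite inE => /eqP ->.
Qed.

End Nakayama.
End Primes.

(** * Supports and finite length *)

Section Support.
Variable R : comNzRingType.
Implicit Types (p q : prime_idealr R) (V : lmodType R).
Hypothesis hR : noetherian R.

(** Membership of p in Supp(V/N). *)
Definition in_supp V (N : set V) p : Prop := exists u, ~ sat p N u.

Lemma in_supp_up V (N : set V) p q : {subset p <= q} -> in_supp N p -> in_supp N q.
Proof. by move=> pq [u Nu]; exists u => /(sat_anti pq). Qed.

Lemma ass_in_supp V (N : set V) p : is_ass N p -> in_supp N p.
Proof. by move=> [u uP]; exists u => -[c /negP pc /uP]. Qed.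

Lemma in_supp_ass V (N : set V) p : submod_set N -> in_supp N p ->
  exists2 q : prime_idealr R, {subset q <= p} & is_ass N q.
Proof.
by move=> hN [u /(exists_ass hR hN)[q [c [qp qP]]]]; exists q => //; exists (c *: u).
Qed.

Lemma in_supp_ann V (N : set V) p : submod_set N -> in_supp N p ->
  forall a, (forall u, N (a *: u)) -> a \in p.
Proof. by move=> hN [u Nu] a aN; apply: contrapT => /negP pa; apply: Nu; exists a. Qed.

Section Local.
Variables (m : prime_idealr R) (hm : local_ring m).

(** A non-unit lies in an ideal maximal among the proper ones, and this ideal is m. *)
Lemma local_unit (s : R) : s \notin m -> exists t, t * s = 1.
Proof.
move=> ms; apply: contrapT => noinv.
pose P (A : set R^o) := A s /\ ~ A 1.
have [|A [hA [As A1] Amax]] := @noeth_max _ _ P (noeth_regular hR).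
  exists (cyc (s : R^o)); first exact: submod_cyc.
  split; first exact: cyc_id.
  by move=> [t tE]; apply: noinv; exists t.
pose n : idealr R := HB.pack (fun x : R => `[< A x >])
    (isIdealr.Build R (fun x => `[< A x >]) (mk_prime_ideal_closed hA A1)).
have nmax : maximal_ideal n.
  move=> I nI a Ia; apply/asboolP.
  apply: (Amax [set b : R^o | (b : R) \in I]) => //.
  - split=> [|c u v Iu Iv]; first exact: rpred0.
    by apply: rpredD => //; exact: idealMr.
  - split; first by apply: nI; exact/asboolP.
    by rewrite /= idealr1.
  - by move=> b Ab; apply: nI; apply/asboolP.
have : s \in n by exact/asboolP.
by rewrite (hm.2 n nmax) (negbTE ms).
Qed.

Lemma sub_max p : {subset p <= m}.
Proof.
move=> a pa; apply: contrapT => /negP /local_unit[t t1].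
by have /negP[] := notin1 p; rewrite -t1 inMl.
Qed.

Lemma sat_max V (N : set V) : submod_set N -> sat m N `<=` N.
Proof.
move=> hN u [c /local_unit[t t1] Nc].
by rewrite -[u]scale1r -t1 -scalerA; exact: submod_setZ.
Qed.

(** A maximal submodule [A] such that A/N has finitely many associated primes is everything:
    adjoining an element whose annihilator modulo [A] is a prime q adds at most q. Primes are listed
    up to extensional equality. *)
Lemma ass_list V (N : set V) : noeth V -> submod_set N ->
  exists l : list (prime_idealr R),
    (forall p, is_ass N p -> exists2 q : prime_idealr R, List.In q l & p =i q) /\
    (forall q, List.In q l -> is_ass N q).
Proof.
move=> nV hN.
pose P A := N `<=` A /\ exists l : list (prime_idealr R),
  forall (p : prime_idealr R) u, A u -> (forall a, a \in p <-> N (a *: u)) ->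
  exists2 q : prime_idealr R, List.In q l & p =i q.
have [|A [hA [NA [l lP]] Amax]] := @noeth_max _ _ P nV.
  exists N => //; split=> //; exists nil => p u Nu uP.
  by have := notin1 p; rewrite (proj2 (uP 1)) // scale1r.
suff AT u : A u.
  have [l' l'P] := exists_filter l (is_ass N).
  exists l'; split=> [p [u uP]|q /l'P[]//].
  have [q lq pq] := lP p u (AT u) uP; exists q => //; apply/l'P; split=> //.
  by exists u => a; rewrite -uP pq.
apply: contrapT => Au; have {}Au : ~ sat m A u by move=> /(sat_max hA).
have [q [c [_ qP]]] := exists_ass hR hA Au.
suff Ac : A (c *: u) by have := notin1 q; rewrite (proj2 (qP 1)) // scale1r.
have hA' := submod_sum hA (submod_cyc (c *: u)).
apply: (Amax _ hA'); last 2 first.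
- by apply: sum_setl; exact: submod_cyc.
- by apply: sum_setr => //; exact: cyc_id.
split; first by move=> v Nv; apply: sum_setl; [exact: submod_cyc|exact: NA].
exists (q :: l)%list => p _ [n An [_ [b ->] ->]]; set v := n + _ => vP.
(* If a multiple of v by an element outside p lies in [A], this multiple again has annihilator p;
   otherwise p is the annihilator of v modulo [A], which is q. *)
have [[r [Arv pr]]|h] := pselect (exists r, A (r *: v) /\ r \notin p).
  have [|q' lq' pq'] := lP p (r *: v) Arv; last by exists q' => //; right.
  move=> a; rewrite scalerA -vP; split=> [pa|]; first exact: inMr.
  by rewrite prime_idealrM (negbTE pr) orbF.
exists q; first by left.
have avA a : A (a *: v) <-> A (a *: (b *: (c *: u))).
  rewrite /v scalerDr; split; first by apply: submod_setDr => //; exact: submod_setZ.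
  by move=> ?; apply: submod_setD => //; exact: submod_setZ.
move=> a; apply/idP/idP => [/vP /NA /avA|qa].
  rewrite scalerA -qP prime_idealrM => /orP[//|qb].
  case: h; exists 1; split; last exact: notin1.
  by apply/avA; rewrite scale1r; apply/qP.
apply: contrapT => /negP pa; apply: h; exists a; split=> //.
by apply/avA; rewrite scalerA mulrC -scalerA; apply: submod_setZ => //; exact/qP.
Qed.

Lemma list_min (l : list (prime_idealr R)) : l <> nil ->
  exists q, List.In q l /\ forall r, List.In r l -> {subset r <= q} -> {subset q <= r}.
Proof.
elim: l => // q l IH _; have [->|/IH[r [lr rmin]]] := pselect (l = nil).
  by exists q; split=> [|r [<-|[]]//]; left.
have [qr|nqr] := pselect ({subset q <= r}); last first.
  by exists r; split=> [|t [<- //|/rmin //]]; right.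
exists q; split=> [|t [<- //|lt tq]]; first by left.
move=> a /qr ra; apply: rmin ra => // b /tq; exact: qr.
Qed.

(** Take a minimal one among the finitely many associated primes below [p]: every prime of the
    support contains an associated prime. *)
Lemma min_supp V (N : set V) p : noeth V -> submod_set N -> in_supp N p ->
  exists q : prime_idealr R, [/\ {subset q <= p}, is_ass N q &
    forall r : prime_idealr R, in_supp N r -> {subset r <= q} -> {subset q <= r}].
Proof.
move=> nV hN /(in_supp_ass hN)[q0 q0p q0A].
have [l [lP lA]] := ass_list nV hN.
have [l' l'P] := exists_filter l (fun q => {subset q <= p}).
have [r0 lr0 qr0] := lP _ q0A.
have [|q [/l'P[lq qp] qmin]] := @list_min l'.
  have : List.In r0 l' by apply/l'P; split=> // a; rewrite -qr0; exact: q0p.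
  by move=> h l'0; rewrite l'0 in h.
exists q; split=> //; first exact: lA.
move=> r rS rq; have [t tr /lP[t' lt' tt']] := in_supp_ass hN rS.
have h : {subset q <= t'}.
  apply: qmin; first by apply/l'P; split=> // a; rewrite -tt' => /tr /rq; exact: qp.
  by move=> a; rewrite -tt' => /tr /rq.
by move=> a /h; rewrite -tt' => /tr.
Qed.

(** * Length at a minimal prime of the support *)

Section Length.
Variables (V : lmodType R) (p : prime_idealr R) (N : set V).

(** Says that A_p/N_p has length at most b over R_p: each step has to be strict after
    localisation. *)
Definition chain_bound (A : set V) (b : nat) := forall k (C : nat -> set V),
  (forall i, (i <= k)%N -> [/\ submod_set (C i), N `<=` C i & C i `<=` A]) ->
  (forall i, (i < k)%N -> C i `<=` C i.+1 /\ ~ C i.+1 `<=` sat p (C i)) -> (k <= b)%N.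

Lemma chain_mono k (C : nat -> set V) i j :
  (forall i, (i < k)%N -> C i `<=` C i.+1) -> (i <= j)%N -> (j <= k)%N -> C i `<=` C j.
Proof.
move=> h /subnK <-; elim: (j - i)%N => [_|n IH jk]; first by [].
by apply: subset_trans (IH (ltnW jk)) _; rewrite addSn; exact: h.
Qed.

(* Adding a generator u with p u in A adds at most one p-strict step. *)
Lemma chain_bound_step (A : set V) b u : submod_set A -> N `<=` A ->
  (forall a, a \in p -> A (a *: u)) -> chain_bound A b ->
  chain_bound (sum_set A (cyc u)) b.+1.
Proof.
move=> hA NA pu bA k C Ck Cs.
have Cm i j : (i <= j)%N -> (j <= k)%N -> C i `<=` C j.
  by apply: chain_mono => l /Cs[].
pose D i := C i `&` A.
have Dk i : (i <= k)%N -> [/\ submod_set (D i), N `<=` D i & D i `<=` A].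
  move=> /Ck[hC NC CA]; split; first exact: submod_setI.
    by move=> v Nv; split; [exact: NC|exact: NA].
  by move=> v [].
have Dm i j : (i <= j)%N -> (j <= k)%N -> D i `<=` D j.
  by move=> ij jk v [Cv Av]; split=> //; exact: Cm Cv.
have Dsat i j : (i <= j)%N -> (j <= k)%N -> sat p (D i) `<=` sat p (D j).
  by move=> ij jk; apply: sat_mono; exact: Dm.
(* If [D] stalls at [i], a new element of [C i.+1] involves [u] with a coefficient outside [p].
   Later terms contain it, so multiples of [u] can be subtracted there and [D] grows whenever [C]
   does. *)
have Dlate i j : (i < k)%N -> D i.+1 `<=` sat p (D i) -> (i < j)%N -> (j < k)%N ->
    ~ D j.+1 `<=` sat p (D j).
  move=> ik Di ij jk Dj; have [_] := Cs i ik; apply=> v Cv.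
  apply: contrapT => nv; have [_ _ /(_ v Cv)] := Ck i.+1 ik.
  move=> [n An [_ [c ->] vE]].
  have pc : c \notin p.
    apply/negP => pc; apply: nv; apply: (@sat_mono _ _ p (D i)) => [w []//|].
    apply: Di; split=> //; rewrite vE; apply: submod_setD => //; exact: pu.
  have [_] := Cs j jk; apply=> w Cw; have [_ _ /(_ w Cw)] := Ck j.+1 jk.
  move=> [n' An' [_ [c' ->] wE]]; apply: (sat_scale pc).
  have {}Cv : C j v by apply: (Cm i.+1 j ij (ltnW jk)).
  have [hCj _ _] := Ck j (ltnW jk); have [hCj1 _ _] := Ck j.+1 jk.
  rewrite -[c *: w](subrK (c' *: v)); apply: submod_setD; first exact: submod_sat.
    apply: (@sat_mono _ _ p (D j)) => [z []//|]; apply: Dj; split.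
      apply: submod_setB => //; apply: submod_setZ => //.
      exact: (Cm j j.+1 (leqnSn j) jk).
    rewrite wE vE !scalerDr !scalerA [c' * c]mulrC opprD addrACA subrr addr0.
    by apply: submod_setB => //; exact: submod_setZ.
  by apply: sub_sat; exact: submod_setZ.
pose Q i : bool := `[< (i < k)%N /\ D i.+1 `<=` sat p (D i) >].
have [exQ|nex] := pselect (exists i, Q i); last first.
  apply/leqW/(bA k D) => // i ik; split; first exact: Dm.
  by move=> h; apply: nex; exists i; apply/asboolP.
have [i /asboolP[ik Di] imin] := ex_minnP exQ.
have Dearly j : (j < i)%N -> ~ D j.+1 `<=` sat p (D j).
  move=> ji h; suff : (i <= j)%N by rewrite leqNgt ji.
  by apply: imin; apply/asboolP; split=> //; exact: ltn_trans ji ik.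
have k0 : (0 < k)%N by apply: leq_ltn_trans ik.
(* The index [i.+1] is skipped: this is the one step lost. *)
rewrite -(prednK k0) ltnS; apply: (bA k.-1 (fun j => if (j <= i)%N then D j else D j.+1)).
  move=> j jk; have jk' : (j < k)%N by rewrite -(prednK k0).
  by case: ifP => _; apply: Dk => //; exact: ltnW.
move=> j jk; have {}jk : (j.+1 < k)%N by rewrite -(prednK k0).
have jk' := ltnW jk; have jk'' := ltnW jk'.
have [ji|ij|jE] := ltngtP j i.
- by split; [exact: Dm|exact: Dearly].
- by split; [exact: Dm|apply: (Dlate i j.+1) => //; exact: ltnW].
- rewrite -jE in Di Dlate; split; first by apply: Dm => //; exact: leqW.
  move=> h; apply: (Dlate j j.+1) => //.
  by apply: (subset_trans h); exact: Dsat.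
Qed.

(** Take [A] maximal with bounded chains. If [A] differs from V at p, an associated prime of V/A
    below p must be p, by minimality, and adjoining the corresponding element adds only one step. *)
Lemma finite_chains : noeth V -> submod_set N ->
  (forall q, {subset q <= p} -> in_supp N q -> {subset p <= q}) ->
  exists b, chain_bound [set: V] b.
Proof.
move=> nV hN hp.
pose P A := N `<=` A /\ exists b, chain_bound A b.
have [|A [hA [NA [b bA]] Amax]] := @noeth_max _ _ P nV.
  exists N => //; split=> //; exists 0%N => -[|k] C Ck Cs //.
  have [_] := Cs 0%N isT; case=> u Cu; apply: sub_sat.
  have [//|_ h _] := Ck 0%N; have [//|_ _ h'] := Ck 1%N; exact/h/h'.
have [[u Au]|AT] := pselect (in_supp A p).
  have [q [c [qp qP]]] := exists_ass hR hA Au.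
  have pq : {subset p <= q}.
    apply: hp => //; exists (c *: u) => -[s /negP qs /NA]; rewrite -qP; exact: qs.
  suff : A (c *: u).
    by have := notin1 q; move=> /negP h h'; case: h; apply/qP; rewrite scale1r.
  apply: (Amax (sum_set A (cyc (c *: u)))).
  - by apply: submod_sum => //; exact: submod_cyc.
  - split; first by move=> v Nv; apply: sum_setl; [exact: submod_cyc|exact: NA].
    by exists b.+1; apply: chain_bound_step => // a /pq /qP.
  - by apply: sum_setl; exact: submod_cyc.
  - by apply: sum_setr => //; exact: cyc_id.
exists b => k C Ck Cs; apply: (bA k (fun i => C i `&` A)) => i ik.
  have [hC NC _] := Ck i ik; split; first exact: submod_setI.
    by move=> v Nv; split; [exact: NC|exact: NA].
  by move=> v [].
have [Ci nCi] := Cs i ik; split; first by move=> v [Cv Av]; split=> //; exact: Ci.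
move=> h; apply: nCi => v Cv.
have [s ps As] : sat p A v by apply: contrapT => nv; apply: AT; exists v.
apply: (sat_scale ps); apply: (@sat_mono _ _ p (C i `&` A)) => [w []//|].
by apply: h; split=> //; have [hC _ _] := Ck i.+1 ik; exact: submod_setZ.
Qed.

End Length.
End Local.
End Support.

(** * The principal ideal theorem and dimension *)

Section KrullDimension.
Variables (R : comNzRingType) (m : prime_idealr R).
Hypotheses (hR : noetherian R) (hm : local_ring m).
Implicit Types (p q r : prime_idealr R).

Lemma expr_prime p (x : R) k : x ^+ k \in p -> x \in p.
Proof.
elim: k => [|k IH]; first by rewrite expr0 idealr1.
by rewrite exprS prime_idealrM => /orP[].
Qed.

(* With J_n = (y^n + p) : x^oo localised at r, the descending chain condition *)
(* modulo x gives J_n = J_(n+1) + x J_n, so J_n = J_(n+1) by Nakayama, and    *)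
(* cancelling y^n in R/p puts a power of x in the ideal y + p.                *)
Lemma principal_ideal_theorem p q r (x : R) :
  {subset p <= q} -> ~ {subset q <= p} -> {subset q <= r} -> x \in r ->
  (forall t : prime_idealr R, {subset p <= t} -> x \in t -> {subset t <= r} -> {subset r <= t}) ->
  {subset r <= q}.
Proof.
move=> pq nqp qr rx rmin; have [qx|qx] := boolP (x \in q); first exact: rmin.
have [y qy py] : exists2 y, y \in q & y \notin p.
  apply: contrapT => h; apply: nqp => y qy; apply: contrapT => /negP py.
  by apply: h; exists y.
pose pset : set R^o := [set a : R^o | (a : R) \in p].
have hp : submod_set pset by exact: submod_prime.
pose Y n : set R^o := sum_set pset (cyc (y ^+ n : R^o)).
have hY n : submod_set (Y n) by apply: submod_sum => //; exact: submod_cyc.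
have YS n : Y n.+1 `<=` Y n.
  move=> _ [a pa [_ [c ->] ->]]; exists a => //; exists ((c * y) *: (y ^+ n : R^o)).
    by exists (c * y).
  by congr (_ + _); rewrite !regular_scaleE exprS mulrA.
pose J n : set R^o := [set a : R^o | exists k, sat r (Y n) (x ^+ k *: a)].
have Jx n k a : J n (x ^+ k *: a) -> J n a.
  by move=> [l]; rewrite scalerA -exprD => h; exists (l + k)%N.
have hJ n : submod_set (J n).
  split=> [|c a b [k Ya] [l Yb]].
    by exists 0%N; rewrite scaler0; exact: (submod_set0 (submod_sat r (hY n))).
  exists (k + l)%N; rewrite scalerDr; apply: submod_setD; first exact: submod_sat.
    have -> : x ^+ (k + l) *: (c *: a) = (c * x ^+ l) *: (x ^+ k *: a).
      by rewrite !scalerA exprD; congr (_ *: _); ring.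
    by apply: submod_setZ => //; exact: submod_sat.
  by rewrite exprD -scalerA; apply: submod_setZ => //; exact: submod_sat.
have JS n : J n.+1 `<=` J n by move=> a [k h]; exists k; exact: (sat_mono (@YS n)).
have Jsat n : sat r (J n) `<=` J n.
  move=> a [s rs [k h]]; exists k; apply: (sat_scale rs).
  by rewrite scalerA mulrC -scalerA.
pose N0 : set R^o := sum_set pset (@mul_set R R^o x).
have hN0 : submod_set N0 by apply: submod_sum => //; exact: submod_mul.
have N0supp t : in_supp N0 t -> {subset p <= t} /\ x \in t.
  move=> tS; have h := in_supp_ann hN0 tS; split=> [a pa|]; apply: h => u.
    by apply: sum_setl; [exact: submod_mul|exact: inMr].
  by apply: sum_setr => //; exists u.
have [b bP] : exists b, chain_bound r N0 [set: R^o] b.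
  apply: (finite_chains hR (noeth_regular hR) hN0) => t tr /N0supp[pt xt].
  exact: rmin.
have [n Jn] : exists n, J n `<=` sat r (sum_set (J n.+1) N0).
  apply: contrapT => h; suff : (b.+1 <= b)%N by rewrite ltnn.
  apply: (bP b.+1 (fun i => sum_set (J (b.+1 - i)%N) N0)) => i ib.
    split=> //; first exact: submod_sum.
    exact: sum_setr.
  have E : (b.+1 - i)%N = (b.+1 - i.+1).+1 by rewrite -subSn.
  split; first by rewrite E => _ [c Jc [d Nd ->]]; exists c; [exact: JS|exists d].
  move=> h'; apply: h; exists (b.+1 - i.+1)%N => a Ja.
  by rewrite -E; apply: h'; apply: sum_setl.
have pJ k : pset `<=` J k.
  move=> a pa; exists 0%N; rewrite expr0 scale1r; apply: sub_sat.
  by apply: sum_setl => //; exact: submod_cyc.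
have {}Jn : J n `<=` sat r (J n.+1).
  apply: (nakayama1 (noeth_regular hR) (hJ n) (hJ n.+1) rx) => a Ja.
  have [s rs [c Jc [_ [d pd [_ [w ->] ->]] sE]]] := Jn a Ja.
  exists s => //; rewrite sE addrA; exists (c + d).
    by apply: submod_setD => //; exact: pJ.
  exists (x *: w) => //; exists w => //.
  apply: (Jx n 1%N); rewrite expr1; apply: (submod_setDr (hJ n) (pJ _ _ pd)).
  apply: (submod_setDr (hJ n) (JS _ _ Jc)); rewrite -sE.
  exact: submod_setZ.
have : J n (y ^+ n).
  exists 0%N; rewrite expr0 scale1r; apply/sub_sat/sum_setr => //; exact: cyc_id.
move=> /Jn /Jsat [k [s rs [a pa [_ [c ->]]]]].
rewrite !regular_scaleE => E.
have pE : y ^+ n * (s * x ^+ k - c * y) \in p.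
  suff -> : y ^+ n * (s * x ^+ k - c * y) = a by [].
  have -> : y ^+ n * (s * x ^+ k - c * y) = s * (x ^+ k * y ^+ n) - c * y ^+ n.+1 by rewrite exprS; ring.
  by rewrite E addrK.
move: pE; rewrite prime_idealrM => /orP[/expr_prime|/pq h].
  by rewrite (negbTE py).
have : s * x ^+ k \in q by rewrite -[_ * _](subrK (c * y)) rpredD // inMl.
rewrite prime_idealrM => /orP[/qr|/expr_prime]; first by rewrite (negbTE rs).
by rewrite (negbTE qx).
Qed.

Definition prime_lt p q := {subset p <= q} /\ ~ {subset q <= p}.

(** Take t minimal over p + (x) inside r; if t were r, the principal ideal theorem would put r
    inside q. *)
Lemma insert_prime p q r (x : R) : prime_lt p q -> prime_lt q r -> x \in r -> x \notin q ->
  exists t, [/\ prime_lt p t, prime_lt t r & x \in t].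
Proof.
move=> [pq nqp] [qr nrq] rx qx.
pose pset : set R^o := [set a : R^o | (a : R) \in p].
have hp : submod_set pset by exact: submod_prime.
pose N0 : set R^o := sum_set pset (@mul_set R R^o x).
have hN0 : submod_set N0 by apply: submod_sum => //; exact: submod_mul.
have N0supp (t : prime_idealr R) : {subset p <= t} -> x \in t -> in_supp N0 t.
  move=> pt xt; exists 1 => -[c /negP tc [a pa [_ [w ->] cE]]].
  apply: tc; rewrite -[c]mulr1 -[c * 1]/(c *: (1 : R^o)) cE.
  by apply: rpredD; [exact: pt|exact: inMr].
have suppN0 (t : prime_idealr R) : in_supp N0 t -> {subset p <= t} /\ x \in t.
  move=> tS; have h := in_supp_ann hN0 tS; split=> [a pa|]; apply: h => u.
    by apply: sum_setl; [exact: submod_mul|exact: inMr].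
  by apply: sum_setr => //; exists u.
have pr : {subset p <= r} by move=> a /pq /qr.
have [t [tr /ass_in_supp /suppN0[pt tx] tmin]] := min_supp hR hm (noeth_regular hR) hN0 (N0supp r pr rx).
exists t; split=> //; split=> //.
  by move=> tp; move: qx; rewrite pq // tp.
move=> rt; apply: nrq; apply: (principal_ideal_theorem (p := p) (x := x)) => //.
move=> z pz zx zr a ra; apply: (tmin z) => //; first exact: N0supp.
  by move=> ? ?; apply/rt/zr.
exact: rt.
Qed.

Lemma prime_chain_le (X : prime_idealr R -> Prop) n c i j : prime_chain X n c ->
  (i <= j)%N -> (j <= n)%N -> {subset c i <= c j}.
Proof.
move=> [_ h] /subnK <-; elim: (j - i)%N => [_|k IH kn a /(IH (ltnW kn))]; first by [].
by rewrite addSn; exact: (h _ kn).1.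
Qed.

Lemma prime_chainW (X Y : prime_idealr R -> Prop) n c :
  (forall p, X p -> Y p) -> prime_chain X n c -> prime_chain Y n c.
Proof. by move=> XY [h1 h2]; split=> // i /h1 /XY. Qed.

Definition dim_le (X : prime_idealr R -> Prop) n :=
  forall k c, prime_chain X k c -> (k <= n)%N.

Definition up_closed (X : prime_idealr R -> Prop) :=
  forall p q, X p -> {subset p <= q} -> X q.

Lemma prime_chain_snoc (X : prime_idealr R -> Prop) k c q :
  prime_chain X k c -> X q -> prime_lt (c k) q ->
  prime_chain X k.+1 (fun i => if (i <= k)%N then c i else q).
Proof.
move=> [c1 c2] Xq cq; split=> i; first by case: ifP => [/c1|].
rewrite ltnS leq_eqVlt => /predU1P[->|ik] /=; first by rewrite eqxx ltnn.
by rewrite ik orbT; exact: c2.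
Qed.

Lemma prime_chain_cons (X : prime_idealr R -> Prop) k c q :
  prime_chain X k c -> X q -> prime_lt q (c 0%N) ->
  prime_chain X k.+1 (fun i => if i is j.+1 then c j else q).
Proof. by move=> [c1 c2] Xq cq; split=> -[|i] //; [exact: c1|exact: c2]. Qed.

(** From the top downwards, [insert_prime] replaces each intermediate term missing x by one
    containing x, with both ends fixed. *)
Lemma move_chain (x : R) k c : prime_chain (fun=> True) k.+1 c -> x \in c k.+1 ->
  exists c', [/\ prime_chain (fun=> True) k.+1 c', c' 0%N = c 0%N, c' k.+1 = c k.+1
               & x \in c' 1%N].
Proof.
elim: k c => [|k IH] c cc xc; first by exists c.
have [xc1|xc1] := boolP (x \in c k.+1).
  have cc1 : prime_chain (fun=> True) k.+1 c by split=> // i ik; apply: cc.2; exact: leqW.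
  have [c' [cc' c'0 c'k c'x]] := IH c cc1 xc1.
  have snoc : prime_lt (c' k.+1) (c k.+2) by rewrite c'k; exact: cc.2.
  exists (fun i => if (i <= k.+1)%N then c' i else c k.+2); split=> //=; last by rewrite ltnn.
  exact: prime_chain_snoc cc' I snoc.
have h1 : prime_lt (c k) (c k.+1) by apply: cc.2.
have h2 : prime_lt (c k.+1) (c k.+2) by apply: cc.2.
have [t [kt tk xt]] := insert_prime h1 h2 xc xc1.
have cck : prime_chain (fun=> True) k c by split=> // i ik; apply: cc.2; exact: (leqW (leqW ik)).
have [|c' [cc' c'0 c'k c'x]] := IH _ (prime_chain_snoc cck I kt); first by rewrite ltnn.
rewrite ltnn in c'k.
have snoc : prime_lt (c' k.+1) (c k.+2) by rewrite c'k.
exists (fun i => if (i <= k.+1)%N then c' i else c k.+2); split=> //=; last by rewrite ltnn.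
exact: prime_chain_snoc cc' I snoc.
Qed.

(** After [move_chain], all terms but the first contain x. A chain whose top misses x is first
    prolonged by m. *)
Lemma dim_le_add (X : prime_idealr R -> Prop) (x : R) n : up_closed X -> x \in m ->
  dim_le (fun p => X p /\ x \in p) n -> dim_le X n.+1.
Proof.
move=> Xup mx Xn.
have main k c : prime_chain X k.+1 c -> x \in c k.+1 -> (k <= n)%N.
  move=> cc xc; have ccT : prime_chain (fun=> True) k.+1 c by exact: prime_chainW cc.
  have [c' [cc' c'0 _ c'x]] := move_chain ccT xc.
  apply: (Xn k (fun i => c' i.+1)); split=> i ik; last by apply: cc'.2.
  split; last by apply: (prime_chain_le (i := 1) (j := i.+1) cc').
  apply: (Xup (c' 0%N)); first by rewrite c'0; apply: cc.1.
  exact: (prime_chain_le (i := 0) (j := i.+1) cc').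
move=> [|k] c cc //; have [xc|xc] := boolP (x \in c k.+1).
  exact: main cc xc.
have h : prime_lt (c k.+1) m.
  split; first exact: sub_max.
  by move=> mc; move: xc; rewrite mc.
have Xm : X m by apply: (Xup (c k.+1)); [exact: cc.1|exact: sub_max].
apply: leqW; apply: (main k.+1 (fun i => if (i <= k.+1)%N then c i else m)); last by rewrite ltnn.
exact: prime_chain_snoc.
Qed.

Definition all_in (x : seq R) p := forall a, a \in x -> a \in p.

Lemma dim_le_addn (X : prime_idealr R -> Prop) (x : seq R) n : up_closed X -> all_in x m ->
  dim_le (fun p => X p /\ all_in x p) n -> dim_le X (n + size x).
Proof.
elim: x n X => [|a x IH] n X Xup mx h /=.
  by rewrite addn0 => k c cc; apply: h; apply: prime_chainW cc => p Xp; split.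
rewrite addnS; apply: (dim_le_add (x := a)) => //; first exact/mx/mem_head.
apply: IH.
- by move=> p q [Xp pa] pq; split; [exact: Xup pq|exact: pq].
- by move=> b xb; apply: mx; rewrite inE xb orbT.
- move=> k c cc; apply: h; apply: prime_chainW cc => p [[Xp pa] px]; split=> // b.
  by rewrite inE => /predU1P[->|/px].
Qed.

(** Only m contains a generating list of m, so [dim_le_addn] starts from dimension 0. *)
Lemma finite_dim : exists n, dim_le (fun=> True) n.
Proof.
have [x xP] := noeth_regular hR (submod_prime m).
exists (0 + size x)%N; apply: dim_le_addn => //.
  by move=> a /(@lspan_mem _ R^o) /xP.
move=> [|k] c // [c1 c2]; have [_ []] := c2 0%N isT.
have [//|_ c0] := c1 0%N; move=> a /(sub_max hR hm) /xP.
apply: (@lspan_min _ R^o x [set a : R^o | (a : R) \in c 0%N]) => //.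
exact: submod_prime.
Qed.

Lemma dim_leW (X Y : prime_idealr R -> Prop) n : (forall p, X p -> Y p) -> dim_le Y n -> dim_le X n.
Proof. by move=> XY h k c /(prime_chainW XY) /h. Qed.

Definition is_dim (X : prime_idealr R -> Prop) n := dim_le X n /\ exists c, prime_chain X n c.

Lemma exists_dim (X : prime_idealr R -> Prop) : (exists p, X p) -> exists n, is_dim X n.
Proof.
move=> [p Xp]; have [b bP] := finite_dim.
pose Q n : bool := `[< exists c, prime_chain X n c >].
have [||n /asboolP nP nmax] := @ex_maxnP Q b.
- by exists 0%N; apply/asboolP; exists (fun=> p); split.
- by move=> n /asboolP[c]; exact: (dim_leW (Y := fun=> True)).
by exists n; split=> // k c cc; apply: nmax; apply/asboolP; exists c.
Qed.

Lemma is_dim_inj (X : prime_idealr R -> Prop) n k : is_dim X n -> is_dim X k -> n = k.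
Proof.
by move=> [h1 [c cc]] [h2 [c' cc']]; apply/eqP; rewrite eqn_leq (h2 _ _ cc) (h1 _ _ cc').
Qed.

Lemma prime_chain_cat (X : prime_idealr R -> Prop) n k c c' :
  prime_chain X n c -> prime_chain X k c' ->
  c n =i c' 0%N -> prime_chain X (n + k) (fun i => if (i < n)%N then c i else c' (i - n)%N).
Proof.
move=> [c1 c2] [c1' c2'] cE; split=> i ink.
  case: ltnP => ni; first by apply: c1; exact: ltnW.
  by apply: c1'; rewrite leq_subLR.
case: (ltnP i n) => ni; last first.
  rewrite ltnNge (leqW ni) /= subSn //; apply: c2'.
  by rewrite ltn_subLR.
have [h1 h2] := c2 i ni; case: (ltnP i.+1 n) => // ni'.
have <- : n = i.+1 by apply/eqP; rewrite eqn_leq ni' ni.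
have {ni'} nE : i.+1 = n by apply/eqP; rewrite eqn_leq ni' ni.
rewrite nE in h1 h2; rewrite subnn; split=> [a /h1|h]; first by rewrite cE.
by apply: h2 => a; rewrite cE; exact: h.
Qed.

End KrullDimension.

(** * Systems of parameters *)

Lemma nat_sup_max (X : set nat) n : X n -> (forall k, X k -> (k <= n)%N) ->
  nat_sup X = n%:Z%:E%E.
Proof.
move=> Xn nmax; rewrite /nat_sup /supremum ifF; last first.
  by apply/negbTE/set0P; exists (n%:Z%:E)%E, n.
have nS : supremums [set k%:Z%:E%E | k in X] n%:Z%:E%E.
  by split=> [_ [k Xk <-]|y]; [rewrite lee_fin lez_nat; exact: nmax|apply; exists n].
by case: xgetP => [y _ yS|/(_ _ nS)//]; exact: (is_subset1_supremums yS nS).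
Qed.

Lemma nat_sup0 (X : set nat) : (forall n, ~ X n) -> nat_sup X = -oo%E.
Proof.
move=> X0; rewrite /nat_sup (_ : [set _ | _ in X] = set0) ?supremum0 //.
by apply/seteqP; split=> // y [n Xn _]; case: (X0 n Xn).
Qed.

Section SystemsOfParameters.
Variables (R : comNzRingType) (m : prime_idealr R) (M : lmodType R).
Hypotheses (hR : noetherian R) (hm : local_ring m) (hM : noeth M).
Implicit Types (p q r : prime_idealr R) (x : seq R).

Lemma supp_in_supp p : supp M p <-> in_supp [set 0 : M] p.
Proof.
split=> [[z z0]|[u u0]].
  have [u [s zE]] : exists u s, z = locfrac u s by exists (repr z).1, (repr z).2; exact: locfracE.
  exists u => -[c pc cu]; move/eqP: z0; apply; rewrite zE locfrac0; apply/locfracP.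
  by exists (exist (fun s => is_true (s \notin p)) c pc); rewrite /= scale1r cu !scaler0.
exists (locfrac u (denom1 p)); apply/eqP => /locfracP[[c pc]] /=.
by rewrite scale1r !scaler0 => cu; apply: u0; exists c.
Qed.

Definition seq_set x : set M := [set u | u \in seq_submod M x].

Lemma submod_seq x : submod_set (seq_set x).
Proof. exact: submod_set_closed_mem. Qed.

Lemma seq_set_nil : seq_set [::] = [set 0].
Proof.
apply/seteqP; split=> u; first by move=> /mem_mk_submod[f ->] /=; rewrite big_ord0.
by move=> ->; exact: submod_set0 (submod_seq _).
Qed.

Lemma seq_set_rcons x a : seq_set (rcons x a) = sum_set (seq_set x) (mul_set a).
Proof.
apply/seteqP; split=> u.
  move=> /mem_mk_submod[f ->]; rewrite size_rcons big_ord_recr /= nth_rcons ltnn eqxx.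
  exists (\sum_(j < size x) x`_j *: f j); first by apply/mem_mk_submod; exists f.
  exists (a *: f (size x)); first by exists (f (size x)).
  by congr (_ + _); apply: eq_bigr => j _; rewrite nth_rcons ltn_ord.
move=> [_ /mem_mk_submod[f ->] [_ [w ->] ->]]; apply/mem_mk_submod.
exists (fun j => if j == size x then w else f j).
rewrite size_rcons big_ord_recr /= nth_rcons ltnn !eqxx; congr (_ + _).
by apply: eq_bigr => j _; rewrite nth_rcons ltn_ord (ltn_eqF (ltn_ord j)).
Qed.

Lemma seq_set_take x i : (i < size x)%N ->
  seq_set (take i.+1 x) = sum_set (seq_set (take i x)) (mul_set x`_i).
Proof. by move=> ix; rewrite (take_nth 0) // seq_set_rcons. Qed.

(** By Nakayama, (M/N)_p cannot vanish on division by an element of p unless it is already zero. *)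
Lemma supp_add_mul (N : set M) a p : submod_set N ->
  in_supp (sum_set N (mul_set a)) p <-> in_supp N p /\ a \in p.
Proof.
move=> hN; have hNa := submod_sum hN (submod_mul a); split=> [[u Nu]|[[u Nu] pa]].
  split; first by exists u => h; apply: Nu; apply: sat_mono h; apply: sum_setl; exact: submod_mul.
  apply: contrapT => /negP pa; apply: Nu; exists a => //.
  by apply: sum_setr => //; exists u.
apply: contrapT => h; apply: Nu.
apply: (nakayama1 hM (@submod_setT _ M) hN pa) (I : [set: M] u) => v _.
have [c pc [n Nn [_ [w ->] cE]]] : sat p (sum_set N (mul_set a)) v.
  by apply: contrapT => nv; apply: h; exists v.
by exists c => //; exists n => //; exists (a *: w) => //; exists w.
Qed.

Lemma supp_seq x p : in_supp (seq_set x) p <-> in_supp [set 0 : M] p /\ all_in x p.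
Proof.
elim/last_ind: x => [|x a IH]; first by rewrite seq_set_nil; split=> [|[]].
rewrite seq_set_rcons supp_add_mul ?IH; last exact: submod_seq.
split=> [[[Zp px] pa]|[Zp px]]; split=> //.
- by move=> b; rewrite mem_rcons inE => /predU1P[->|/px].
- by split=> // b xb; apply: px; rewrite mem_rcons inE xb orbT.
- by apply: px; rewrite mem_rcons mem_head.
Qed.

Lemma up_closed_supp (N : set M) : up_closed (in_supp N).
Proof. by move=> p q Np pq; exact: in_supp_up Np. Qed.

Variable d : nat.
Hypothesis hd : is_dim (in_supp [set 0 : M]) d.

(** The bound on dim M/xM is the smallest possible, by [dim_le_addn]. *)
Definition part_sop x :=
  [/\ all_in x m, (size x <= d)%N & dim_le (in_supp (seq_set x)) (d - size x)].

Lemma part_sop_nil : part_sop [::].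
Proof. by split=> //; rewrite subn0 seq_set_nil; exact: hd.1. Qed.

(** Each of the remaining elements lowers the dimension by at most one. *)
Lemma part_sop_take x i : part_sop x -> (i <= size x)%N -> part_sop (take i x).
Proof.
move=> [mx xd xdim] ix; have sz : size (take i x) = i by rewrite size_takel.
split.
- by move=> a /mem_take /mx.
- by rewrite sz; exact: leq_trans xd.
- have -> : (d - size (take i x) = (d - size x) + size (drop i x))%N.
    by rewrite sz size_drop addnBA // subnK.
  apply: (dim_le_addn hR hm); first exact: up_closed_supp.
    by move=> a /mem_drop /mx.
  apply: dim_leW xdim => p [/supp_seq[Zp px] px']; apply/supp_seq; split=> // a.
  by rewrite -[x in _ \in x](cat_take_drop i) mem_cat => /orP[/px|/px'].
Qed.

Lemma mod_dimE : mod_dim M = d%:Z%:E%E.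
Proof.
have [dle [c cc]] := hd; apply: nat_sup_max.
  by exists c; apply: prime_chainW cc => p /supp_in_supp.
by move=> k [c' cc']; apply: (dle k c'); apply: prime_chainW cc' => p /supp_in_supp.
Qed.

(** For [a] in m outside p and [u] surviving at p, the submodules generated by the a^k u form strict
    chains of any length: if a^k u = c a^(k+1) u modulo N, then a^k (1 - c a), which is outside p,
    kills u modulo N. *)
Lemma finite_length_supp (N : submodClosed M) p : finite_length (quotmod N) ->
  in_supp [set u | u \in N] p -> {subset m <= p}.
Proof.
move=> [b bP] [u Nu] a ma; apply: contrapT => /negP pa.
suff : (b.+1 <= b)%N by rewrite ltnn.
pose C i := mk_submod (submod_cyc (a ^+ (b.+1 - i)%N *: qpi N u)).
apply: (bP b.+1 C) => i ib.
have E : (b.+1 - i = (b.+1 - i.+1).+1)%N by rewrite -subSn.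
split=> [z /mem_mk_submod[c ->]|sub].
  by apply/mem_mk_submod; exists (c * a); rewrite E exprS !scalerA mulrA.
have : a ^+ (b.+1 - i.+1)%N *: qpi N u \in C i by apply/sub/mem_mk_submod; exact: cyc_id.
move=> /mem_mk_submod[c]; rewrite E exprS; set k := (b.+1 - i.+1)%N => e.
have : qpi N ((a ^+ k * (1 - c * a)) *: u) = 0.
  have -> : a ^+ k * (1 - c * a) = a ^+ k - c * (a * a ^+ k) by ring.
  by rewrite scalerBl linearB !linearZ /= e scalerA scalerN subrr.
move=> /qpi_eq0 h; apply: Nu; exists (a ^+ k * (1 - c * a)) => //.
apply: notinM; first by apply: contra pa => /expr_prime.
apply/negP => /(sub_max hR hm) h1; have /negP[] := notin1 m.
by rewrite -[1](subrK (c * a)) rpredD // inMl.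
Qed.

(** Localising at m changes nothing, so [finite_chains] bounds chains in M/N itself. *)
Lemma supp_finite_length (N : submodClosed M) :
  (forall p, in_supp [set u | u \in N] p -> {subset m <= p}) -> finite_length (quotmod N).
Proof.
move=> hN.
have [|b bP] := finite_chains hR (p := m) hM (submod_set_closed_mem N).
  by move=> q _; exact: hN.
exists b; case=> [|k] C Cs //.
apply: (bP k.+1 (fun i => if (i <= k.+1)%N then [set u | qpi N u \in C i] else set0)) => i ik.
  rewrite ik; split=> //.
    split=> [|a u v /= Cu Cv]; first by rewrite /= linear0 rpred0.
    by rewrite linearP rpredD // rpredZ.
  by move=> u /= /qpi_eq0 ->; exact: rpred0.
rewrite ik ltnW //; have [C1 nC2] := Cs i ik; split; first by move=> u /= /C1.
move=> h; apply: nC2 => z; have [u <-] := qpi_surj z => Cu.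
apply: (sat_max hR hm (N := [set u | qpi N u \in C i])); last exact: h.
split=> [|a v w /= Cv Cw]; first by rewrite /= linear0 rpred0.
by rewrite linearP rpredD // rpredZ.
Qed.

Lemma sopP x : sop m M x <-> part_sop x /\ size x = d.
Proof.
rewrite /sop mod_dimE; split=> [[mx sz fl]|[[mx xd xdim] sz]].
  have {}sz : size x = d by case: sz.
  split=> //; split=> //; first by rewrite sz.
  move=> [|k] c // [c1 c2]; have [_ []] := c2 0%N isT.
  by move=> a /(sub_max hR hm); apply: (finite_length_supp fl); exact: c1.
split=> //; first by rewrite sz.
apply: supp_finite_length => p pS a ma; apply: contrapT => /negP pa.
suff : (1 <= 0)%N by [].
rewrite sz subnn in xdim; apply: (xdim 1%N (fun i => if i is 0%N then p else m)).
split=> [[|i] _ //|[|i] // _].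
  by apply: in_supp_up pS; exact: sub_max.
split; first exact: sub_max.
by move=> mp; move: pa; rewrite mp.
Qed.

(** The hypothesis says that no prime of Supp(M/xM) containing p starts a chain of length d - |x|.
    Prime avoidance gives y in p outside the finitely many associated primes that do start one, and
    the dimension drops. *)
Lemma part_sop_extend x p : part_sop x -> (size x < d)%N ->
  (forall q c, in_supp (seq_set x) q -> {subset p <= q} ->
     ~ prime_chain (fun r => {subset q <= r}) (d - size x) c) ->
  exists2 y, y \in p & part_sop (rcons x y).
Proof.
move=> [mx _ xdim] xd hp.
have [l [lP lA]] := ass_list hR hm hM (submod_seq x).
have [l' l'P] := exists_filter l
  (fun q => exists c, prime_chain (fun r => {subset q <= r}) (d - size x) c).
have [q /l'P[lq [c cc]]|y py ly] := prime_avoidance (l := l') (submod_prime p).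
  apply: contrapT => h; apply: (hp q c) => //; first exact/ass_in_supp/lA.
  by move=> a pa; apply: contrapT => /negP qa; apply: h; exists a.
exists y => //; split.
- by move=> a; rewrite mem_rcons inE => /predU1P[->|/mx //]; exact: (sub_max hR hm) py.
- by rewrite size_rcons.
move=> k c cc; rewrite size_rcons.
have ccx : prime_chain (in_supp (seq_set x)) k c.
  by apply: prime_chainW cc => q; rewrite seq_set_rcons => /supp_add_mul[]; first exact: submod_seq.
have kd := xdim _ _ ccx; rewrite subnS.
have [kd'|kd'|kd'] := ltngtP k (d - size x).
- by rewrite -ltnS prednK // subn_gt0.
- by move: kd; rewrite leqNgt kd'.
have yc : y \in c 0%N.
  have := cc.1 0%N isT; rewrite seq_set_rcons => /supp_add_mul[] //; exact: submod_seq.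
have [t tc tA] := in_supp_ass hR (submod_seq x) (ccx.1 0%N isT).
have [q lq tq] := lP t tA.
have qc : {subset q <= c 0%N} by move=> a; rewrite -tq; exact: tc.
(* A chain of full length d - |x| cannot be prolonged downwards, so its first term is the associated
   prime q, which y avoids. *)
have [cq|ncq] := pselect ({subset c 0%N <= q}).
  have /negP[] : y \notin q; last exact: cq.
  apply: ly; apply/l'P; split=> //; exists c; rewrite -kd'; split=> i ik; last by apply: cc.2.
  by move=> a /qc; apply: (prime_chain_le cc).
have Xq : in_supp (seq_set x) q by exact/ass_in_supp/lA.
by have := xdim _ _ (prime_chain_cons ccx Xq (conj qc ncq)); rewrite kd' ltnn.
Qed.

Lemma part_sop_complete x : part_sop x -> exists2 z, sop m M z & x = take (size x) z.
Proof.
move=> xs; have xd : (size x <= d)%N by case: xs.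
suff [z zs xz] : exists2 z, part_sop z /\ size z = d & x = take (size x) z.
  by exists z => //; exact/sopP.
move: {2}(d - size x)%N (erefl (d - size x)%N) => n.
elim: n x xs xd => [|n IH] x xs xd nE.
  exists x; last by rewrite take_size.
  by split=> //; apply/eqP; rewrite eqn_leq xd -subn_eq0 nE.
have xd' : (size x < d)%N by rewrite -subn_gt0 nE.
have [q c _ mq [c1 c2]|y my ys] := part_sop_extend (p := m) xs xd'.
  have d0 : (0 < d - size x)%N by rewrite subn_gt0.
  by have [_] := c2 0%N d0; apply=> a /(sub_max hR hm) /mq; exact: c1.
have [||z zs zE] := IH _ ys; first by rewrite size_rcons.
  by rewrite size_rcons subnS nE.
exists z => //; move: zE; rewrite size_rcons => zE.
have sz : (size x < size z)%N by rewrite zs.2.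
move: zE; rewrite (take_nth 0) // => /eqP; by rewrite eqseq_rcons => /andP[/eqP].
Qed.

(* Nakayama's lemma applied to the elements of V/N that q kills at p. *)
Lemma ass_lift (N : set M) p q a : submod_set N -> is_ass N q -> {subset q <= p} -> a \in p ->
  (forall u, N (a *: u) -> sat p N u) ->
  exists t, [/\ is_ass (sum_set N (mul_set a)) t, {subset q <= t}, a \in t & {subset t <= p}].
Proof.
move=> hN [u uP] qp pa areg.
have hNa := submod_sum hN (submod_mul a).
have hsN := submod_sat p hN.
pose A : set M := [set v | forall c, c \in q -> sat p N (c *: v)].
have hA : submod_set A.
  split=> [c _|b v w Av Aw c qc]; first by rewrite scaler0; exact: submod_set0.
  rewrite scalerDr scalerA mulrC -scalerA.
  by apply: submod_setD; [|apply: submod_setZ => //; exact: Av|exact: Aw].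
have aregs w : sat p N (a *: w) -> sat p N w.
  move=> [s ps]; rewrite scalerA mulrC -scalerA => /areg; exact: sat_scale.
have [v Av nv] : exists2 v, A v & ~ sat p (sum_set N (mul_set a)) v.
  apply: contrapT => h.
  have AN : A `<=` sat p N.
    apply: (nakayama1 hM hA hN pa) => v Av.
    have [s ps [n Nn [_ [w ->] sE]]] : sat p (sum_set N (mul_set a)) v.
      by apply: contrapT => nv; apply: h; exists v.
    exists s => //; exists n => //; exists (a *: w) => //; exists w => // c qc.
    apply: aregs; apply: (submod_setDr hsN (u := c *: n)).
      by apply: sub_sat; exact: submod_setZ.
    rewrite scalerA mulrC -scalerA -scalerDr -sE scalerA mulrC -scalerA.
    by apply: submod_setZ => //; exact: Av.
  have [s /negP ps /uP /qp //] : sat p N u.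
  by apply: AN => c /uP; exact: sub_sat.
have [t [c [tp tP]]] := exists_ass hR hNa nv.
exists t; split=> //; first by exists (c *: v).
  move=> b qb; have [s ps Ns] := Av b qb.
  have : s * b \in t.
    apply/tP; rewrite scalerA mulrC -scalerA; apply: submod_setZ => //.
    by rewrite -scalerA; apply: sum_setl => //; exact: submod_mul.
  by rewrite prime_idealrM => /orP[/tp|//]; rewrite (negbTE ps).
by apply/tP/sum_setr => //; exists (c *: v).
Qed.

(** Regularity of x on M_p, apart from the condition that M_p/xM_p be nonzero, which is
    [in_supp (seq_set M x) p]. *)
Definition loc_regular p x := forall i, (i < size x)%N ->
  forall u, seq_set (take i x) (x`_i *: u) -> sat p (seq_set (take i x)) u.

End SystemsOfParameters.

Arguments seq_set {R} M x _.

(** * Free resolutions and finite generation of Ext *)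

Section ExtModules.
Variable R : comNzRingType.
Implicit Types (K L M N V W P : lmodType R) (q : prime_idealr R).

Definition projective P := forall V W (e : {linear V -> W}) (f : {linear P -> W}),
  (forall z, exists v, e v = f z) -> exists g : {linear P -> V}, forall z, e (g z) = f z.

Lemma lift_inj V K W (e : {linear K -> W}) (g : {linear V -> W}) :
  injective e -> (forall v, exists k, e k = g v) ->
  exists h : {linear V -> K}, forall v, e (h v) = g v.
Proof.
move=> ei /choice[h hP].
have hL : linear h by move=> a u v; apply: ei; rewrite linearP !hP linearP.
by exists (mk_linear hL : {linear V -> K}).
Qed.

Section FreeProjective.
Variable N : lmodType R.

Definition fdelta (y : N) : N -> R^o := fun z => (z == y)%:R.

Lemma fdelta_supp y : fdelta y \in mk_submod (@fin_supp_subproof R N).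
Proof.
apply/mem_mk_submod; apply: (@sub_finite_set _ _ [set y]) => // z /=.
by rewrite /fdelta; case: (z =P y) => // _ /eqP[].
Qed.

Definition free_delta y : free_mod N := Submod (fdelta_supp y).

Lemma free_mod_sum (z : free_mod N) (A : set N) : finite_set A ->
  (forall y, ~ A y -> submod_val z y = 0) ->
  z = \sum_(y <- fset_set A) (submod_val z y : R) *: free_delta y.
Proof.
move=> fA hA; apply: val_inj; apply/funext => y0 /=.
rewrite (linear_sum (@submod_val _ _ _)) fct_sumE.
have E (y : N) : submod_val ((submod_val z y : R) *: free_delta y) y0
    = if y == y0 then submod_val z y0 else 0.
  rewrite linearZ /= -[LHS]/((submod_val z y : R) * (y0 == y)%:R) eq_sym.
  by case: eqP => [->|_]; rewrite ?mulr1 ?mulr0.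
rewrite (eq_bigr _ (fun y _ => E y)).
have [Ay|nAy] := pselect (A y0); last first.
  by rewrite hA // big1 // => y _; case: ifP.
rewrite (bigD1_seq y0) /=; [|by rewrite in_fset_set //; exact: mem_set|exact: fset_uniq].
by rewrite eqxx big1 ?addr0 // => y /negbTE ->.
Qed.

Lemma free_mod_projective : projective (free_mod N).
Proof.
move=> V W e f ef; have [phi phiP] := choice (fun y => ef (free_delta y)).
pose g (z : free_mod N) := \sum_(y \in [set: N]) (submod_val z y : R) *: phi y.
have gE (z : free_mod N) (A : set N) : finite_set A -> (forall y, ~ A y -> submod_val z y = 0) ->
    g z = \sum_(y <- fset_set A) (submod_val z y : R) *: phi y.
  move=> fA hA; rewrite /g -fsbig_finite //; apply/esym/fsbig_widen => // y [_ Ay] /=.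
  by rewrite hA // scale0r.
have suppP (z : free_mod N) y : ~ [set y | submod_val z y != 0] y -> submod_val z y = 0.
  by move=> /negP; rewrite negbK => /eqP.
have gL : linear g.
  move=> a u v; pose A := [set y | submod_val u y != 0] `|` [set y | submod_val v y != 0].
  have fA : finite_set A by rewrite finite_setU; split; exact: free_mod_fin_supp.
  have Au y : ~ A y -> submod_val u y = 0 by move=> /not_orP[/suppP].
  have Av y : ~ A y -> submod_val v y = 0 by move=> /not_orP[_ /suppP].
  rewrite !(gE _ A) //; last first.
    move=> y Ay; rewrite linearP -[_ y]/(a *: submod_val u y + submod_val v y).
    by rewrite Au // Av // scaler0 addr0.
  rewrite scaler_sumr -big_split; apply: eq_bigr => y _.
  rewrite linearP -[(_ + _) y]/(a *: submod_val u y + submod_val v y).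
  by rewrite scalerDl -scalerA.
exists (mk_linear gL : {linear free_mod N -> V}) => z.
rewrite -[LHS]/(e (g z)) (gE _ _ (free_mod_fin_supp z) (@suppP z)).
rewrite [in RHS](free_mod_sum (free_mod_fin_supp z) (@suppP z)) !linear_sum.
by apply: eq_bigr => y _; rewrite !linearZ /= phiP.
Qed.

End FreeProjective.

Lemma row_projective n : projective 'rV[R]_n.
Proof.
move=> V W e f ef; have [phi phiP] := choice (fun j => ef (delta_mx 0 j)).
have gL : linear (fun v : 'rV[R]_n => \sum_j v 0 j *: phi j).
  move=> a u v; rewrite scaler_sumr -big_split; apply: eq_bigr => j _ /=.
  by rewrite !mxE scalerDl scalerA.
exists (mk_linear gL : {linear 'rV[R]_n -> V}) => z.
rewrite -[LHS]/(e (\sum_j z 0 j *: phi j)) linear_sum [in RHS](row_sum_delta z) linear_sum.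
by apply: eq_bigr => j _; rewrite !linearZ /= phiP.
Qed.

Lemma submod_set_sum V (A : set V) (I : Type) (r : seq I) (F : I -> V) :
  submod_set A -> (forall i, A (F i)) -> A (\sum_(i <- r) F i).
Proof.
move=> hA AF; elim: r => [|i r IH]; first by rewrite big_nil; exact: submod_set0.
by rewrite big_cons; exact: submod_setD.
Qed.

Lemma noeth_gen V (s : seq V) : noetherian R -> (forall v, lspan s v) -> noeth V.
Proof. by move=> hR sT A hA; apply: (noeth_lspan hR (s := s)). Qed.

Lemma noeth_row n : noetherian R -> noeth 'rV[R]_n.
Proof.
move=> hR; apply: (noeth_gen (s := [seq delta_mx 0 j | j <- enum 'I_n])) => // v.
rewrite (row_sum_delta v); apply: submod_set_sum; first exact: submod_lspan.
move=> j; apply: submod_setZ; first exact: submod_lspan.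
by apply: lspan_mem; apply: map_f; rewrite mem_enum.
Qed.

Lemma noeth_cover V : noeth V -> exists n (e : {linear 'rV[R]_n -> V}), forall v, exists z, e z = v.
Proof.
move=> nV; have [s sP] := nV _ (@submod_setT R V).
have eL : linear (fun v : 'rV[R]_(size s) => \sum_j v 0 j *: s`_j).
  move=> a u v; rewrite scaler_sumr -big_split; apply: eq_bigr => j _ /=.
  by rewrite !mxE scalerDl scalerA.
exists (size s), (mk_linear eL : {linear 'rV[R]_(size s) -> V}) => v.
have /sP /lspanP[a ->] : [set: V] v by [].
exists (\row_j a j); rewrite -[LHS]/(\sum_j (\row_j a j) 0 j *: s`_j).
by apply: eq_bigr => j _; rewrite mxE.
Qed.

Lemma noeth_ffun n V : noetherian R -> noeth V -> noeth ('I_n -> V).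
Proof.
move=> hR nV; have [s sP] := nV _ (@submod_setT R V).
pose d (j : 'I_n) (x : V) : 'I_n -> V := fun i => if i == j then x else 0.
apply: (noeth_gen (s := [seq d j x | j <- enum 'I_n, x <- s])) => // f.
have -> : f = \sum_j d j (f j).
  apply/funext => i; rewrite fct_sumE (bigD1 i) //= /d eqxx big1 ?addr0 // => j.
  by rewrite eq_sym => /negbTE ->.
apply: submod_set_sum; first exact: submod_lspan.
move=> j; have /sP : [set: V] (f j) by [].
set t := [seq _ | _ <- _, _ <- _].
apply: (lspan_min (A := [set x | lspan t (d j x)])).
  split=> [|a u v /= hu hv].
    rewrite /mkset; suff -> : d j 0 = 0 by exact: (submod_set0 (submod_lspan t)).
    by apply/funext => i; rewrite /d; case: ifP.
  rewrite /mkset; suff -> : d j (a *: u + v) = a *: d j u + d j v by apply: (submod_lspan t).2.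
  apply/funext => i; rewrite -[RHS]/(a *: d j u i + d j v i) /d.
  by case: ifP => // _; rewrite scaler0 addr0.
by move=> x xs; apply: lspan_mem; apply/allpairsP; exists (j, x); rewrite mem_enum.
Qed.

Definition incl N : {linear relations N -> free_mod N} := @submod_val _ _ _.

Lemma incl_inj N : injective (@incl N).
Proof. exact: val_inj. Qed.

Lemma eval_incl N (z : relations N) : free_eval (incl N z) = 0.
Proof. by case: z => w hw; exact: (proj1 (mem_mk_submod _ w) hw). Qed.

Lemma incl_exact N (v : free_mod N) : free_eval v = 0 -> exists z, incl N z = v.
Proof. by move=> v0; exists (Submod (proj2 (mem_mk_submod (@relations_subproof R N) v) v0)). Qed.

(** The class of f in Ext^n(L, M) is 0, where Ext^n is Hom([syzygy L n], M) modulo the maps that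
    extend to the free module; for n = 0 nothing is divided out. *)
Definition triv L M n : (syzygy L n -> M) -> Prop :=
  if n is k.+1 then fun f => exists g : {linear resol L k -> M}, forall z, f z = g (incl _ z)
  else fun f => forall z, f z = 0.

Lemma triv_eq L M n (f g : syzygy L n -> M) : f =1 g -> triv f -> triv g.
Proof.
by case: n f g => [|n] f g fg /=; [move=> f0 z; rewrite -fg|move=> [h hP]; exists h => z;
  rewrite -fg].
Qed.

Lemma triv_comp L M M' n (h : {linear M -> M'}) (f : syzygy L n -> M) :
  triv f -> triv (h \o f).
Proof.
case: n f => [|n] f /=; first by move=> f0 z; rewrite f0 linear0.
by move=> [g gP]; exists (h \o g) => z /=; rewrite gP.
Qed.

Lemma triv_lift L M M' n (h : {linear M -> M'}) (f : syzygy L n -> M') :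
  (forall y, exists x, h x = y) -> triv f ->
  exists k : {linear syzygy L n -> M}, triv k /\ forall z, h (k z) = f z.
Proof.
move=> hs; case: n f => [|n] f /=.
  by move=> f0; exists \0; split=> // z; rewrite f0 linear0.
move=> [g gP]; have [g' g'P] := free_mod_projective (e := h) (f := g) (fun z => hs _).
by exists (g' \o incl _); split=> [|z]; [exists g'|rewrite gP -g'P].
Qed.

(** Multiplication by x on the resolution is null-homotopic, so on each syzygy it extends to the
    ambient free module. *)
Lemma scale_extends L (x : R) n : (forall z : L, x *: z = 0) ->
  exists h : {linear resol L n -> relations (syzygy L n)}, forall z, h (incl _ z) = x *: z.
Proof.
move=> xL; elim: n => [|n [h hP]].
  have [|h hP] := @lift_inj (resol L 0) _ _ (incl _) (x \*: idfun) (@incl_inj _).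
    by move=> v; apply: incl_exact; rewrite /= linearZ /= xL.
  by exists h => z; apply: incl_inj; rewrite hP linearZ.
have [h' h'P] := free_mod_projective (e := @free_eval R (syzygy L n.+1)) (f := h) (fun z =>
  free_eval_surj _).
(* Subtracting the lift of [h] sends x v into the kernel of the evaluation and changes nothing on
   that kernel. *)
pose g : {linear resol L n.+1 -> resol L n.+1} :=
  (x \*: idfun) \- (h' \o (@incl _ \o @free_eval R _)).
have gE v : g v = x *: v - h' (incl _ (free_eval v)) by [].
have [|k kP] := @lift_inj _ _ _ (incl _) g (@incl_inj _).
  by move=> v; apply: incl_exact; rewrite gE linearB linearZ /= h'P hP subrr.
by exists k => z; apply: incl_inj; rewrite kP linearZ gE eval_incl !linear0 ?subr0 ?oppr0 ?addr0.
Qed.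

Lemma triv_kill L M (x : R) n (f : {linear syzygy L n -> M}) : (forall z : L, x *: z = 0) ->
  triv (fun z => x *: f z).
Proof.
move=> xL; case: n f => [|n] f /=; first by move=> z; rewrite -linearZ xL linear0.
have [h hP] := scale_extends n xL.
by exists (f \o h) => z /=; rewrite hP linearZ.
Qed.

(* Ext is defined through free modules of infinite rank. Its finite generation *)
(* comes from finitely generated K with maps to and from the syzygies whose   *)
(* composite is the identity up to a map factoring through the free module.   *)
Lemma stable_step L n K (a : {linear K -> syzygy L n}) (b : {linear syzygy L n -> K})
    P (al : {linear syzygy L n -> P}) (be : {linear P -> syzygy L n}) :
  noetherian R -> noeth K -> projective P -> (forall z, a (b z) = z + be (al z)) ->
  exists (K' : lmodType R) (a' : {linear K' -> syzygy L n.+1}) (b' : {linear syzygy L n.+1 -> K'})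
    (h : {linear resol L n -> syzygy L n.+1}),
    noeth K' /\ forall z, a' (b' z) = z + h (incl _ z).
Proof.
move=> hR nK hP abE.
have [r [e es]] := noeth_cover nK.
have ev_surj := @free_eval_surj R (syzygy L n).
have [a' a'P] := row_projective (e := @free_eval R (syzygy L n)) (f := a \o e) (fun z => ev_surj _).
have [b' b'P] := free_mod_projective (e := e) (f := b \o @free_eval R (syzygy L n)) (fun z => es _).
have [c cP] := hP _ _ (@free_eval R (syzygy L n)) be (fun z => ev_surj _).
have hker : submod_set [set v | e v = 0].
  by split=> [|s u v /= u0 v0]; rewrite /= ?linear0 // linearP /= u0 v0 scaler0 addr0.
pose K' : lmodType R := submod (mk_submod hker).
pose i : {linear K' -> 'rV[R]_r} := @submod_val _ _ _.
have i_inj : injective i by exact: val_inj.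
have iK k : e (i k) = 0 by case: k => w hw; exact: (proj1 (mem_mk_submod _ w) hw).
have [|a2 a2P] := @lift_inj K' _ _ (incl _) (a' \o i) (@incl_inj _).
  by move=> k; apply: incl_exact; rewrite /= a'P /= iK linear0.
have [|b2 b2P] := @lift_inj (relations (syzygy L n)) K' _ i (b' \o incl _) i_inj.
  move=> z; have v0 : e (b' (incl _ z)) = 0 by rewrite b'P /= eval_incl linear0.
  by exists (Submod (proj2 (mem_mk_submod hker _) v0)).
pose g : {linear resol L n -> resol L n} :=
  ((a' \o b') \- idfun) \- (c \o (al \o @free_eval R (syzygy L n))).
have gE v : g v = a' (b' v) - v - c (al (free_eval v)) by [].
have [|h hP'] := @lift_inj _ _ _ (incl _) g (@incl_inj _).
  move=> v; apply: incl_exact; rewrite gE !linearB /= a'P /= b'P /= abE cP.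
  by rewrite [X in X - _]addrAC subrr add0r subrr.
exists K', a2, b2, h; split; first exact: noeth_inj i_inj (noeth_row hR).
move=> z; apply: incl_inj; rewrite [RHS]linearD hP' gE eval_incl !linear0 addr0.
by rewrite a2P [LHS]/= b2P addrC subrK.
Qed.

Lemma stable_presentation L n : noetherian R -> noeth L ->
  exists (K : lmodType R) (a : {linear K -> syzygy L n}) (b : {linear syzygy L n -> K})
    (P : lmodType R) (al : {linear syzygy L n -> P}) (be : {linear P -> syzygy L n}),
    [/\ noeth K, projective P & forall z, a (b z) = z + be (al z)].
Proof.
move=> hR nL; elim: n => [|n [K [a [b [P [al [be [nK hP abE]]]]]]]].
  exists L, idfun, idfun, (free_mod L), \0, \0; split=> //; first exact: free_mod_projective.
  by move=> z; rewrite /= addr0.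
have [K' [a' [b' [h [nK' abE']]]]] := stable_step hR nK hP abE.
by exists K', a', b', (resol L n), (incl _), h; split=> //; exact: free_mod_projective.
Qed.

(** Up to trivial cocycles, every f factors through a finitely generated K: for n > 0 the
    discrepancy in [stable_step] is defined on the whole free module. *)
Lemma triv_stable L M n : noetherian R -> noeth L ->
  exists (K : lmodType R) (a : {linear K -> syzygy L n}) (b : {linear syzygy L n -> K}),
    noeth K /\ forall f : {linear syzygy L n -> M}, triv (fun z => f (a (b z)) - f z).
Proof.
move=> hR nL; case: n => [|n].
  by exists L, idfun, idfun; split=> // f z; rewrite /= subrr.
have [K [a [b [P [al [be [nK hP abE]]]]]]] := stable_presentation n hR nL.
have [K' [a' [b' [h [nK' abE']]]]] := stable_step hR nK hP abE.
exists K', a', b'; split=> // f; exists (f \o h) => z /=.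
by rewrite abE' linearD addrC addKr.
Qed.

End ExtModules.

(** * Local vanishing of Ext *)

Section ExtVanishing.
Variable R : comNzRingType.
Implicit Types (K L M V W P : lmodType R) (q p : prime_idealr R).

(* Ext^n(L, M)_q = 0, with one denominator for each cocycle. *)
Definition ext_zero q L M n := forall f : {linear syzygy L n -> M},
  exists2 s, s \notin q & triv (fun z => s *: f z).

Lemma ext_zero_retract q L M V n (h : {linear V -> M}) (k : {linear M -> V}) :
  (forall u, h (k u) = u) -> ext_zero q L V n -> ext_zero q L M n.
Proof.
move=> hk VZ f; have [s qs tr] := VZ (k \o f); exists s => //.
by apply: triv_eq (triv_comp h tr) => z; rewrite /= linearZ /= hk.
Qed.

(** * Division by an element regular on M_q *)

Section Step.
Variables (q : prime_idealr R) (L M M' : lmodType R) (x t : R) (h : {linear M -> M'}).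
Hypotheses (hs : forall y, exists u, h u = y) (hker : forall u, h u = 0 <-> exists v, u = x *: v).
Hypotheses (qt : t \notin q) (ht : forall u : M, x *: u = 0 -> t *: u = 0).

Lemma ext_zero0 : (forall z : L, x *: z = 0) -> ext_zero q L M 0.
Proof. by move=> xL f; exists t => // z; apply: ht; rewrite -linearZ xL linear0. Qed.

(* Ext^n(L, M/xM) -> Ext^(n+1)(L, M) -x-> Ext^(n+1)(L, M), where x acts as 0. *)
Lemma ext_zeroS n : (forall z : L, x *: z = 0) -> ext_zero q L M' n -> ext_zero q L M n.+1.
Proof.
move=> xL Z f; have [g gP] := triv_kill (n := n.+1) f xL.
have [||k1 k1P] := @factor_linear R (resol L n) (syzygy L n) M' (@free_eval R (syzygy L n)) (h \o g).
- exact: free_eval_surj.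
- by move=> v /incl_exact[z <-] /=; apply/hker; exists (f z); rewrite gP.
have [s qs tr] := Z k1.
have [k [ktr kP]] := triv_lift hs tr.
pose G : {linear resol L n -> M} := (s \*: g) \- (k \o @free_eval R (syzygy L n)).
have GE v : G v = s *: g v - k (free_eval v) by [].
have [|w wP] := free_mod_projective (e := x \*: idfun) (f := G).
  move=> v; suff /hker[u uE] : h (G v) = 0 by exists u.
  by rewrite GE linearB linearZ /= kP k1P subrr.
exists (t * s); first exact: notinM.
exists (t \*: w) => z; apply/eqP; rewrite -subr_eq0 /= -scalerA -scalerBr; apply/eqP/ht.
have := wP (incl _ z); rewrite GE eval_incl linear0 subr0 -gP /= => e.
by rewrite scalerBr [X in _ - X]e !scalerA mulrC subrr.
Qed.

(* Ext^n(L, M) -> Ext^n(L, M/xM) -> Ext^(n+1)(L, M). As (0 : x) is only       *)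
(* killed by t, division by x is replaced by the well-defined map x v |-> t v. *)
Lemma ext_zero_mod n : ext_zero q L M n -> ext_zero q L M n.+1 -> ext_zero q L M' n.
Proof.
move=> Zn ZS f.
have [g gP] := free_mod_projective (e := h) (f := f \o @free_eval R (syzygy L n)) (fun z => hs _).
have /choice[v vP] : forall z : relations (syzygy L n), exists u : M, g (incl _ z) = x *: u.
  by move=> z; apply/hker; rewrite gP /= eval_incl linear0.
have fL : linear (fun z => t *: v z).
  move=> a y z; apply/eqP; rewrite -subr_eq0 scalerA mulrC -scalerA -scalerDr -scalerBr.
  apply/eqP/ht; rewrite scalerBr scalerDr scalerA mulrC -scalerA -!vP.
  by rewrite [incl _ _]linearP linearP subrr.
have [s qs [w wP]] := ZS (mk_linear fL : {linear relations (syzygy L n) -> M}).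
pose G : {linear resol L n -> M} := ((s * t) \*: g) \- (x \*: w).
have GE y : G y = (s * t) *: g y - x *: w y by [].
have [||k kP] := @factor_linear R (resol L n) (syzygy L n) M (@free_eval R (syzygy L n)) G.
- exact: free_eval_surj.
- move=> y /incl_exact[z <-].
  have wE : w (incl _ z) = s *: (t *: v z) by exact: esym (wP z).
  rewrite GE vP wE; apply/eqP; rewrite subr_eq0 !scalerA; apply/eqP.
  by congr (_ *: _); ring.
have [s' qs' tr] := Zn k.
exists (s' * (s * t)); first by do ?apply: notinM.
apply: triv_eq (triv_comp h tr) => z; rewrite /= linearZ /=.
have [y <-] := free_eval_surj z.
rewrite kP GE linearB linearZ /= gP /=; have -> : h (x *: w y) = 0 by apply/hker; exists (w y).
by rewrite subr0 scalerA.
Qed.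

End Step.

(** * Ext along sequences regular on M_q *)

Section Sequences.
Variables (M : lmodType R) (hM : noeth M).

Lemma quot_step (N N' : submodClosed M) (a : R) :
  [set u | u \in N'] = sum_set [set u | u \in N] (mul_set a) ->
  exists h : {linear quotmod N -> quotmod N'},
    [/\ forall u, h (qpi N u) = qpi N' u, forall y, exists u, h u = y
      & forall u, h u = 0 <-> exists v, u = a *: v].
Proof.
move=> NE; have NP u : u \in N' <-> sum_set [set u | u \in N] (mul_set a) u by rewrite -NE.
have [||h hP] := @factor_linear R M (quotmod N) (quotmod N') (qpi N) (qpi N').
- exact: qpi_surj.
- by move=> v /qpi_eq0 Nv; apply/qpi_eq0/NP; apply: sum_setl => //; exact: submod_mul.
exists h; split=> // [y|u].
  by have [v <-] := qpi_surj y; exists (qpi N v); exact: hP.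
have [v <-] := qpi_surj u; rewrite hP; split.
  move=> /qpi_eq0 /NP[n Nn [_ [w ->] ->]]; exists (qpi N w).
  by rewrite linearD linearZ /= (proj2 (qpi_eq0 N n) Nn) add0r.
move=> [z]; have [w <-] := qpi_surj z => /eqP; rewrite -linearZ -subr_eq0 -linearB =>
  /eqP /qpi_eq0 h'.
apply/qpi_eq0/NP; exists (v - a *: w) => //; exists (a *: w); first by exists w.
by rewrite subrK.
Qed.

Lemma ext_zero_quot_nil L q n : ext_zero q L (quotmod (seq_submod M [::])) n <-> ext_zero q L M n.
Proof.
have [||h hP] := @factor_linear R M (quotmod (seq_submod M [::])) M (qpi (seq_submod M [::])) idfun.
- exact: qpi_surj.
- move=> v /qpi_eq0 => h; have : seq_set M [::] v by []; by rewrite seq_set_nil.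
split; first exact: (ext_zero_retract (h := h) (k := qpi (seq_submod M [::])) hP).
apply: (ext_zero_retract (h := qpi (seq_submod M [::])) (k := h)) => z.
by have [u <-] := qpi_surj z; rewrite hP.
Qed.

(** Data for one division: [sat_common] supplies a single t outside q killing everything that x_i
    kills. *)
Lemma loc_regular_step q (x : seq R) i : loc_regular M q x -> (i < size x)%N ->
  exists (t : R) (h : {linear quotmod (seq_submod M (take i x)) ->
    quotmod (seq_submod M (take i.+1 x))}),
   [/\ t \notin q, forall u : quotmod (seq_submod M (take i x)), x`_i *: u = 0 -> t *: u = 0,
       forall y, exists u, h u = y
      & forall u, h u = 0 <-> exists v, u = x`_i *: v].
Proof.
move=> xreg ix; have [h [_ hs hk]] := quot_step (seq_set_take M ix).
have [|t qt tP] := sat_common (p := q) hM (submod_seq M (take i x))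
   (A := [set u | seq_set M (take i x) (x`_i *: u)]) _ (xreg i ix).
  split=> [|a u v /= hu hv]; first by rewrite /mkset scaler0; exact: (submod_set0 (submod_seq _ _)).
  rewrite /mkset scalerDr scalerA mulrC -scalerA.
  by apply: submod_setD; [exact: submod_seq|apply: submod_setZ hu; exact: submod_seq|].
exists t, h; split=> // u; have [v <-] := qpi_surj u.
by rewrite -!linearZ => /qpi_eq0 xv; apply/qpi_eq0/tP.
Qed.

(** [ext_zeroS] trades a degree of Ext for an element of the sequence, down to Hom, which vanishes
    at q because that element is zero on L and regular on the target. *)
Lemma ext_zero_regular L q (x : seq R) : loc_regular M q x ->
  (forall a, a \in x -> forall z : L, a *: z = 0) ->
  forall j, (j < size x)%N -> ext_zero q L M j.
Proof.
move=> xreg xL j jx; suff H i : (j + i < size x)%N ->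
    ext_zero q L (quotmod (seq_submod M (take i x))) j.
  by apply/ext_zero_quot_nil; have := H 0%N; rewrite addn0 take0; apply.
elim: j i {jx} => [|j IH] i jx.
  have [t [h [qt ht hs hk]]] := loc_regular_step xreg jx.
  by apply: (ext_zero0 qt ht); apply: xL; exact: mem_nth.
have ix : (i < size x)%N by apply: leq_ltn_trans jx; exact: leq_addl.
have [t [h [qt ht hs hk]]] := loc_regular_step xreg ix.
apply: (ext_zeroS hs hk qt ht); first by apply: xL; exact: mem_nth.
by apply: IH; rewrite addnS -addSn.
Qed.

(** Each division costs one degree, by [ext_zero_mod]. *)
Lemma ext_zero_quot L q (x : seq R) r : loc_regular M q x -> (size x <= r)%N ->
  (forall j, (j <= r)%N -> ext_zero q L M j) ->
  forall j, (j + size x <= r)%N -> ext_zero q L (quotmod (seq_submod M x)) j.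
Proof.
move=> xreg xr Z; suff H i : (i <= size x)%N -> forall j, (j + i <= r)%N ->
    ext_zero q L (quotmod (seq_submod M (take i x))) j.
  by move=> j jr; have := H (size x) (leqnn _) j jr; rewrite take_size.
elim: i => [_ j|i IH ix j jr]; first by rewrite addn0 take0 => /Z /ext_zero_quot_nil.
have [t [h [qt ht hs hk]]] := loc_regular_step xreg ix.
apply: (ext_zero_mod hs hk qt ht); apply: IH; rewrite ?(ltnW ix) //.
  by apply: leq_trans jr; rewrite leq_add2l.
by rewrite addSn -addnS.
Qed.

(** The lower Ext vanish at p by regularity. If this one did too, so would Hom(R/p, M/xM); but an
    element of M/xM with annihilator p defines a homomorphism surviving at p. *)
Lemma ass_ext_nonzero p (x : seq R) : loc_regular M p x -> all_in x p ->
  is_ass (seq_set M x) p -> ~ ext_zero p (quotmod (ideal_of p)) M (size x).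
Proof.
move=> xreg px [u uP] Z.
have pL a : a \in p -> forall z : quotmod (ideal_of p), a *: z = 0.
  move=> pa z; have [b <-] := qpi_surj z; rewrite -linearZ; apply/qpi_eq0/mem_mk_submod.
  exact: inMr.
have Z0 : ext_zero p (quotmod (ideal_of p)) (quotmod (seq_submod M x)) 0.
  apply: (ext_zero_quot xreg (leqnn _)) => // j; rewrite leq_eqVlt => /predU1P[->//|jx].
  by apply: (ext_zero_regular xreg) => // a /px; exact: pL.
have gL : linear (fun a : R^o => (a : R) *: qpi (seq_submod M x) u).
  by move=> a b c; rewrite scalerDl -scalerA.
have [||f fP] := @factor_linear R R^o (quotmod (ideal_of p)) (quotmod (seq_submod M x)) (qpi (ideal_of p))
    (mk_linear gL : {linear R^o -> quotmod (seq_submod M x)}).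
- exact: qpi_surj.
- move=> a /qpi_eq0 /mem_mk_submod pa; rewrite -[LHS]/((a : R) *: qpi _ u) -linearZ.
  by apply/qpi_eq0; exact/(uP a).
have f1 : f (qpi (ideal_of p) 1) = qpi (seq_submod M x) u.
  by rewrite fP -[LHS]/((1 : R) *: qpi (seq_submod M x) u) scale1r.
have [s /negP ps s0] := Z0 f; apply/ps/uP; apply/(qpi_eq0 (seq_submod M x)).
have h1 : s *: f (qpi (ideal_of p) 1) = 0 by exact: s0.
by rewrite f1 -linearZ in h1.
Qed.

End Sequences.

(** * Classes in Ext as maps on syzygies *)

Section ExtElements.
Variables (L M : lmodType R) (n : nat).

Lemma resol_kernel (v : resol L n) : free_eval v = 0 -> exists z : resol L n.+1, v = resol_diff z.
Proof.
move=> /incl_exact[k kv]; have [z zk] := free_eval_surj (k : syzygy L n.+1).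
by exists z; rewrite -kv /resol_diff zk.
Qed.

Lemma eval_diff (z : resol L n.+1) : free_eval (resol_diff z) = 0.
Proof. exact: eval_incl. Qed.

Lemma cocycleP (F : resol L n -> M) : F \in cocycles L M n <->
  exists f : {linear syzygy L n -> M}, forall v, F v = f (free_eval v).
Proof.
split=> [/mem_mk_submod[FL F0]|[f fP]]; last first.
  apply/mem_mk_submod; split=> [a u v|z]; first by rewrite !fP !linearP.
  by rewrite fP eval_diff linear0.
have [||f fP] := @factor_linear R (resol L n) (syzygy L n) M
  (@free_eval R (syzygy L n)) (mk_linear FL : {linear resol L n -> M}).
- exact: free_eval_surj.
- by move=> v /resol_kernel[z ->]; exact: F0.
by exists f => v; rewrite fP.
Qed.

End ExtElements.

Lemma coboundaryP L M n (f : {linear syzygy L n -> M}) (F : resol L n -> M) :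
  (forall v, F v = f (free_eval v)) -> F \in coboundaries L M n <-> triv f.
Proof.
case: n f F => [|n] f F FE.
  split=> [/mem_mk_submod F0 z|f0].
    by have [v <-] := free_eval_surj z; rewrite -FE F0.
  by apply/mem_mk_submod; apply/funext => v; rewrite FE f0.
split=> [/mem_mk_submod[g gL FG]|[g gP]].
  exists (mk_linear gL : {linear resol L n -> M}) => z.
  by have [v <-] := free_eval_surj (z : syzygy L n.+1); rewrite -FE FG.
apply/mem_mk_submod; exists g; first exact: linearP.
by apply/funext => v; rewrite FE gP.
Qed.

Definition ext_class L M n (F : submod (cocycles L M n)) : Ext L M n := qpi _ F.

Lemma ext_class_eq0 L M n (F : submod (cocycles L M n)) (f : {linear syzygy L n -> M}) :
  (forall v, submod_val F v = f (free_eval v)) -> ext_class F = 0 <-> triv f.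
Proof.
move=> FE; rewrite -(coboundaryP FE); split=> [/qpi_eq0 /mem_mk_submod //|h].
by apply/qpi_eq0/mem_mk_submod.
Qed.

Lemma ext_zeroP L M n q :
  ext_zero q L M n <-> forall z : Ext L M n, exists2 s, s \notin q & s *: z = 0.
Proof.
split=> [Z z|h f].
  have [F <-] := qpi_surj z; have [f fP] := proj1 (cocycleP _) (valP F).
  have [s qs tr] := Z f; exists s => //; rewrite -linearZ.
  by apply/(@ext_class_eq0 _ _ _ _ (s \*: f)) => // v; rewrite linearZ /= -fP.
have FP : (fun v => f (free_eval v)) \in cocycles L M n by apply/cocycleP; exists f.
have [s qs s0] := h (ext_class (Submod FP)); exists s => //.
apply/(@ext_class_eq0 _ _ _ (s *: Submod FP) (s \*: f)); last by rewrite /ext_class linearZ.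
by move=> v; rewrite linearZ.
Qed.

(** Composition with [b] maps Hom(K, M) onto Ext, as f and f a b differ by a trivial cocycle; and
    Hom(K, M) embeds in a finite power of M through the values at generators of K. *)
Lemma noeth_ext L M n : noetherian R -> noeth L -> noeth M -> noeth (Ext L M n).
Proof.
move=> hR nL nM; have [K [a [b [nK abE]]]] := triv_stable M n hR nL.
have homS : submod_set [set f : K -> M | linear f].
  split=> [c u v|c f g fL gL] /=; first by rewrite -[LHS]/0 -[RHS]/(c *: 0 + 0) scaler0 addr0.
  move=> e u v; have E t : (c *: f + g) t = c *: f t + g t by [].
  rewrite !E fL gL !scalerDr !scalerA addrACA; congr (_ *: _ + _ + _).
  by rewrite mulrC.
pose H : lmodType R := submod (mk_submod homS).
have HL (f : H) : linear (submod_val f) by case: f => f hf; exact/(mem_mk_submod homS).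
have nH : noeth H.
  have [s sP] := nK _ (@submod_setT R K).
  have rL : linear (fun (f : H) (j : 'I_(size s)) => submod_val f s`_j) by [].
  apply: (noeth_inj (f := mk_linear rL : {linear H -> 'I_(size s) -> M})); last exact: noeth_ffun.
  move=> f g fg; apply: val_inj; apply/funext => k.
  have /sP /lspanP[c ->] : [set: K] k by [].
  pose fl : {linear K -> M} := mk_linear (HL f).
  pose gl : {linear K -> M} := mk_linear (HL g).
  rewrite -[LHS]/(fl _) -[RHS]/(gl _) !linear_sum; apply: eq_bigr => j _; rewrite !linearZ.
  by congr (_ *: _); exact: (congr1 (fun F => F j) fg).
have FP (f : H) : (fun v => submod_val f (b (free_eval v))) \in cocycles L M n.
  by apply/cocycleP; exists (mk_linear (HL f) \o b).
have tL : linear (fun f : H => ext_class (Submod (FP f))).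
  move=> c f g; rewrite /ext_class -linearP; congr (qpi _ _).
  exact: val_inj.
apply: (noeth_surj (f := mk_linear tL : {linear H -> Ext L M n})) nH.
move=> z; have [F <-] := qpi_surj z; have [f fP] := proj1 (cocycleP _) (valP F).
have hf : (f \o a : K -> M) \in mk_submod homS by apply/mem_mk_submod => e u v; rewrite !linearP.
exists (Submod hf); rewrite -[LHS]/(ext_class (Submod (FP (Submod hf)))) /ext_class.
apply/eqP; rewrite -subr_eq0 -linearB; apply/eqP.
apply/(@ext_class_eq0 _ _ _ _ ((f \o a \o b) \- f)); last exact: abE.
by move=> v; rewrite linearB /= -fP.
Qed.

End ExtVanishing.

(** * Localised and quotient rings *)

Lemma nat_sup_dim (A : comNzRingType) (X : prime_idealr A -> Prop) n : is_dim X n ->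
  nat_sup [set n | exists q, prime_chain X n q] = n%:Z%:E%E.
Proof. by move=> [dle [c cc]]; apply: nat_sup_max => [|k [c' /dle]//]; exists c. Qed.

(** Up to extensional equality, [con] is an order isomorphism from the primes in [XB] to those in
    [XA], so chains correspond. *)
Lemma dim_transfer (A B : comNzRingType) (con : prime_idealr B -> prime_idealr A)
    (XA : prime_idealr A -> Prop) (XB : prime_idealr B -> Prop) n :
  (forall P Q : prime_idealr B, {subset P <= Q} <-> {subset con P <= con Q}) ->
  (forall P, XB P <-> XA (con P)) -> (forall p q : prime_idealr A, XA p -> p =i q -> XA q) ->
  (forall p, XA p -> exists P, con P =i p) -> is_dim XA n -> is_dim XB n.
Proof.
move=> sub XP Xext lift [dle [c [c1 c2]]].
split=> [k C [C1 C2]|].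
  apply: (dle k (con \o C)); split=> i ik /=; first exact/XP/C1.
  by have [h1 h2] := C2 i ik; split; [exact/sub|move=> /sub].
have [P0 _] := lift _ (c1 0%N isT).
have /choice[C CP] : forall i, exists P, (i <= n)%N -> con P =i c i.
  move=> i; have [ik|_] := leqP i n; last by exists P0.
  by have [P PE] := lift _ (c1 i ik); exists P.
exists C; split=> i ik.
  by apply/XP/(Xext (c i)); [exact: c1|move=> a; rewrite CP].
have [h1 h2] := c2 i ik; split; first by apply/sub => a; rewrite !CP ?(ltnW ik) //; exact: h1.
by move=> /sub h; apply: h2 => a; rewrite -!CP ?(ltnW ik) //; exact: h.
Qed.

Section LocalizedPrimes.
Variables (R : comNzRingType) (p : prime_idealr R).
Local Notation Rp := (locring p).

Definition frac (a : R) (s : denom p) : Rp := @locfrac R p R^o a s.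

Lemma fracM a s b t : frac a s * frac b t = frac (a * b) (denomM s t).
Proof. exact: loc_actE. Qed.

Lemma fracD a s b t : frac a s + frac b t = frac (sval t * a + sval s * b) (denomM s t).
Proof. exact: locfracD. Qed.

Lemma frac1 : 1 = frac 1 (denom1 p).
Proof. by []. Qed.

Lemma fracP a s b t : frac a s = frac b t <->
  exists u : denom p, sval u * (sval t * a) = sval u * (sval s * b).
Proof. exact: locfracP. Qed.

Lemma fracE z : exists a s, z = frac a s.
Proof. by exists (repr z).1, (repr z).2; exact: locfracE. Qed.

Lemma frac_eq a s b t : sval t * a = sval s * b -> frac a s = frac b t.
Proof. by move=> e; apply/fracP; exists (denom1 p); rewrite e. Qed.

Lemma frac_scale (M : lmodType R) a s (u : M) t :
  frac a s *: locfrac u t = locfrac (a *: u) (denomM s t).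
Proof. exact: loc_actE. Qed.

Section Contraction.
Variable Q : prime_idealr Rp.

Fact contract_submod : submod_set [set a : R^o | frac a (denom1 p) \in Q].
Proof.
split=> [|a u v /= Qu Qv]; first exact: rpred0.
have -> : frac (a *: u + v) (denom1 p) = frac a (denom1 p) * frac u (denom1 p) + frac v (denom1 p).
  by rewrite fracM fracD; apply: frac_eq; rewrite /= ?(mulr1, mul1r).
by rewrite rpredD // inMl.
Qed.

Fact contract1 : ~ [set a : R^o | frac a (denom1 p) \in Q] 1.
Proof. by rewrite /= -frac1 idealr1. Qed.

Fact contract_prime (a b : R) : frac (a * b) (denom1 p) \in Q ->
  frac a (denom1 p) \in Q \/ frac b (denom1 p) \in Q.
Proof.
have -> : frac (a * b) (denom1 p) = frac a (denom1 p) * frac b (denom1 p).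
  by rewrite fracM; apply: frac_eq; rewrite /= ?(mulr1, mul1r).
by rewrite prime_idealrM => /orP.
Qed.

Definition contract : prime_idealr R := mk_prime contract_submod contract1 contract_prime.

Lemma mem_contract a s : a \in contract <-> frac a s \in Q.
Proof.
split=> [/mem_mk_prime h|h].
  have -> : frac a s = frac 1 s * frac a (denom1 p).
    by rewrite fracM; apply: frac_eq; rewrite /= ?(mulr1, mul1r).
  exact: inMl.
apply/mem_mk_prime => /=.
have -> : frac a (denom1 p) = frac (sval s) (denom1 p) * frac a s.
  by rewrite fracM; apply: frac_eq; rewrite /= ?(mulr1, mul1r).
exact: inMl.
Qed.

Lemma contract_sub : {subset contract <= p}.
Proof.
move=> a /mem_mk_prime /= Qa; apply: contrapT => /negP pa.
have /negP[] := notin1 Q.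
have -> : 1 = frac 1 (exist (fun s => is_true (s \notin p)) a pa) * frac a (denom1 p).
  by rewrite fracM frac1; apply: frac_eq; rewrite /= ?(mulr1, mul1r).
exact: inMl.
Qed.

End Contraction.

Lemma contract_subset (P Q : prime_idealr Rp) :
  {subset P <= Q} <-> {subset contract P <= contract Q}.
Proof.
split=> h => [a /(mem_contract P _ (denom1 p)) /h /(mem_contract Q)//|z].
by have [a [s ->]] := fracE z => /mem_contract /h /mem_contract.
Qed.

Section Extension.
Variables (q : prime_idealr R) (qp : {subset q <= p}).

Let ext : set Rp^o := [set z | exists a s, a \in q /\ z = frac a s].

Fact ext_frac a s : ext (frac a s) <-> a \in q.
Proof.
split=> [[b [t [qb /fracP[u e]]]]|qa]; last by exists a, s.
have : sval u * (sval t * a) \in q by rewrite e; do 2 apply: inMl.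
have qn (v : denom p) : sval v \notin q by apply: contra (valP v); exact: qp.
by rewrite !prime_idealrM (negbTE (qn u)) (negbTE (qn t)).
Qed.

Fact ext_submod : submod_set ext.
Proof.
split=> [|z _ _ [a [s [qa ->]]] [b [t [qb ->]]]]; first by apply/ext_frac; exact: rpred0.
have [c [r ->]] := fracE z.
have -> : frac c r *: (frac a s : Rp^o) = frac (c * a) (denomM r s) by exact: fracM.
have -> : (frac (c * a) (denomM r s) : Rp^o) + frac b t
    = frac (sval t * (c * a) + sval (denomM r s) * b) (denomM (denomM r s) t) by exact: fracD.
by apply/ext_frac; rewrite rpredD // !inMl.
Qed.

Fact ext1 : ~ ext 1.
Proof. by move=> /(ext_frac 1 (denom1 p)); rewrite idealr1. Qed.

Fact ext_prime (a b : Rp) : ext (a * b) -> ext a \/ ext b.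
Proof.
have [c [s ->]] := fracE a; have [e [t ->]] := fracE b.
by rewrite fracM => /ext_frac; rewrite prime_idealrM => /orP[] h; [left|right]; apply/ext_frac.
Qed.

Lemma contract_surj : exists Q : prime_idealr Rp, contract Q =i q.
Proof.
exists (mk_prime ext_submod ext1 ext_prime) => a; apply/idP/idP.
  by move=> /(mem_contract _ _ (denom1 p)) /mem_mk_prime /ext_frac.
by move=> qa; apply/(mem_contract _ _ (denom1 p))/mem_mk_prime/ext_frac.
Qed.

End Extension.

Section LocalizedModule.
Variable M : lmodType R.

Lemma locfrac_eq0 (u : M) (s : denom p) : locfrac u s = 0 <-> sat p [set 0 : M] u.
Proof.
rewrite locfrac0; split=> [/locfracP[[c pc]] /=|[c pc /= cu]].
  by rewrite scale1r !scaler0 => cu; exists c.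
by apply/locfracP; exists (exist (fun s => is_true (s \notin p)) c pc);
  rewrite /= scale1r cu !scaler0.
Qed.

Lemma locmodE (z : locmod p M) : exists u s, z = locfrac u s.
Proof. by exists (repr z).1, (repr z).2; exact: locfracE. Qed.

(** Localising M_p at Q is localising M at the contraction of Q. *)
Lemma supp_locmod Q : supp (locmod p M) Q <-> in_supp [set 0 : M] (contract Q).
Proof.
rewrite supp_in_supp; split=> [[z nz]|[u nu]].
  have [u [t zE]] := locmodE z.
  exists u => -[c nc /= cu]; apply: nz; exists (frac c (denom1 p)).
    by apply: contra nc => h; apply/mem_contract; exact: h.
  by rewrite /= zE frac_scale cu; apply/locfrac_eq0/sub_sat.
exists (locfrac u (denom1 p)) => -[z].
have [c [s ->]] := fracE z => nc /=; rewrite frac_scale => /locfrac_eq0[d pd /= dcu].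
apply: nu; exists (d * c); last by rewrite /= -scalerA.
apply: notinM; first by apply: contra pd; exact: contract_sub.
by apply: contra nc => /mem_contract; apply.
Qed.

Lemma ht_dim h : is_dim (fun q => in_supp [set 0 : M] q /\ {subset q <= p}) h -> ht M p = h%:Z%:E%E.
Proof.
move=> hd; apply: nat_sup_dim.
apply: (dim_transfer (con := contract) _ _ _ _ hd); first exact: contract_subset.
- by move=> P; rewrite supp_locmod; split=> [|[]//]; split=> //; exact: contract_sub.
- move=> r q [rS rp] rq; split; last by move=> a; rewrite -rq; exact: rp.
  by apply: in_supp_up rS => a; rewrite rq.
- by move=> q [_ qp]; exact: contract_surj.
Qed.

(** [X] agrees with [x] up to unit factors of R_p. *)
Definition assoc_seq (X : seq Rp) (x : seq R) :=
  size X = size x /\ forall i, (i < size x)%N -> exists s, X`_i = frac x`_i s.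

Lemma assoc_take X x i : assoc_seq X x -> assoc_seq (take i X) (take i x).
Proof.
move=> [sz h]; split=> [|j]; first by rewrite !size_take sz.
by rewrite size_take_min leq_min => /andP[ji jx]; rewrite !nth_take //; exact: h.
Qed.

Lemma seq_set_locmod X x : assoc_seq X x -> forall u s,
  seq_set (locmod p M) X (locfrac u s) <-> sat p (seq_set M x) u.
Proof.
elim/last_ind: x X => [|x a IH] X.
  by move=> [/size0nil -> _] u s; rewrite !seq_set_nil; exact: locfrac_eq0.
case/lastP: X => [|X A] [sz h]; first by move: sz; rewrite size_rcons.
have {}sz : size X = size x by move: sz; rewrite !size_rcons => -[].
have hX : assoc_seq X x.
  split=> // i ix; have := h i; rewrite size_rcons !nth_rcons sz ix; apply; exact: leqW.
have [t AE] : exists t, A = frac a t.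
  by have := h (size x); rewrite size_rcons !nth_rcons sz ltnn eqxx; apply.
have hS := submod_seq (locmod p M) X; have hs := submod_seq M x.
have hN := submod_sum hs (submod_mul (V := M) a).
move=> u s; rewrite !seq_set_rcons; split.
  move=> [y Xy [_ [w ->] uE]].
  have [v [r yE]] := locmodE y.
  have [w' [r' wE]] := locmodE w.
  rewrite yE in Xy; move: Xy => /(IH X hX) vs.
  move: uE; rewrite yE wE AE frac_scale locfracD => /locfracP[c e].
  apply: (sat_scale (c := sval c * sval (denomM r (denomM t r')))).
    by apply: notinM; [exact: (valP c)|exact: (valP (denomM r (denomM t r')))].
  rewrite -scalerA e; have hsN := submod_sat p hN.
  apply: submod_setZ => //; apply: submod_setZ => //; apply: submod_setD => //.
    apply: submod_setZ => //; apply: sat_mono vs; apply: sum_setl; exact: submod_mul.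
  apply: submod_setZ => //; apply: sub_sat; apply: sum_setr => //; by exists w'.
move=> [c pc [v xv [_ [w ->] cE]]].
have hSA := submod_sum hS (submod_mul (V := locmod p M) A).
have -> : locfrac u s = frac 1 (exist (fun s => is_true (s \notin p)) c pc) *: locfrac (c *: u) s.
  by rewrite frac_scale; apply: locfrac_eq; rewrite /= scale1r !scalerA mulrC.
apply: submod_setZ => //; rewrite cE.
have -> : locfrac (v + a *: w) s = locfrac v s + A *: locfrac (sval t *: w) s.
  rewrite AE frac_scale locfracD; apply: locfrac_eq; rewrite /= !scalerDr !scalerA.
  by congr (_ *: _ + _ *: _); ring.
exists (locfrac v s); first by apply/(IH X hX)/sub_sat.
by exists (A *: locfrac (sval t *: w) s) => //; exists (locfrac (sval t *: w) s).
Qed.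

Lemma regular_seq_locmod X x : assoc_seq X x ->
  regular_seq (locmod p M) X <-> loc_regular M p x /\ in_supp (seq_set M x) p.
Proof.
move=> hX; have sz := hX.1.
have q0 Y y u s : assoc_seq Y y ->
    qpi (seq_submod (locmod p M) Y) (locfrac u s) = 0 <-> sat p (seq_set M y) u.
  by move=> hY; rewrite -(seq_set_locmod hY u s); exact: qpi_eq0.
split=> [[reg [z z0]]|[reg [u nu]]]; split.
- move=> i ix u xu; have hT := assoc_take i hX; apply/(q0 _ _ _ (denom1 p) hT).
  apply: reg; rewrite ?sz // -linearZ; have [t ->] := hX.2 i ix.
  by rewrite frac_scale; apply/(q0 _ _ _ _ hT)/sub_sat.
- have [w wE] := qpi_surj z.
  have [u [s uE]] := locmodE w.
  by exists u => /(q0 _ _ _ s hX) h; move/eqP: z0; apply; rewrite -wE uE.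
- move=> i; rewrite sz => ix z; have hT := assoc_take i hX; have [w <-] := qpi_surj z.
  have [v [s wE]] := locmodE w; rewrite wE.
  rewrite -linearZ; have [t ->] := hX.2 i ix; rewrite frac_scale => /(q0 _ _ _ _ hT)[c pc].
  rewrite scalerA mulrC -scalerA => /(reg i ix) h; apply/(q0 _ _ _ _ hT); exact: sat_scale h.
- exists (qpi _ (locfrac u (denom1 p))); apply/eqP => /(q0 _ _ _ _ hX); exact: nu.
Qed.

(** Passing to numerators turns the depth of M_p into a statement over R. *)
Lemma depth_locP n :
  (exists X : seq Rp, [/\ size X = n, {subset X <= loc_max p} & regular_seq (locmod p M) X]) <->
  (exists x : seq R, [/\ size x = n, all_in x p, loc_regular M p x & in_supp (seq_set M x) p]).
Proof.
split=> [[X [sz Xm Xreg]]|[x [sz px xreg xS]]].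
  have [x hx px] : exists2 x, assoc_seq X x & all_in x p.
    elim: (X) Xm => [|A Y IH] Xm; first by exists [::].
    have /asboolP[a [s [pa AE]]] := Xm A (mem_head _ _).
    have [|x [sx hx] px] := IH; first by move=> y yY; apply: Xm; rewrite inE yY orbT.
    exists (a :: x); last by move=> b; rewrite inE => /predU1P[->|/px].
    by split=> [|[|i]] /=; [rewrite sx|exists s|exact: hx].
  exists x; have [? ?] := proj1 (regular_seq_locmod hx) Xreg.
  by split=> //; rewrite -hx.1.
have hx : assoc_seq [seq frac a (denom1 p) | a <- x] x.
  by split=> [|i ix]; [rewrite size_map|exists (denom1 p); rewrite (nth_map 0)].
exists [seq frac a (denom1 p) | a <- x]; split; first by rewrite size_map.
  by move=> _ /mapP[a ax ->]; apply/asboolP; exists a, (denom1 p); split=> //; exact: px.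
exact/(regular_seq_locmod hx).
Qed.

End LocalizedModule.
End LocalizedPrimes.

(** * Primes of R/q *)

Section QuotientPrimes.
Variables (R : comNzRingType) (q : prime_idealr R).
Local Notation Rq := {ideal_quot q}.

Definition rpi (a : R) : Rq := \pi_Rq a.

Lemma rpiP a b : rpi a = rpi b <-> a - b \in q.
Proof. by rewrite Quotient.idealrBE; split=> /eqP. Qed.

Lemma rpi_surj z : exists a, z = rpi a.
Proof. by exists (repr z); rewrite /rpi reprK. Qed.

Lemma rpiM a b : rpi a * rpi b = rpi (a * b).
Proof. by rewrite /rpi rmorphM. Qed.

Lemma rpiD a b : rpi a + rpi b = rpi (a + b).
Proof. by rewrite /rpi rmorphD. Qed.

Section Contraction.
Variable Q : prime_idealr Rq.

Fact qcontract_submod : submod_set [set a : R^o | rpi a \in Q].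
Proof.
split=> [|a u v /= Qu Qv]; first by rewrite /= /rpi rmorph0 rpred0.
by rewrite -rpiD -rpiM rpredD // inMl.
Qed.

Fact qcontract1 : ~ [set a : R^o | rpi a \in Q] 1.
Proof. by rewrite /= /rpi rmorph1 idealr1. Qed.

Fact qcontract_prime (a b : R) : rpi (a * b) \in Q -> rpi a \in Q \/ rpi b \in Q.
Proof. by rewrite -rpiM prime_idealrM => /orP. Qed.

Definition qcontract : prime_idealr R := mk_prime qcontract_submod qcontract1 qcontract_prime.

Lemma mem_qcontract a : a \in qcontract <-> rpi a \in Q.
Proof. exact: mem_mk_prime. Qed.

Lemma qcontract_sup : {subset q <= qcontract}.
Proof.
move=> a qa; apply/mem_qcontract; suff -> : rpi a = rpi 0 by rewrite /rpi rmorph0 rpred0.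
by apply/rpiP; rewrite subr0.
Qed.

End Contraction.

Lemma qcontract_subset (P Q : prime_idealr Rq) :
  {subset P <= Q} <-> {subset qcontract P <= qcontract Q}.
Proof.
split=> h => [a /mem_qcontract /h /mem_qcontract//|z].
by have [a ->] := rpi_surj z => /mem_qcontract /h /mem_qcontract.
Qed.

Section Extension.
Variables (p : prime_idealr R) (qp : {subset q <= p}).

Lemma mem_quot_image a : rpi a \in quot_image q p <-> a \in p.
Proof.
split=> [/asboolP[b pb /rpiP /qp h]|pa]; last by apply/asboolP; exists a.
by rewrite -[a](subrK b) rpredD.
Qed.

Let ext : set Rq^o := [set z | (z : Rq) \in quot_image q p].

Fact qext_submod : submod_set ext.
Proof.
split=> [|z u v].
  have -> : 0 = rpi 0 :> Rq by rewrite /rpi rmorph0.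
  by apply/mem_quot_image; exact: rpred0.
have [a ->] := rpi_surj z; have [b ->] := rpi_surj u; have [c ->] := rpi_surj v.
move=> /mem_quot_image pb /mem_quot_image pc.
have -> : rpi a *: (rpi b : Rq^o) + rpi c = rpi (a * b + c) by rewrite -rpiD -rpiM.
by apply/mem_quot_image; rewrite rpredD // inMl.
Qed.

Fact qext1 : ~ ext 1.
Proof.
have -> : 1 = rpi 1 :> Rq by rewrite /rpi rmorph1.
by move=> /mem_quot_image; rewrite idealr1.
Qed.

Fact qext_prime (a b : Rq) : ext (a * b) -> ext a \/ ext b.
Proof.
have [c ->] := rpi_surj a; have [e ->] := rpi_surj b; rewrite rpiM => /mem_quot_image.
by rewrite prime_idealrM => /orP[] h; [left|right]; apply/mem_quot_image.
Qed.

Lemma qcontract_surj : exists Q : prime_idealr Rq, qcontract Q =i p.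
Proof.
exists (mk_prime qext_submod qext1 qext_prime) => a; apply/idP/idP.
  by move=> /mem_qcontract /mem_mk_prime /mem_quot_image.
by move=> pa; apply/mem_qcontract/mem_mk_prime/mem_quot_image.
Qed.

End Extension.

Lemma krull_dim_quot n : is_dim (fun p => {subset q <= p}) n -> krull_dim Rq = n%:Z%:E%E.
Proof.
move=> hd; apply: nat_sup_dim.
apply: (dim_transfer (con := qcontract) _ _ _ _ hd); first exact: qcontract_subset.
- by move=> P; split=> // _; exact: qcontract_sup.
- by move=> p r qp pr a /qp; rewrite pr.
- by move=> p qp; exact: qcontract_surj.
Qed.

(** Chains counted by [height] end exactly at the image of p. A longest chain below p does so, since
    otherwise p could be added at its top. *)
Lemma height_quot (p : prime_idealr R) n : {subset q <= p} ->
  is_dim (fun r => {subset q <= r} /\ {subset r <= p}) n ->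
  height (quot_image q p) = n%:Z%:E%E.
Proof.
move=> qp hd.
have [Q QE] := qcontract_surj qp.
have QI : Q =i quot_image q p.
  move=> z; have [a ->] := rpi_surj z; apply/idP/idP => [/mem_qcontract|].
    by rewrite QE => pa; apply/(mem_quot_image qp).
  by move=> /(mem_quot_image qp); rewrite -QE => /mem_qcontract.
have [dle [C cC]] : is_dim (fun P => {subset P <= Q}) n.
  apply: (dim_transfer (con := qcontract) _ _ _ _ hd); first exact: qcontract_subset.
  - move=> P; rewrite qcontract_subset; split=> [h|[_ h] a /h]; last by rewrite QE.
    by split=> [|a /h]; [exact: qcontract_sup|rewrite QE].
  - move=> r t [h1 h2] rt; split=> a; first by rewrite -rt; exact: h1.
    by rewrite -rt; exact: h2.
  - by move=> r [qr _]; exact: qcontract_surj.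
apply: nat_sup_max => [|k [c [cc cE]]].
  exists C; split; first exact: prime_chainW cC.
  have CQ := cC.1 n (leqnn n).
  have [QC|nQC] := pselect ({subset Q <= C n}).
    by move=> z; rewrite -QI; apply/idP/idP => [/CQ|/QC].
  have := dle _ _ (prime_chain_snoc (q := Q) cC (fun z h => h) (conj CQ nQC)).
  by rewrite ltnn.
apply: (dle k c); split=> i ik; last exact: cc.2.
by move=> z zc; rewrite QI -cE; apply: (prime_chain_le cc ik (leqnn k)).
Qed.

End QuotientPrimes.

(** * Serre classes and unmixedness *)

Section SerreClasses.
Variables (R : comNzRingType) (S : lmodType R -> Prop).
Hypothesis hS : serre_class S.
Implicit Types (L M N E : lmodType R) (p q : prime_idealr R).

Lemma serre_sub L M (f : {linear L -> M}) : injective f -> S M -> S L.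
Proof.
move=> fi SM; have hN : submod_set [set y | exists x, y = f x].
  split=> [|a _ _ [u ->] [v ->]]; first by exists 0; rewrite linear0.
  by exists (a *: u + v); rewrite linearP.
have [h _] := hS.2 L M (quotmod (mk_submod hN)) f (qpi _) fi
   (fun y => iff_trans (qpi_eq0 (mk_submod hN) y) (mem_mk_submod hN y)) (@qpi_surj _ _ _).
by have [] := h SM.
Qed.

Lemma serre_quo M N (g : {linear M -> N}) : (forall z, exists y, g y = z) -> S M -> S N.
Proof.
move=> gs SM; have hK : submod_set [set y | g y = 0].
  split=> [|a u v /= u0 v0] /=; first by rewrite linear0.
  by rewrite linearP u0 v0 scaler0 addr0.
pose i : {linear submod (mk_submod hK) -> M} := @submod_val _ _ _.
have iK y : g y = 0 <-> exists x, y = i x.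
  split=> [y0|[[x hx] ->]]; last exact/(mem_mk_submod hK).
  by exists (Submod (proj2 (mem_mk_submod hK y) y0)).
by have [h _] := hS.2 _ _ _ i g val_inj iK gs; have [] := h SM.
Qed.

Lemma serre_prime_mono p q : {subset q <= p} ->
  S (quotmod (ideal_of q)) -> S (quotmod (ideal_of p)).
Proof.
move=> qp; have [||f fP] := @factor_linear R R^o (quotmod (ideal_of q)) (quotmod (ideal_of p))
    (qpi (ideal_of q)) (qpi (ideal_of p)).
- exact: qpi_surj.
- by move=> a /qpi_eq0 /mem_mk_submod qa; apply/qpi_eq0/mem_mk_submod; exact: qp.
apply: (serre_quo (g := f)) => z; have [a <-] := qpi_surj z.
by exists (qpi _ a); rewrite fP.
Qed.

(** If nothing outside q kills e, the annihilator I of e lies in q, so R/I embeds in E and maps onto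
    R/q. *)
Lemma serre_torsion E q : S E -> ~ S (quotmod (ideal_of q)) ->
  forall e : E, exists2 s, s \notin q & s *: e = 0.
Proof.
move=> SE nq e; apply: contrapT => h; apply: nq.
have gL : linear (fun a : R^o => (a : R) *: e) by move=> a b c; rewrite scalerDl -scalerA.
pose g : {linear R^o -> E} := mk_linear gL.
have hI := submod_ann e (@submod_set_zero R E).
pose I := mk_submod hI.
have [||f fP] := @factor_linear R R^o (quotmod I) E (qpi I) g.
- exact: qpi_surj.
- by move=> a /qpi_eq0 /(mem_mk_submod hI).
have SI : S (quotmod I).
  apply: (serre_sub (f := f)) SE => y z; have [a <-] := qpi_surj y; have [b <-] := qpi_surj z.
  rewrite !fP => /eqP; rewrite -subr_eq0 -linearB => /eqP e0.
  apply/eqP; rewrite -subr_eq0 -linearB; apply/eqP/qpi_eq0/(mem_mk_submod hI).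
  exact: e0.
have [||k kP] := @factor_linear R R^o (quotmod I) (quotmod (ideal_of q)) (qpi I) (qpi (ideal_of q)).
- exact: qpi_surj.
- move=> a /qpi_eq0 /(mem_mk_submod hI) ae; apply/qpi_eq0/mem_mk_submod.
  by apply: contrapT => /negP qa; apply: h; exists a.
apply: (serre_quo (g := k)) SI => z; have [a <-] := qpi_surj z.
by exists (qpi _ a); rewrite kP.
Qed.

Variables (m : prime_idealr R) (hR : noetherian R) (hm : local_ring m).

(** Take a maximal submodule [A] in S. If it is proper, some w has prime annihilator q modulo [A].
    Here R/q is in S, since otherwise an element outside q would kill w; so A + Rw, an extension of
    a quotient of R/q by [A], is in S as well. *)
Lemma serre_criterion E : noeth E ->
  (forall q, ~ S (quotmod (ideal_of q)) -> forall e : E, exists2 s, s \notin q & s *: e = 0) ->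
  S E.
Proof.
move=> nE htor.
pose P (A : set E) := exists hA : submod_set A, S (submod (mk_submod hA)).
have [|A [_ [hA SA] Amax]] := @noeth_max _ _ P nE.
  exists [set 0]; first exact: submod_set_zero.
  have [W SW] := hS.1; exists (@submod_set_zero R E).
  apply: (serre_sub (f := \0 : {linear _ -> W})) SW => -[x hx] [y hy] _; apply: val_inj => /=.
  by move: hx hy => /(mem_mk_submod (submod_set_zero _)) -> /(mem_mk_submod (submod_set_zero _)) ->.
suff AT u : A u.
  pose i : {linear submod (mk_submod hA) -> E} := @submod_val _ _ _.
  apply: (serre_quo (g := i)) SA => u.
  by exists (Submod (proj2 (mem_mk_submod hA u) (AT u))).
apply: contrapT => Au; have {}Au : ~ sat m A u by move=> /(sat_max hR hm hA).
have [q [c [_ qP]]] := exists_ass hR hA Au; set w := c *: u in qP.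
have SQ : S (quotmod (ideal_of q)).
  apply: contrapT => /htor /(_ w) [s /negP qs sw]; apply/qs/qP; rewrite sw; exact: submod_set0.
have hA' := submod_sum hA (submod_cyc w).
have AA' : A `<=` sum_set A (cyc w) by apply: sum_setl; exact: submod_cyc.
have Aw' : sum_set A (cyc w) w by apply: sum_setr => //; exact: cyc_id.
suff Aw : A w by have /negP[] := notin1 q; apply/qP; rewrite scale1r.
apply: (Amax _ hA' _ AA' w Aw'); exists hA'.
pose i' : {linear submod (mk_submod hA') -> E} := @submod_val _ _ _.
have [|f fP] := @lift_inj R (submod (mk_submod hA)) (submod (mk_submod hA')) E i'
    (@submod_val _ _ _) val_inj.
  move=> [v hv]; have Av' : v \in mk_submod hA' by apply/(mem_mk_submod hA')/AA'/(mem_mk_submod hA).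
  by exists (Submod Av').
pose Q := subquot (mk_submod hA') (mk_submod hA).
pose hres := restrict_subproof (mk_submod hA') (mk_submod hA).
pose g : {linear submod (mk_submod hA') -> Q} := qpi (mk_submod hres).
apply/(hS.2 _ _ _ f g); last split.
- move=> x y /(congr1 i'); rewrite !fP => h; exact: val_inj.
- move=> y; split=> [/qpi_eq0 /(mem_mk_submod hres) Ay|[x ->]].
    exists (Submod (Ay : submod_val y \in mk_submod hA)).
    by have /val_inj : i' y = i' (f (Submod (Ay : submod_val y \in mk_submod hA))) by rewrite fP.
  apply/qpi_eq0/(mem_mk_submod hres); rewrite /mkset -[submod_val _]/(i' (f x)) fP.
  exact: (valP x).
- exact: qpi_surj.
- exact: SA.
have gL : linear (fun a : R^o => (a : R) *: g (Submod (proj2 (mem_mk_submod hA' w) Aw'))).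
  by move=> a b e; rewrite scalerDl -scalerA.
have [||k kP] := @factor_linear R R^o (quotmod (ideal_of q)) Q (qpi (ideal_of q))
    (mk_linear gL : {linear R^o -> Q}).
- exact: qpi_surj.
- move=> a /qpi_eq0 /mem_mk_submod qa; rewrite -[LHS]/((a : R) *: g _) -linearZ.
  by apply/qpi_eq0/(mem_mk_submod hres)/(mem_mk_submod hA); exact/(qP a).
apply: (serre_quo (g := k)) SQ => z; have [[v hv] <-] := qpi_surj z.
have [n An [_ [b ->] vE]] := proj1 (mem_mk_submod hA' v) hv.
exists (qpi (ideal_of q) (b : R^o)); rewrite kP -[LHS]/((b : R) *: g _) -linearZ.
apply/eqP; rewrite -subr_eq0 -linearB; apply/eqP/qpi_eq0/(mem_mk_submod hres)/(mem_mk_submod hA).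
rewrite -[submod_val _]/(b *: w - v) vE opprD addrCA subrr addr0.
exact: submod_setN.
Qed.

(** * Unmixedness, regular sequences and chains of primes *)

Section Unmixed.
Variables (M : lmodType R) (hM : noeth M) (d : nat).
Hypothesis hd : is_dim (in_supp [set 0 : M]) d.
Local Notation nS p := (~ S (quotmod (ideal_of p))).
Local Notation above p := (fun q : prime_idealr R => {subset p <= q}).
Local Notation below p := (fun q : prime_idealr R => in_supp [set 0 : M] q /\ {subset q <= p}).

Definition unmixed_at x := forall p, is_ass (seq_set M x) p -> nS p ->
  is_dim (above p) (d - size x).

Definition unmixed := forall x, part_sop m M d x -> unmixed_at x.

Lemma dim_above p : exists t, is_dim (above p) t.
Proof. by apply: (exists_dim hR hm); exists p. Qed.

Lemma above_le p t x : in_supp (seq_set M x) p -> part_sop m M d x -> is_dim (above p) t ->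
  (t <= d - size x)%N.
Proof.
move=> pS [_ _ xdim] [_ [c cc]]; apply: (xdim t c); apply: prime_chainW cc => q.
exact: up_closed_supp.
Qed.

(** A zero divisor x_i at q lies in an associated prime p inside q, with R/p outside S since R/q is
    a quotient of it. The chains above p then lie in the support after division by x_i, and are one
    step too long for it. *)
Lemma unmixed_regular x q : part_sop m M d x ->
  (forall i, (i < size x)%N -> unmixed_at (take i x)) -> nS q -> loc_regular M q x.
Proof.
move=> xs xu nq i ix u xN; apply: contrapT => Nu.
have [p [c [pq pP]]] := exists_ass hR (submod_seq M (take i x)) Nu.
have pA : is_ass (seq_set M (take i x)) p by exists (c *: u).
have [_ [C CC]] := xu i ix p pA (fun h => nq (serre_prime_mono pq h)).
have xp : x`_i \in p.
  by apply/pP; rewrite scalerA mulrC -scalerA; apply: submod_setZ => //; exact: submod_seq.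
have [_ szd xdim] := part_sop_take hR hm hM xs ix.
have CC' : prime_chain (in_supp (seq_set M (take i.+1 x))) (d - size (take i x)) C.
  apply: prime_chainW CC => r pr; apply: in_supp_up pr _.
  rewrite seq_set_take //; apply/(supp_add_mul hM); first exact: submod_seq.
  by split=> //; exact: ass_in_supp.
have := xdim _ _ CC'; rewrite !size_takel ?(ltnW ix) // in szd *.
by rewrite leqNgt ltn_sub2l.
Qed.

(** If p has coheight below d - |x|, some y in p extends x inside a system of parameters. The colon
    module for y is in S but contains an element with annihilator p, against [serre_torsion]. *)
Lemma cohen_macaulay_unmixed : S_cohen_macaulay S m M -> unmixed.
Proof.
move=> CM x xs p pA np; have pS := ass_in_supp pA.
split=> [k c cc|].
  have [_ _ xdim] := xs; apply: (xdim k c); apply: prime_chainW cc => q.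
  exact: up_closed_supp.
have [mx xd _] := xs; apply: contrapT => noc.
have {xd} : (size x < d)%N.
  rewrite ltn_neqAle xd andbT; apply/eqP => xd'; apply: noc; rewrite xd' subnn.
  by exists (fun=> p); split=> // i _ a.
move=> xd; have [q c qS pq cc|y py ys] := part_sop_extend hR hm hM (p := p) xs xd.
  by apply: noc; exists c; apply: prime_chainW cc => r qr a /pq; exact: qr.
have [z zs zE] := part_sop_complete hR hm hM hd ys; rewrite size_rcons in zE.
have xz : (size x < size z)%N.
  by rewrite ltnNge; apply/negP => h; have := congr1 size zE;
    rewrite size_rcons take_oversize ?(leqW h) // => e; rewrite -e ltnn in h.
have := CM z zs _ xz.
move: zE; rewrite (take_nth 0) // => /eqP; rewrite eqseq_rcons => /andP[/eqP xE /eqP yE].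
rewrite -xE -yE => SE; have [u uP] := pA.
have Cu : u \in colon (seq_submod M x) y by apply/mem_mk_submod; exact/(uP y).
have [s /negP ps s0] := serre_torsion SE np (qpi _ (Submod Cu)).
apply/ps/uP; move: s0; rewrite -linearZ => /qpi_eq0 /mem_mk_submod.
exact.
Qed.

(** The colon quotients vanish at every q with R/q outside S, by [unmixed_regular], so
    [serre_criterion] applies. *)
Lemma unmixed_cohen_macaulay : unmixed -> S_cohen_macaulay S m M.
Proof.
move=> un x /(sopP hR hm hM hd)[xs _] i ix; apply: serre_criterion => [|q nq e].
  apply: (noeth_surj (f := qpi _)); first exact: qpi_surj.
  exact: (noeth_inj (f := @submod_val _ _ _) val_inj).
have [[u hu] <-] := qpi_surj e.
have xreg : loc_regular M q x.
  by apply: unmixed_regular => // j jx; apply: un; apply: (part_sop_take hR hm hM) => //;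
    exact: ltnW.
have [s qs su] := xreg i ix u (proj1 (mem_mk_submod _ u) hu).
by exists s => //; rewrite -linearZ; apply/qpi_eq0/mem_mk_submod.
Qed.

(** Strong induction on |x|: shorter parts being unmixed, x is M_p-regular, so Ext^|x|(R/p, M) is
    nonzero at p and |x| + dim R/p >= d. The opposite inequality is [above_le]. *)
Lemma ext_zero_unmixed :
  (forall p, in_supp [set 0 : M] p -> nS p -> forall t, is_dim (above p) t ->
     forall j, (j + t < d)%N -> ext_zero p (quotmod (ideal_of p)) M j) ->
  unmixed.
Proof.
move=> H x xs; have [n] := ubnP (size x); elim: n x xs => // n IH x xs xn p pA np.
have pS := ass_in_supp pA; have [Zp px] := proj1 (supp_seq hM x p) pS.
have [t td] := dim_above p.
have tx := above_le pS xs td.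
have xreg : loc_regular M p x.
  apply: unmixed_regular => // i ix; apply: IH.
    by apply: (part_sop_take hR hm hM) => //; exact: ltnW.
  by rewrite size_takel ?(ltnW ix) // -ltnS; exact: leq_trans xn.
have := ass_ext_nonzero hM xreg px pA; have [_ xd _] := xs.
have [e|] := eqVneq t (d - size x)%N; first by rewrite -e.
move=> ne []; apply: (H p Zp np t td).
have : (t < d - size x)%N by rewrite ltn_neqAle ne tx.
by rewrite ltn_subRL.
Qed.

(** Concatenate a chain below p with a longest chain above p, with one more step if they do not
    meet. *)
Lemma dim_below_le (X : prime_idealr R -> Prop) n p t : up_closed X -> dim_le X n -> X p ->
  is_dim (above p) t -> dim_le (fun q => X q /\ {subset q <= p}) (n - t).
Proof.
move=> Xup Xn Xp [_ [c' cc']] k c cc.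
have cX : prime_chain X k c by apply: prime_chainW cc => q [].
have cX' : prime_chain X t c' by apply: prime_chainW cc' => q /(Xup _ _ Xp).
have cp := (cc.1 k (leqnn k)).2; have pc' := cc'.1 0%N isT.
have [h|h] := pselect ({subset c' 0%N <= c k}).
  have E : c k =i c' 0%N by move=> a; apply/idP/idP => [/cp /pc'|/h].
  have := Xn _ _ (prime_chain_cat cX cX' E); have := leq_addl k t.
  by move=> _ kt; rewrite leq_subRL ?(addnC t) //; apply: leq_trans kt; exact: leq_addl.
have cX1 := prime_chain_snoc (q := c' 0%N) cX (cX'.1 0%N isT).
have {}cX1 := cX1 (conj (fun a ha => pc' a (cp a ha)) h).
have := Xn _ _ (prime_chain_cat cX1 cX' _); rewrite ltnn => /(_ (fun=> erefl)) kt.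
have kt' : (k + t <= n)%N by apply: ltnW; rewrite -addSn.
by rewrite leq_subRL ?(addnC t) //; apply: leq_trans kt'; exact: leq_addl.
Qed.

(** [ass_lift] enlarges an associated prime at each division. The inclusion is strict because the
    regular element lies in the new prime and not in the old one. *)
Lemma ass_chain p q z i : loc_regular M p z -> all_in z p -> (i <= size z)%N ->
  is_ass (seq_set M (take i z)) q -> {subset q <= p} ->
  exists c, prime_chain (fun r => {subset q <= r} /\ {subset r <= p}) (size z - i) c.
Proof.
move=> zreg pz iz qA qp; suff H k : (i + k <= size z)%N -> exists2 c,
    prime_chain (fun r => {subset q <= r} /\ {subset r <= p}) k c
    & is_ass (seq_set M (take (i + k) z)) (c k).
  by have [|c cc _] := H (size z - i)%N; [rewrite subnKC|exists c].
elim: k => [_|k IH ik]; first by exists (fun=> q); [split=> // i0 _; split=> // a|rewrite addn0].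
have ik' : (i + k < size z)%N by rewrite -addnS.
have [c cc cA] := IH (ltnW ik').
have [qc cp] := cc.1 k (leqnn k); have xp : z`_(i + k) \in p by apply: pz; exact: mem_nth.
have [r [rA cr xr rp]] := ass_lift hR hM (submod_seq _ _) cA cp xp (zreg _ ik').
exists (fun j => if (j <= k)%N then c j else r); last first.
  by rewrite ltnn addnS seq_set_take.
apply: prime_chain_snoc => //; first by split=> // a /qc /cr.
split=> // rc; have [u uP] := cA.
have : seq_set M (take (i + k) z) (z`_(i + k) *: u) by apply/uP/rc.
by move=> /(zreg _ ik')[s /negP ps /uP /cp].
Qed.

Lemma regular_chain p x : loc_regular M p x -> all_in x p -> in_supp [set 0 : M] p ->
  exists c, prime_chain (below p) (size x) c.
Proof.
move=> xreg px Zp; have [q qp qA] := in_supp_ass hR (@submod_set_zero R M) Zp.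
have [||c cc] := @ass_chain p q x 0 xreg px _ _ qp => //.
  by rewrite take0 seq_set_nil.
exists c; rewrite subn0 in cc; apply: prime_chainW cc => r [qr rp]; split=> //.
by apply: in_supp_up qr _; exact: ass_in_supp.
Qed.

(** Parameters can be chosen in p until dim M/zM has dropped to t. Then p is minimal in Supp(M/zM),
    since a smaller prime would start a chain of length t + 1, and hence p is associated. *)
Lemma part_sop_in p t x : part_sop m M d x -> all_in x p -> in_supp [set 0 : M] p ->
  is_dim (above p) t -> exists z, [/\ part_sop m M d z, size z = (d - t)%N, all_in z p,
     is_ass (seq_set M z) p & take (size x) z = x].
Proof.
move=> xs px Zp td.
have tx : (t <= d - size x)%N by apply: (above_le _ xs td); exact/(supp_seq hM).
have [_ xd _] := xs.
have [z [zs zn pz zx]] : exists z,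
      [/\ part_sop m M d z, size z = (d - t)%N, all_in z p & take (size x) z = x].
  move: {2}(d - t - size x)%N (erefl (d - t - size x)%N) => n.
  elim: n x xs px tx xd => [|n IH] x xs px tx xd nE.
    exists x; split=> //; last by rewrite take_size.
    by move: tx xd nE; lia.
  have xt : (size x < d - t)%N by rewrite -subn_gt0 nE.
  have tx' : (t < d - size x)%N by rewrite ltn_subRL addnC -ltn_subRL.
  have xd' : (size x < d)%N by apply: leq_trans xt (leq_subr _ _).
  have [q c qS pq cc|y py ys] := part_sop_extend hR hm hM (p := p) xs xd'.
    have := td.1 _ _ (prime_chainW (Y := above p) (fun r (qr : {subset q <= r}) a pa =>
      qr a (pq a pa)) cc).
    by rewrite leqNgt tx'.
  have sz : size (rcons x y) = (size x).+1 by rewrite size_rcons.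
  have [||||z [zs zn pz zx]] := IH (rcons x y) ys; rewrite ?sz //.
  - by move=> a; rewrite mem_rcons inE => /predU1P[->|/px].
  - by rewrite subnS -ltnS prednK // subn_gt0.
  - by rewrite subnS nE.
  exists z; split=> //; rewrite sz in zx.
  have : take (size x) (take (size x).+1 z) = take (size x) (rcons x y) by rewrite zx.
  by rewrite take_takel // -cats1 take_size_cat.
exists z; split=> //.
have pS : in_supp (seq_set M z) p by apply/(supp_seq hM).
have [q qp qA] := in_supp_ass hR (submod_seq M z) pS.
have [pq|npq] := pselect ({subset p <= q}).
  by have [u uP] := qA; exists u => a; rewrite -uP; split=> [/pq|/qp].
have [_ _ zdim] := zs; have [_ [c cc]] := td.
have cz : prime_chain (in_supp (seq_set M z)) t c.
  by apply: prime_chainW cc => r pr; exact: in_supp_up pr pS.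
have pc := cc.1 0%N isT.
have := zdim _ _ (prime_chain_cons (q := q) cz (ass_in_supp qA) (conj (fun a qa =>
  pc a (qp a qa)) (fun h => npq (fun a pa => h a (pc a pa))))).
have td' : (t <= d)%N by apply: leq_trans tx (leq_subr _ _).
by rewrite zn subKn // ltnn.
Qed.

End Unmixed.
End SerreClasses.

(** * The equivalences *)

Local Open Scope ereal_scope.

Lemma nat_sup_unbounded (X : set nat) : (forall n, exists2 k, X k & (n < k)%N) ->
  nat_sup X = +oo.
Proof.
move=> Xu; have [k0 Xk0 _] := Xu 0%N.
rewrite /nat_sup /supremum ifF; last by apply/negbTE/set0P; exists (k0%:Z%:E), k0.
have S : supremums [set k%:Z%:E | k in X] +oo.
  split=> [y _|[r| |] ub]; rewrite ?leey //.
    have [k Xk rk] := Xu (absz r); have : k%:Z%:E <= r%:E by apply: ub; exists k.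
    by rewrite lee_fin => ?; lia.
  by have : k0%:Z%:E <= -oo by apply: ub; exists k0.
by case: xgetP => [y _ yS|/(_ _ S)//]; exact: (is_subset1_supremums yS S).
Qed.

(** A finite supremum is attained: the empty set gives -oo and an unbounded one +oo. *)
Lemma nat_supP (X : set nat) n : nat_sup X = n%:Z%:E -> X n.
Proof.
move=> Xn; have [[b bX]|nb] := pselect (exists b, forall k, X k -> (k <= b)%N); last first.
  suff : nat_sup X = +oo by rewrite Xn.
  apply: nat_sup_unbounded => b; apply: contrapT => h; apply: nb; exists b => k Xk.
  by rewrite leqNgt; apply/negP => bk; apply: h; exists k.
have [[k0 Xk0]|X0] := pselect (exists k, X k); last first.
  by move: Xn; rewrite nat_sup0 // => k Xk; apply: X0; exists k.
pose Q k : bool := `[< X k >].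
have [||k /asboolP Xk kmax] := @ex_maxnP Q b; first by exists k0; exact/asboolP.
  by move=> k /asboolP /bX.
move: Xn; rewrite (nat_sup_max Xk); last by move=> l Xl; apply: kmax; exact/asboolP.
by move=> [<-].
Qed.

Lemma infimum_minE (X : set (\bar int)) y : X y -> (forall z, X z -> y <= z) ->
  infimum +oo X = y.
Proof.
move=> Xy ymin; rewrite /infimum ifF; last by apply/negbTE/set0P; exists y.
have S : infimums X y by split=> // z; apply.
by case: xgetP => [z _ zS|/(_ _ S)//]; exact: (is_subset1_infimums zS S).
Qed.

Lemma infimum_nat_lt (X : set nat) n j :
  infimum +oo [set i%:Z%:E | i in X] = n%:Z%:E -> (j < n)%N -> ~ X j.
Proof.
move=> Xn jn Xj; have [k /asboolP Xk kmin] : exists2 k, `[< X k >] & forall l, X l -> (k <= l)%N.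
  have [|k Xk kmin] := @ex_minnP (fun k => `[< X k >]); first by exists j; exact/asboolP.
  by exists k => // l Xl; apply: kmin; exact/asboolP.
move: Xn; rewrite (@infimum_minE _ k%:Z%:E); last 2 first.
- by exists k.
- by move=> _ [l Xl <-]; rewrite lee_fin lez_nat; exact: kmin.
by move=> [kn]; move: (kmin j Xj); rewrite kn leqNgt jn.
Qed.

Lemma natE_add (a b : nat) : a%:Z%:E + b%:Z%:E = (a + b)%N%:Z%:E.
Proof. by rewrite PoszD EFinD. Qed.

Lemma natE_sub (a b : nat) : (b <= a)%N -> a%:Z%:E - b%:Z%:E = (a - b)%N%:Z%:E.
Proof. by move=> ba; rewrite -subzn // EFinB. Qed.

Section Equivalences.
Variables (R : comNzRingType) (m : prime_idealr R) (S : lmodType R -> Prop) (M : lmodType R).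
Hypotheses (hR : noetherian R) (hm : local_ring m) (hS : serre_class S) (hM : noeth M).
Implicit Types (p q : prime_idealr R).
Local Notation nS p := (~ S (quotmod (ideal_of p))).
Local Notation above p := (fun q : prime_idealr R => {subset p <= q}).
Local Notation Z := (in_supp [set 0%R : M]).
Local Notation below p := (fun q : prime_idealr R => Z q /\ {subset q <= p}).

Variable d : nat.
Hypothesis hd : is_dim Z d.

Lemma S_suppP p : S_supp S M p <-> Z p /\ nS p.
Proof. by rewrite /S_supp supp_in_supp. Qed.

Lemma below_le p t : Z p -> is_dim (above p) t -> dim_le (below p) (d - t).
Proof. by move=> Zp td; apply: (dim_below_le (up_closed_supp (N := _)) hd.1 Zp td). Qed.

Lemma above_le_dim p t : Z p -> is_dim (above p) t -> (t <= d)%N.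
Proof.
move=> Zp td; rewrite -[d]subn0; apply: (above_le (x := [::]) _ (part_sop_nil m hd) td).
by rewrite seq_set_nil.
Qed.

Lemma depth_ext_zero p h : depth (loc_max p) (locmod p M) = h%:Z%:E ->
  forall j, (j < h)%N -> ext_zero p (quotmod (ideal_of p)) M j.
Proof.
move=> /nat_supP /depth_locP[x [sz px xreg _]] j jh.
apply: (ext_zero_regular hM xreg); last by rewrite sz.
move=> a ax z; have [b <-] := qpi_surj z; rewrite -linearZ; apply/qpi_eq0/mem_mk_submod.
by apply: inMr; exact: px.
Qed.

Lemma unmixed_seq p t : unmixed S m M d -> Z p -> nS p -> is_dim (above p) t ->
  exists x, [/\ size x = (d - t)%N, all_in x p, loc_regular M p x & is_ass (seq_set M x) p].
Proof.
move=> un Zp np td.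
have [|z [zs zn pz pA _]] := part_sop_in hR hm hM (part_sop_nil m hd) _ Zp td; first by [].
exists z; split=> //; apply: (unmixed_regular hS hR hm hM zs) => // i iz; apply: un.
by apply: (part_sop_take hR hm hM) => //; exact: ltnW.
Qed.

Lemma unmixed_below p t : unmixed S m M d -> Z p -> nS p -> is_dim (above p) t ->
  is_dim (below p) (d - t).
Proof.
move=> un Zp np td; split; first exact: below_le.
have [x [<- px xreg _]] := unmixed_seq un Zp np td.
exact: regular_chain.
Qed.

Lemma unmixed_depth p t : unmixed S m M d -> Z p -> nS p -> is_dim (above p) t ->
  depth (loc_max p) (locmod p M) = (d - t)%N%:Z%:E.
Proof.
move=> un Zp np td; apply: nat_sup_max.
  have [x [sz px xreg pA]] := unmixed_seq un Zp np td.
  by apply/depth_locP; exists x; split=> //; exact: ass_in_supp.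
move=> k /depth_locP[x [<- px xreg _]].
have [c cc] := regular_chain hR hM xreg px Zp.
exact: (below_le Zp td cc).
Qed.

(** The parameters z in p kill R/p and are regular on M_q for every q with R/q outside S, not only
    for q = p, so Ext^j vanishes at all these q. *)
Lemma unmixed_ext p t j : unmixed S m M d -> Z p -> nS p -> is_dim (above p) t ->
  (j < d - t)%N -> S (Ext (quotmod (ideal_of p)) M j).
Proof.
move=> un Zp np td jt; apply: (serre_criterion hS hR hm).
  apply: noeth_ext => //; apply: (noeth_surj (f := qpi _)); first exact: qpi_surj.
  exact: noeth_regular.
move=> q nq; apply/ext_zeroP.
have [|z [zs zn pz _ _]] := part_sop_in hR hm hM (part_sop_nil m hd) _ Zp td; first by [].
have zreg : loc_regular M q z.
  apply: (unmixed_regular hS hR hm hM zs) => // i iz; apply: un.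
  by apply: (part_sop_take hR hm hM) => //; exact: ltnW.
apply: (ext_zero_regular hM zreg); last by rewrite zn.
move=> a az y; have [b <-] := qpi_surj y; rewrite -linearZ; apply/qpi_eq0/mem_mk_submod.
by apply: inMr; exact: pz.
Qed.

Lemma unmixed_ext_neq p t : unmixed S m M d -> Z p -> nS p -> is_dim (above p) t ->
  ~ S (Ext (quotmod (ideal_of p)) M (d - t)).
Proof.
move=> un Zp np td SE; have [x [sz px xreg pA]] := unmixed_seq un Zp np td.
apply: (ass_ext_nonzero hM xreg px pA); rewrite sz; apply/ext_zeroP.
exact: (serre_torsion hS SE np).
Qed.

(** Parameters x in q with q associated to M/xM are extended to z inside p; lifting q through the
    last |z| - |x| = t - u of them gives the chain. *)
Lemma unmixed_between q p t u : unmixed S m M d -> Z q -> nS q -> Z p -> nS p ->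
  {subset q <= p} -> is_dim (above q) t -> is_dim (above p) u ->
  is_dim (fun r : prime_idealr R => {subset q <= r} /\ {subset r <= p}) (t - u).
Proof.
move=> un Zq nq Zp np qp td ud; split.
  apply: (dim_below_le (X := above q) _ td.1 qp ud).
  by move=> r1 r2 h1 h2 a /h1 /h2.
have [|x [xs xn qx qA _]] := part_sop_in hR hm hM (part_sop_nil m hd) _ Zq td; first by [].
have px : all_in x p by move=> a /qx /qp.
have [z [zs zn pz pA xz]] := part_sop_in hR hm hM xs px Zp ud.
have zreg : loc_regular M p z.
  apply: (unmixed_regular hS hR hm hM zs) => // i iz; apply: un.
  by apply: (part_sop_take hR hm hM) => //; exact: ltnW.
have tu : (u <= t)%N.
  have [c cc] := ud.2; apply: (td.1 u c); apply: prime_chainW cc => r pr a /qp; exact: pr.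
have xzs : (size x <= size z)%N by rewrite xn zn leq_sub2l.
have td' := above_le_dim Zq td.
have [|c cc] := ass_chain hR hM zreg pz xzs _ qp; first by rewrite xz.
by exists c; have -> : (t - u = size z - size x)%N by rewrite xn zn; lia.
Qed.

Lemma ht_below p : Z p -> exists2 h, is_dim (below p) h & ht M p = h%:Z%:E.
Proof.
move=> Zp; have [|h hh] := @exists_dim _ m hR hm (below p); first by exists p; split.
by exists h => //; exact: ht_dim.
Qed.

Lemma unmixed_ht p t : unmixed S m M d -> Z p -> nS p -> is_dim (above p) t ->
  ht M p = (d - t)%N%:Z%:E.
Proof. by move=> un Zp np td; apply/ht_dim/unmixed_below. Qed.

Lemma max_in_supp : Z m.
Proof. by have [_ [c cc]] := hd; apply: in_supp_up (cc.1 0%N isT); exact: (sub_max hR hm). Qed.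

Lemma above_max p : p =i m -> is_dim (above p) 0.
Proof.
move=> pm; split; last by exists (fun=> p); split=> // i _ a.
move=> [|k] c // [c1 c2]; have [_ []] := c2 0%N isT.
by move=> a /(sub_max hR hm); rewrite -pm; exact: c1.
Qed.

Lemma below_max p : p =i m -> is_dim (below p) d.
Proof.
move=> pm; have [dle [c cc]] := hd; split=> [k c' cc'|].
  by apply: (dle k c'); apply: prime_chainW cc' => q [].
exists c; apply: prime_chainW cc => q Zq; split=> // a; rewrite pm; exact: sub_max.
Qed.

Lemma unmixed_of_depth : (forall p t, Z p -> nS p -> is_dim (above p) t ->
    depth (loc_max p) (locmod p M) = (d - t)%N%:Z%:E) -> unmixed S m M d.
Proof.
move=> H; apply: (ext_zero_unmixed hS hR hm hM) => p Zp np t td j jt.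
by apply: (depth_ext_zero (H p t Zp np td)); rewrite ltn_subRL addnC.
Qed.

Lemma cohen_macaulay_depth p t : Z p -> is_dim (above p) t ->
  cohen_macaulay (loc_max p) (locmod p M) ->
  ht M p + krull_dim {ideal_quot p} = mod_dim M ->
  depth (loc_max p) (locmod p M) = (d - t)%N%:Z%:E.
Proof.
move=> Zp td [M0|dep].
  by have [z z0] : supp M p := proj2 (supp_in_supp M p) Zp; rewrite (M0 z) eqxx in z0.
rewrite dep -/(ht M p) (mod_dimE hd) (krull_dim_quot td); have [h _ ->] := ht_below Zp.
by rewrite natE_add => -[<-]; rewrite addnK.
Qed.

Lemma unmixed_local_cohen_macaulay p : unmixed S m M d -> Z p -> nS p ->
  cohen_macaulay (loc_max p) (locmod p M) /\ ht M p + krull_dim {ideal_quot p} = mod_dim M.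
Proof.
move=> un Zp np; have [t td] := dim_above hR hm p.
rewrite (krull_dim_quot td) (mod_dimE hd) (unmixed_ht un Zp np td) natE_add subnK;
  last exact: (above_le_dim Zp td).
by split=> //; right; rewrite (unmixed_depth un Zp np td) -(unmixed_ht un Zp np td).
Qed.

Lemma between_max q p t : Z q -> p =i m -> is_dim (above q) t ->
  is_dim (fun r : prime_idealr R => {subset q <= r} /\ {subset r <= p}) t.
Proof.
move=> Zq pm [dle [c cc]]; split=> [k c' cc'|].
  by apply: (dle k c'); apply: prime_chainW cc' => r [].
by exists c; apply: prime_chainW cc => r qr; split=> // a; rewrite pm; exact: sub_max.
Qed.

Lemma unmixed_S_ht p t : unmixed S m M d -> Z p -> nS p -> is_dim (above p) t ->
  S_ht S M (ideal_of p) = (d - t)%N%:Z%:E.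
Proof.
move=> un Zp np td; apply: infimum_minE.
  exists p; split; [exact/S_suppP| |exact/esym/unmixed_ht].
  by move=> a /mem_mk_submod.
move=> _ [q [/S_suppP[Zq nq] pq ->]]; have [u ud] := dim_above hR hm q.
rewrite (unmixed_ht un Zq nq ud) lee_fin lez_nat leq_sub2l //.
have [c cc] := ud.2; apply: (td.1 u c); apply: prime_chainW cc => r qr a pa.
by apply/qr/pq/mem_mk_submod.
Qed.

Lemma unmixed_Egrade p t : unmixed S m M d -> Z p -> nS p -> is_dim (above p) t ->
  S_Egrade S (ideal_of p) M = (d - t)%N%:Z%:E.
Proof.
move=> un Zp np td; apply: infimum_minE.
  by exists (d - t)%N => //; exact: unmixed_ext_neq.
move=> _ [j nSj <-]; rewrite lee_fin lez_nat leqNgt; apply/negP => jt.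
by apply: nSj; exact: unmixed_ext jt.
Qed.

(** Below the S-grade, which is d - dim R/p, the Ext modules lie in S and therefore vanish at p. *)
Lemma Egrade_unmixed :
  (forall p, S_supp S M p ->
      [/\ S_Egrade S (ideal_of p) M = S_ht S M (ideal_of p),
          S_ht S M (ideal_of p) = ht M p
        & ht M p + krull_dim {ideal_quot p} = mod_dim M]) -> unmixed S m M d.
Proof.
move=> H; apply: (ext_zero_unmixed hS hR hm hM) => p Zp np t td j jt.
have [Eg Sh] := H p (proj2 (S_suppP p) (conj Zp np)).
have [h _ hE] := ht_below Zp; rewrite (mod_dimE hd) (krull_dim_quot td) hE natE_add => -[hd'].
rewrite Sh hE in Eg; have jh : (j < h)%N by lia.
apply/ext_zeroP; apply: (serre_torsion hS _ np).
by apply: contrapT; exact: (infimum_nat_lt Eg jh).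
Qed.

Lemma S_assP N p : S_ass S (quotmod N) p <-> is_ass [set u : M | u \in N] p /\ nS p.
Proof.
split=> -[[z zP] np]; split=> //.
  have [u uE] := qpi_surj z; exists u => a; rewrite zP -uE -linearZ.
  by split=> [/eqP /qpi_eq0|/qpi_eq0 /eqP].
exists (qpi N z) => a; rewrite -linearZ; apply/idP/eqP => [/zP Nz|/qpi_eq0 /zP //].
exact/qpi_eq0.
Qed.

(** The sequences in [part_sop] are exactly the initial segments of systems of parameters. *)
Lemma unmixed_sopP : unmixed S m M d <->
  (forall x, sop m M x -> forall i, (i <= size x)%N ->
      forall p, S_ass S (quotmod (seq_submod M (take i x))) p ->
        krull_dim {ideal_quot p} = mod_dim M - i%:Z%:E).
Proof.
split=> [un x /(sopP hR hm hM hd)[xs sz] i ix p /S_assP[pA np]|H x xs p pA np].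
  have := un _ (part_sop_take hR hm hM xs ix) p pA np; rewrite size_takel // => h.
  by rewrite (krull_dim_quot h) (mod_dimE hd) natE_sub // -sz.
have [z zs xE] := part_sop_complete hR hm hM hd xs; have [_ xd _] := xs.
have [_ sz] := proj1 (sopP hR hm hM hd z) zs.
have := H z zs (size x) _ p; rewrite -xE sz => /(_ xd (proj2 (S_assP _ _) (conj pA np))).
have [t td] := dim_above hR hm p.
by rewrite (krull_dim_quot td) (mod_dimE hd) natE_sub // => -[<-].
Qed.

Lemma unmixed_heights : unmixed S m M d ->
    [/\ forall q p,
          S_supp S M q \/ q =i m -> S_supp S M p \/ p =i m ->
          {subset q <= p} ->
          height (quot_image q p) + ht M q = ht M p,
        forall p, S_supp S M p -> cohen_macaulay (loc_max p) (locmod p M)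
      & forall p, min_primes (S_supp S M) p ->
          krull_dim {ideal_quot p} = mod_dim M].
Proof.
move=> un; split.
- move=> q p hq hp qp; have [t td] := dim_above hR hm q.
  (* R/m may belong to S, so m is treated apart: its coheight is 0 and its height on M is d. *)
  have H r s : S_supp S M r \/ r =i m -> is_dim (above r) s -> Z r /\ ht M r = (d - s)%N%:Z%:E.
    case=> [/S_suppP[Zr nr] sd|rm sd]; first by split=> //; exact: unmixed_ht.
    have -> : s = 0%N by apply: is_dim_inj sd (above_max rm).
    rewrite subn0; split; last exact/ht_dim/below_max.
    by apply: in_supp_up max_in_supp => a; rewrite rm.
  have [Zq htq] := H q t hq td; have [u ud] := dim_above hR hm p.
  have [Zp htp] := H p u hp ud; rewrite htq htp.
  have ut : (u <= t)%N.
    by have [c cc] := ud.2; apply: (td.1 u c); apply: prime_chainW cc => r pr a /qp; exact: pr.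
  have td' := above_le_dim Zq td.
  have -> : height (quot_image q p) = (t - u)%N%:Z%:E.
    apply: height_quot => //.
    case: hp => [/S_suppP[_ np]|pm]; last first.
      by rewrite (is_dim_inj ud (above_max pm)) subn0; exact: between_max.
    case: hq => [/S_suppP[_ nq]|qm]; first exact: unmixed_between.
    have pm : p =i m by move=> a; apply/idP/idP => [/(sub_max hR hm)//|]; rewrite -qm; exact: qp.
    by rewrite (is_dim_inj ud (above_max pm)) subn0; exact: between_max.
  have dE : (t - u + (d - t) = d - u)%N by lia.
  by rewrite natE_add dE.
- by move=> p /S_suppP[Zp np]; have [] := unmixed_local_cohen_macaulay un Zp np.
move=> p [/S_suppP[Zp np] pmin].
have [q qp qA] := in_supp_ass hR (@submod_set_zero R M) Zp.
have nq : nS q by move=> Sq; apply: np; exact: (serre_prime_mono hS qp).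
(* R/q is outside S because R/p is a quotient of it; minimality gives p = q, so p is associated to M
   itself. *)
have pq : {subset p <= q} by apply: pmin => //; apply/S_suppP; split=> //; exact: ass_in_supp.
have pA : is_ass (seq_set M [::]) p.
  by have [u uP] := qA; exists u => a; rewrite seq_set_nil -uP; split=> [/pq|/qp].
have := un _ (part_sop_nil m hd) p pA np; rewrite subn0 => h.
by rewrite (krull_dim_quot h) (mod_dimE hd).
Qed.

(** The height formula for p inside m reads dim R/p + ht_M(p) = dim M. *)
Lemma heights_local_cohen_macaulay :
    [/\ forall q p,
          S_supp S M q \/ q =i m -> S_supp S M p \/ p =i m ->
          {subset q <= p} ->
          height (quot_image q p) + ht M q = ht M p,
        forall p, S_supp S M p -> cohen_macaulay (loc_max p) (locmod p M)
      & forall p, min_primes (S_supp S M) p ->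
          krull_dim {ideal_quot p} = mod_dim M] ->
  forall p, S_supp S M p ->
      cohen_macaulay (loc_max p) (locmod p M) /\
      ht M p + krull_dim {ideal_quot p} = mod_dim M.
Proof.
move=> [H CM _] p pS; split; first exact: CM.
have [Zp _] := proj1 (S_suppP p) pS; have [t td] := dim_above hR hm p.
have pm := sub_max hR hm (p := p).
have := H p m (or_introl pS) (or_intror (fun _ => erefl)) pm.
rewrite (height_quot pm (between_max Zp (fun _ => erefl) td)) (ht_dim (below_max (fun _ => erefl))).
by rewrite (krull_dim_quot td) (mod_dimE hd) => <-; rewrite addeC.
Qed.

Lemma local_cohen_macaulay_unmixed :
  (forall p, S_supp S M p ->
      cohen_macaulay (loc_max p) (locmod p M) /\
      ht M p + krull_dim {ideal_quot p} = mod_dim M) -> unmixed S m M d.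
Proof.
move=> H; apply: unmixed_of_depth => p t Zp np td.
by have [] := H p (proj2 (S_suppP p) (conj Zp np)); exact: cohen_macaulay_depth.
Qed.

Lemma unmixed_depthP :
  (forall p, S_supp S M p ->
      depth (loc_max p) (locmod p M) = mod_dim M - krull_dim {ideal_quot p}) <->
  unmixed S m M d.
Proof.
split=> [H|un p /S_suppP[Zp np]].
  apply: unmixed_of_depth => p t Zp np td.
  rewrite H ?(mod_dimE hd) ?(krull_dim_quot td) ?natE_sub //; last exact/S_suppP.
  exact: (above_le_dim Zp td).
have [t td] := dim_above hR hm p.
rewrite (unmixed_depth un Zp np td) (mod_dimE hd) (krull_dim_quot td) natE_sub //.
exact: (above_le_dim Zp td).
Qed.

End Equivalences.

Lemma zero_module_dim (R : comNzRingType) (M : lmodType R) :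
  ~ (exists p, in_supp [set 0%R : M] p) -> mod_dim M = -oo.
Proof.
move=> h; apply: nat_sup0 => n [c [c1 _]].
by apply: h; exists (c 0%N); apply/supp_in_supp; exact: c1.
Qed.

Theorem theorem3p5 (R : comNzRingType) (m : prime_idealr R)
    (S : lmodType R -> Prop) (M : lmodType R)
    (hR : noetherian R) (hm : local_ring m)
    (hS : serre_class S) (hM : fin_gen M) :
  [<->
    (* (i) *)
    S_cohen_macaulay S m M;
    (* (ii) *)
    forall p, S_supp S M p ->
      cohen_macaulay (loc_max p) (locmod p M) /\
      ht M p + krull_dim {ideal_quot p} = mod_dim M;
    (* (iii) *)
    forall p, S_supp S M p ->
      [/\ S_Egrade S (ideal_of p) M = S_ht S M (ideal_of p),
          S_ht S M (ideal_of p) = ht M p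
        & ht M p + krull_dim {ideal_quot p} = mod_dim M];
    (* (iv) *)
    forall p, S_supp S M p ->
      depth (loc_max p) (locmod p M) = mod_dim M - krull_dim {ideal_quot p};
    (* (v) *)
    forall x, sop m M x ->
      forall i, (i <= size x)%N ->
      forall p, S_ass S (quotmod (seq_submod M (take i x))) p ->
        krull_dim {ideal_quot p} = mod_dim M - i%:Z%:E;
    (* (vi) *)
    [/\ forall q p,
          S_supp S M q \/ q =i m -> S_supp S M p \/ p =i m ->
          {subset q <= p} ->
          height (quot_image q p) + ht M q = ht M p,
        forall p, S_supp S M p -> cohen_macaulay (loc_max p) (locmod p M)
      & forall p, min_primes (S_supp S M) p ->
          krull_dim {ideal_quot p} = mod_dim M]
  ].

Proof.
have {}hM : noeth M := noeth_fin_gen hR hM.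
have [Z|nZ] := pselect (exists p, in_supp [set 0%R : M] p); last first.
  (* Empty support: dim M is -oo, so there are no systems of parameters and S-Supp M is empty. In
     (vi) only p = q = m remains, where both sides are -oo. *)
  have dM := zero_module_dim nZ.
  have nS p : ~ S_supp S M p by move=> [/supp_in_supp pS _]; apply: nZ; exists p.
  have nsop x : ~ sop m M x by rewrite /sop dM => -[].
  tfae.
  - by move=> _ p /nS.
  - by move=> _ p /nS.
  - by move=> _ p /nS.
  - by move=> _ x /nsop.
  - move=> _; split; [|by move=> p /nS|by move=> p [/nS]].
    move=> q p [/nS//|qm] [/nS//|pm] qp.
    have htN r : ht M r = -oo.
      apply: nat_sup0 => n [c [c1 _]]; apply: nZ; exists (contract (c 0%N)).
      exact/supp_locmod/(c1 0%N).
    by rewrite !htN addeNy.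
  - by move=> _ x /nsop.
have [d hd] := exists_dim hR hm Z.
(* Each implication of the cycle passes through [unmixed]. *)
tfae.
- move=> CM p /S_suppP[Zp np]; apply: (unmixed_local_cohen_macaulay hR hm hS hM hd) => //.
  exact: (cohen_macaulay_unmixed hS hR hm hM hd).
- move=> /(local_cohen_macaulay_unmixed hR hm hS hM hd) un p /S_suppP[Zp np].
  have [t td] := dim_above hR hm p;
    have [_ e] := unmixed_local_cohen_macaulay hR hm hS hM hd un Zp np.
  by rewrite (unmixed_Egrade hR hm hS hM hd un Zp np td) (unmixed_S_ht hR hm hS hM hd un Zp np td)
     (unmixed_ht hR hm hS hM hd un Zp np td) in e *.
- by move=> /(Egrade_unmixed hR hm hS hM hd) /(unmixed_depthP hR hm hS hM hd).
- by move=> /(unmixed_depthP hR hm hS hM hd) /(unmixed_sopP S hR hm hM hd).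
- by move=> /(unmixed_sopP S hR hm hM hd) /(unmixed_heights hR hm hS hM hd).
- move=> /(heights_local_cohen_macaulay hR hm hd) /(local_cohen_macaulay_unmixed hR hm hS hM hd).
  exact: (unmixed_cohen_macaulay hS hR hm hM hd).
Qed.
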